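(* Let $p$ and $q$ be odd prime numbers with $p = 2q+1$, and let $r \geq 1$ be an even integer. Then there exist infinitely many pairs of consecutive bi-quadratic fields $\bigl(K_{m,p-1}, K_{m,p}\bigr)$, with $m$ an integer, such that $$Po(K_{m,p-1}) \simeq Po(K_{m,p}) \simeq (\mathbb{Z}/2\mathbb{Z})^{r}.$$
   Context: For non-square integers $m$ and $n$, $K_{m,n}$ denotes the field $\mathbb{Q}(\sqrt{m},\sqrt{n})$. Two bi-quadratic fields are called consecutive if they are of the form $K_{m,n}$ and $K_{m,n+1}$ for some integers $m,n$. For a number field $K$ with ring of integers $\mathcal{O}_K$ and ideal class group $Cl_K$, and for a prime power $q$, let $\Pi_q(K)$ be the product of all prime ideals $\mathfrak{p}$ of $\mathcal{O}_K$ with $N_{K/\mathbb{Q}}\mathfrak{p} = q$; if there are no such prime ideals, set $\Pi_q(K) = \mathcal{O}_K$. The Pólya group $Po(K)$ is the subgroup of $Cl_K$ generated by the ideal classes $[\Pi_q(K)]$ as $q$ ranges over all prime powers. *)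

(* Defs.v *)
From HB Require Import structures.
From mathcomp Require Import all_boot all_order all_algebra all_fingroup all_field.
From mathcomp Require Import generic_quotient.
From mathcomp Require Import boolp classical_sets functions cardinality fsbigop.

Set Implicit Arguments.
Unset Strict Implicit.
Unset Printing Implicit Defensive.

Import Order.TTheory GRing.Theory Num.Theory.
Local Open Scope classical_set_scope.
Local Open Scope ring_scope.
Local Open Scope quotient_scope.

(* A number field is a [K : fieldExtType rat]. Ideals are subsets of [K].     *)
Section Ideals.

Variable K : fieldExtType rat.
Implicit Types (I J P : set K) (x y z : K).

Definition ringOfIntegers : set K := [set x | integralOver (intr : int -> K) x].
Local Notation OK := ringOfIntegers.

Definition is_submodule I :=
  [/\ I 0, forall x y, I x -> I y -> I (x + y)
    & forall a x, OK a -> I x -> I (a * x)].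

Definition is_fractional I :=
  [/\ is_submodule I, exists2 x, I x & x != 0
    & exists d, [/\ OK d, d != 0 & forall x, I x -> OK (d * x)]].

Definition is_prime_ideal P :=
  [/\ is_submodule P, P `<=` OK, ~ P 1
    & forall a b, OK a -> OK b -> P (a * b) -> P a \/ P b].

Definition residues P : set (set K) := [set [set x + y | y in P] | x in OK].

Definition ideal_has_norm P (q : nat) := (residues P #= `I_q)%card.

Definition idealMul I J : set K :=
  [set x | exists n (a b : 'I_n -> K),
     [/\ forall i, I (a i), forall i, J (b i) & x = \sum_i a i * b i]].

Definition idealInv I : set K := [set x | forall y, I y -> OK (x * y)].

Lemma OK0 : OK 0. Proof. exact: integral0. Qed.
Lemma OK1 : OK 1. Proof. exact: integral1. Qed.
Lemma OKD x y : OK x -> OK y -> OK (x + y).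
Proof. exact: integral_add. Qed.
Lemma OKM x y : OK x -> OK y -> OK (x * y).
Proof. exact: integral_mul. Qed.

Lemma sub_sum I n (a : 'I_n -> K) :
  is_submodule I -> (forall i, I (a i)) -> I (\sum_i a i).
Proof. by move=> [I0 ID _] Ia; elim/big_ind: _. Qed.

Lemma idealMul_in I J x y : I x -> J y -> idealMul I J (x * y).
Proof.
move=> Ix Jy; exists 1, (fun=> x), (fun=> y); split=> //.
by rewrite big_ord_recl big_ord0 addr0.
Qed.

Lemma idealMul_min I J S :
  is_submodule S -> (forall x y, I x -> J y -> S (x * y)) -> idealMul I J `<=` S.
Proof. by move=> Ssub H x [n [a [b [Ia Jb ->]]]]; apply: sub_sum => // i; apply: H. Qed.

Lemma idealMul_sub I J : is_submodule I -> is_submodule (idealMul I J).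
Proof.
move=> [I0 ID IM]; split.
- by exists 0, (fun=> 0), (fun=> 0); split; [case | case | rewrite big_ord0].
- move=> x y [n [a [b [Ia Jb ->]]]] [m [c [d [Ic Jd ->]]]].
  exists (n + m)%N, (fun i : 'I_(n + m) => match fintype.split i with inl j => a j | inr j => c j end),
         (fun i : 'I_(n + m) => match fintype.split i with inl j => b j | inr j => d j end).
  split=> [i|i|]; try by case: (fintype.split i).
  rewrite big_split_ord /=; congr (_ + _); apply: eq_bigr => i _.
    by rewrite (unsplitK (inl i)).
  by rewrite (unsplitK (inr i)).
- move=> u x Ou [n [a [b [Ia Jb ->]]]].
  exists n, (fun i => u * a i), b; split=> // [i|]; first exact: IM.
  by rewrite mulr_sumr; apply: eq_bigr => i _; rewrite mulrA.
Qed.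

Lemma idealMulC I J : idealMul I J = idealMul J I.
Proof.
by apply/seteqP; split=> x [n [a [b [Ia Jb ->]]]]; exists n, b, a; split=> //;
   apply: eq_bigr => i _; rewrite mulrC.
Qed.

Lemma scale_sub I x : is_submodule I -> is_submodule [set y | I (x * y)].
Proof.
move=> [I0 ID IM]; split=> /=; first by rewrite mulr0.
  by move=> y z Iy Iz; rewrite mulrDr; apply: ID.
by move=> a y Oa Iy; rewrite mulrCA; apply: IM.
Qed.

Lemma idealMulA I J S : is_submodule I -> is_submodule J -> is_submodule S ->
  idealMul I (idealMul J S) = idealMul (idealMul I J) S.
Proof.
move=> sI sJ sS; apply/seteqP; split.
  apply: idealMul_min; first exact/idealMul_sub/idealMul_sub.
  move=> x z Ix; apply: (@idealMul_min _ _ [set z | idealMul (idealMul I J) S (x * z)]).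
    exact/scale_sub/idealMul_sub/idealMul_sub.
  by move=> y {}z Jy Sz /=; rewrite mulrA; do 2?apply: idealMul_in.
apply: idealMul_min; first exact: idealMul_sub.
move=> z y Hz Sy; rewrite mulrC; move: z Hz.
apply: (@idealMul_min _ _ [set z | idealMul I (idealMul J S) (y * z)]).
  exact/scale_sub/idealMul_sub.
by move=> x z Ix Jz /=; rewrite mulrC -mulrA; do 2?apply: idealMul_in.
Qed.

Lemma OK_sub : is_submodule OK.
Proof. by split; [exact: OK0 | exact: OKD | move=> *; exact: OKM]. Qed.

Lemma idealMul1 I : is_submodule I -> idealMul OK I = I.
Proof.
move=> sI; apply/seteqP; split; last first.
  by move=> x Ix; rewrite -[x]mul1r; apply: idealMul_in => //; exact: OK1.
by apply: idealMul_min => // x y Ox Iy; case: sI => _ _; apply.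
Qed.

Lemma OK_fractional : is_fractional OK.
Proof.
split; [exact: OK_sub | by exists 1; [exact: OK1 | exact: oner_neq0] |].
by exists 1; split; [exact: OK1 | exact: oner_neq0 | move=> x; rewrite mul1r].
Qed.

Lemma idealMul_fractional I J :
  is_fractional I -> is_fractional J -> is_fractional (idealMul I J).
Proof.
move=> [sI [x Ix x0] [d [Od d0 dI]]] [sJ [y Jy y0] [e [Oe e0 eJ]]].
split; first exact: idealMul_sub.
  by exists (x * y); [exact: idealMul_in | rewrite mulf_neq0].
exists (d * e); split; [exact: OKM | by rewrite mulf_neq0 |].
apply: (@idealMul_min _ _ [set z | OK (d * e * z)]).
  exact/scale_sub/OK_sub.
by move=> u v Iu Jv /=; rewrite mulrACA; apply: OKM; [exact: dI | exact: eJ].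
Qed.

Lemma idealInv_fractional I : is_fractional I -> is_fractional (idealInv I).
Proof.
move=> [sI [x Ix x0] [d [Od d0 dI]]]; split.
- split; first by move=> y _; rewrite mul0r; exact: OK0.
    by move=> y z Hy Hz t It; rewrite mulrDl; apply: OKD; [exact: Hy | exact: Hz].
  by move=> a y Oa Hy t It; rewrite -mulrA; apply: OKM => //; exact: Hy.
- by exists d.
- exists (d * x); split; [exact: dI | by rewrite mulf_neq0 |].
  move=> y Hy; rewrite -mulrA; apply: OKM => //.
  by rewrite mulrC; exact: Hy.
Qed.

End Ideals.

Record fracIdeal (K : fieldExtType rat) := FracIdeal {
  fracIdeal_set :> set K;
  fracIdealP : is_fractional fracIdeal_set
}.

HB.instance Definition _ K := gen_eqMixin (fracIdeal K).
HB.instance Definition _ K := gen_choiceMixin (fracIdeal K).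

Section ClassGroup.

Variable K : fieldExtType rat.
Implicit Types I J : fracIdeal K.

Lemma fracIdeal_inj I J : (I = J :> set K) -> I = J.
Proof.
case: I J => [I HI] [J HJ] /= E; rewrite E in HI *.
by congr FracIdeal; exact: Prop_irrelevance.
Qed.

Lemma fracIdeal_submodule I : is_submodule (I : set K).
Proof. by case: (fracIdealP I). Qed.

Definition fone : fracIdeal K := FracIdeal (@OK_fractional K).
Definition fmul I J : fracIdeal K :=
  FracIdeal (idealMul_fractional (fracIdealP I) (fracIdealP J)).
Definition finv I : fracIdeal K :=
  FracIdeal (idealInv_fractional (fracIdealP I)).

Lemma fmulA : associative fmul.
Proof. by move=> I J S; apply: fracIdeal_inj; apply: idealMulA; exact: fracIdeal_submodule. Qed.
Lemma fmulC : commutative fmul.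
Proof. by move=> I J; apply: fracIdeal_inj; exact: idealMulC. Qed.
Lemma fmul1 : left_id fone fmul.
Proof. by move=> I; apply: fracIdeal_inj; apply: idealMul1; exact: fracIdeal_submodule. Qed.

HB.instance Definition _ := Monoid.isComLaw.Build (fracIdeal K) fone fmul
  fmulA fmulC fmul1.

Definition ideal_equiv : rel (fracIdeal K) := fun I J =>
  `[< exists2 x : K, x != 0 & (J : set K) = [set x * y | y in (I : set K)] >].

Lemma ideal_equivP I J :
  reflect (exists2 x : K, x != 0 & forall y, (I : set K) y <-> (J : set K) (x * y))
          (ideal_equiv I J).
Proof.
apply: (iffP (asboolP _)) => -[x x0 H]; exists x => //.
  move=> y; rewrite H; split=> [Iy|[z Iz]]; first by exists y.
  by move/(mulfI x0) <-.
apply/seteqP; split=> y.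
  by move=> Jy; exists (x^-1 * y); [apply/H|]; rewrite mulrA divff ?mul1r.
by move=> [z /H ? <-].
Qed.

Lemma ideal_equiv_refl : reflexive ideal_equiv.
Proof.
by move=> I; apply/ideal_equivP; exists 1; [exact: oner_neq0|move=> y; rewrite mul1r].
Qed.

Lemma ideal_equiv_sym : symmetric ideal_equiv.
Proof.
have half I J : ideal_equiv I J -> ideal_equiv J I.
  move=> /ideal_equivP[x x0 H]; apply/ideal_equivP; exists x^-1.
    by rewrite invr_eq0.
  by move=> y; rewrite H mulrA divff ?mul1r.
by move=> I J; apply/idP/idP; exact: half.
Qed.

Lemma ideal_equiv_trans : transitive ideal_equiv.
Proof.
move=> J I S /ideal_equivP[x x0 H] /ideal_equivP[y y0 G]; apply/ideal_equivP.
by exists (y * x) => [|z]; rewrite ?mulf_neq0 // H G mulrA.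
Qed.

Canonical ideal_equiv_rel :=
  EquivRel ideal_equiv ideal_equiv_refl ideal_equiv_sym ideal_equiv_trans.

Definition idealClass : Type := {eq_quot ideal_equiv}.
HB.instance Definition _ := Choice.on idealClass.
HB.instance Definition _ := EqQuotient.on idealClass.

Definition cl (I : fracIdeal K) : idealClass := \pi_idealClass I.

Lemma cl_eq I J : (cl I = cl J) <-> ideal_equiv I J.
Proof. by split=> /eqmodP. Qed.

Lemma cl_repr (c : idealClass) : cl (repr c) = c.
Proof. exact: reprK. Qed.

Definition clmul (c d : idealClass) : idealClass := cl (fmul (repr c) (repr d)).
Definition clinv (c : idealClass) : idealClass := cl (finv (repr c)).

Lemma fmul_equivl I J S : ideal_equiv I J -> ideal_equiv (fmul I S) (fmul J S).
Proof.
move=> /ideal_equivP[x x0 H]; apply/ideal_equivP; exists x => // y /=; split.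
  move=> [n [a [b [Ia Jb ->]]]]; exists n, (fun i => x * a i), b.
  split=> // [i|]; first exact/H.
  by rewrite mulr_sumr; apply: eq_bigr => i _; rewrite mulrA.
move=> [n [a [b [Ia Jb E]]]]; exists n, (fun i => x^-1 * a i), b.
split=> // [i|]; first by apply/H; rewrite mulrA divff ?mul1r.
apply: (mulfI x0); rewrite E mulr_sumr; apply: eq_bigr => i _.
by rewrite !mulrA divff ?mul1r.
Qed.

Lemma clM I J : cl (fmul I J) = clmul (cl I) (cl J).
Proof.
have cl_mul I1 J1 I2 J2 : cl I1 = cl I2 -> cl J1 = cl J2 ->
    cl (fmul I1 J1) = cl (fmul I2 J2).
  move=> /cl_eq eI /cl_eq eJ; apply/cl_eq.
  apply: (@ideal_equiv_trans (fmul I2 J1)); first exact: fmul_equivl.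
  by rewrite ![fmul I2 _]fmulC; exact: fmul_equivl.
by apply: cl_mul; rewrite cl_repr.
Qed.

Lemma clV I : cl (finv I) = clinv (cl I).
Proof.
have /cl_eq/ideal_equivP[x x0 H] : cl I = cl (repr (cl I)) by rewrite cl_repr.
apply/cl_eq/ideal_equivP; exists x^-1; first by rewrite invr_eq0.
move=> y /=; split=> Hy z Hz.
  rewrite -mulrA mulrCA; apply: Hy; apply/H.
  by rewrite mulrA divff ?mul1r.
have := Hy (x * z) (proj1 (H z) Hz).
by rewrite mulrACA mulVf ?mul1r.
Qed.

Lemma clmulA : associative clmul.
Proof.
move=> c d e; rewrite -(cl_repr c) -(cl_repr d) -(cl_repr e).
by rewrite -!clM fmulA.
Qed.

Lemma clmulC : commutative clmul.
Proof. by move=> c d; rewrite /clmul fmulC. Qed.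

Lemma clmul1 : left_id (cl fone) clmul.
Proof. by move=> c; rewrite -(cl_repr c) -clM fmul1. Qed.

Lemma clmul1r : right_id (cl fone) clmul.
Proof. by move=> c; rewrite clmulC clmul1. Qed.

(* Inversion is induced by I |-> (O_K : I), which is the group inverse since  *)
(* O_K is a Dedekind domain; that law is not needed below, and only the       *)
(* commutative monoid laws are recorded.                                      *)
HB.instance Definition _ :=
  isMonoid.Build idealClass clmulA clmul1 clmul1r.
HB.instance Definition _ := hasInv.Build idealClass clinv.

Definition primes_of_norm (q : nat) : set (fracIdeal K) :=
  [set P | is_prime_ideal (P : set K) /\ ideal_has_norm P q].

(* The set of primes of given norm being finite, the finitely supported       *)
(* product ranges over all of it.                                             *)
Definition PolyaIdeal (q : nat) : fracIdeal K :=
  \big[fmul/fone]_(P \in primes_of_norm q) P.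

Definition prime_power (q : nat) :=
  exists l k : nat, [/\ prime l, (0 < k)%N & q = (l ^ k)%N].

Definition is_subgroup (A : set idealClass) :=
  [/\ A 1%g, forall c d, A c -> A d -> A (c * d)%g
    & forall c, A c -> A (c^-1)%g].

Definition PolyaGroup : set idealClass :=
  [set c | forall A, is_subgroup A ->
     (forall q, prime_power q -> A (cl (PolyaIdeal q))) -> A c].

End ClassGroup.

Arguments PolyaGroup K : clear implicits.

(* A and B are meant to be subgroups.                                         *)
Definition subgroup_iso (G H : magmaType) (A : set G) (B : set H) :=
  exists f : G -> H, {in A &, {morph f : x y / (x * y)%g}} /\ set_bij A B f.

(* The field QQ(sqrt m, sqrt n), given by an abstract extension of the        *)
(* rationals together with its embedding in algC.                             *)
Definition Kdata (m n : int) :=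
  num_field_exists [:: sqrtC (m%:~R : algC); sqrtC (n%:~R : algC)].

Definition Kmn (m n : int) : fieldExtType rat := projT1 (Kdata m n).

Definition Kmn_embed (m n : int) : {rmorphism Kmn m n -> algC} :=
  projT1 (projT2 (Kdata m n)).

Lemma Kmn_gen (m n : int) :
  exists x y : Kmn m n,
    [/\ Kmn_embed m n x = sqrtC m%:~R, Kmn_embed m n y = sqrtC n%:~R
      & <<1 & [:: x; y]>>%VS = fullv].
Proof.
rewrite /Kmn_embed /Kmn; case: (Kdata m n) => L [f [s /= + gen]].
by case: s gen => [|x [|y [|]]] //= gen [<- <-]; exists x, y.
Qed.

Definition subfieldC (m n : int) : set algC := range (Kmn_embed m n).

Definition nonsquare (m : int) := forall k : int, m != k ^+ 2.

Definition biquadratic (m n : int) :=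
  [/\ nonsquare m, nonsquare n & \dim {: Kmn m n} = 4].

(* Main.v *)
(* Take m = - M with M squarefree and congruent to 3 mod 4, and let d be p or p - 1 = 2 q. In K = Q(sqrt m, sqrt d)
   the ramified primes are those dividing 2 d M, all with ramification index 2. As the product rad l of the primes
   above l satisfies (rad l)^2 = (l) for l ramified and rad l = (l) otherwise, Po(K) is the elementary abelian
   2-group generated by the classes of the rad l, l dividing 2 d M, and a product of rad l's over l dividing a
   squarefree N is principal iff alpha^2 / N is a unit for some alpha in K.

   Since K is imaginary, alpha divided by its complex conjugate is 1 or - 1, so up to a factor sqrt m we may take
   alpha in Q(sqrt d). There a trace computation shows that N lies in the square classes generated by 2, d and M;
   d and M always give relations, and 2 does iff x^2 - d y^2 = 2 or - 2 has an integral solution. Hence the rank of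
   Po(K) is #{l | 2 d M} - 2 or #{l | 2 d M} - 3. The solvability of this equation depends on d only, not on M: if it
   is solvable for d = 2 q we put the factor p into M, if it is solvable for d = p we put the factor q into M, and
   with r further primes both Pólya groups have rank r. *)
Require Import Defs.
From HB Require Import structures.
From mathcomp Require Import all_boot all_order all_algebra all_fingroup all_field.
From mathcomp Require Import boolp classical_sets functions cardinality fsbigop.
From mathcomp Require Import finmap.
From mathcomp Require Import ring lra zify.

Import Order.TTheory GRing.Theory Num.Theory.
Local Open Scope classical_set_scope.
Local Open Scope ring_scope.

Set Implicit Arguments.
Unset Strict Implicit.
Unset Printing Implicit Defensive.

(** * Algebraic integers and radicals *)

(** For odd [q] and [p = 2 q + 1] one has [2 q = 2 (mod 4)] and [p = 3 (mod 4)], so 2 ramifies in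
    Q(sqrt d) for both values of [d]; as [- M = 1 (mod 4)], it is unramified in Q(sqrt (- M)). This
    is what fixes the ramification index at 2. A prime [l] dividing both [M] and [d] also has index
    2, since sqrt (- M d) / l is integral there; hence a factor [p] or [q] may be put into [M].

    Principality is decided by squaring: if [I ^ 2 = (M)] and [J ^ 2 = (N)], then [a I] lies in [J]
    exactly when [a ^ 2 M / N] is integral, because the ring of integers is integrally closed.

    The trace computation runs as follows. If [beta] in Q(sqrt d) has norm [n], and [beta ^ 2 / n]
    is a unit of trace [T], then [n (T + 2)] is a rational square and [n (T - 2)] is [d] times one.
    Since [T + 2] and [T - 2] share no odd prime, the odd primes not dividing [d] have even
    valuation in [n]. *)

Section RingOfIntegers.

Variable K : fieldExtType rat.
Implicit Types x y z : K.
Notation OK := (@ringOfIntegers K).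

Lemma OK_int (n : int) : OK n%:~R. Proof. exact: integral_id. Qed.
Lemma OK_nat (n : nat) : OK n%:R. Proof. exact: integral_nat. Qed.
Lemma OKN x : OK x -> OK (- x). Proof. exact: integral_opp. Qed.
Lemma OKB x y : OK x -> OK y -> OK (x - y). Proof. exact: integral_sub. Qed.

Lemma OKX x n : OK x -> OK (x ^+ n).
Proof. by move=> Ox; elim: n => [|n IH]; rewrite ?expr0 ?exprS; [exact: OK1 | exact: OKM]. Qed.

Lemma OK_conj (f : {rmorphism K -> K}) x : OK x -> OK (f x).
Proof.
case=> p mp rp; exists p => //.
have -> : map_poly intr p = map_poly f (map_poly intr p).
  by rewrite -map_poly_comp; apply: eq_map_poly => n /=; rewrite rmorph_int.
exact: rmorph_root.
Qed.

Lemma OK_of_expn x n : (0 < n)%N -> OK (x ^+ n) -> OK x.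
Proof.
move=> n0 Ox; apply: (@integral_root_monic _ _ _ _ ('X^n - (x ^+ n)%:P)).
- exact: monicXnsubC.
- by rewrite /root !hornerE subrr.
- apply/(integral_poly (intr : int -> K)) => i; rewrite coefB coefXn coefC.
  by apply: integral_sub; [exact: integral_nat | case: ifP => _; [exact: Ox | exact: integral0]].
Qed.

Lemma OK_quadratic x (t n : int) : x ^+ 2 - t%:~R * x + n%:~R = 0 -> OK x.
Proof.
move=> E; exists ('X^2 - t *: 'X + n%:P).
  rewrite monicE -[_ - _ + _]addrA lead_coefDl ?lead_coefXn //.
  rewrite size_polyXn (leq_ltn_trans (size_polyD _ _)) // gtn_max size_polyN.
  by rewrite (leq_ltn_trans (size_scale_leq _ _)) ?size_polyX // (leq_ltn_trans (size_polyC_leq1 _)).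
rewrite /root rmorphD rmorphB /= map_polyXn map_polyZ /= map_polyX map_polyC /=.
by rewrite !hornerE E.
Qed.

(** Transport to [algC], where a rational algebraic integer is known to be an integer. *)
Lemma OK_rat (r : rat) : OK (in_alg K r) -> exists n : int, r = n%:~R.
Proof.
case=> p mp; rewrite /root => rp.
have {}rp : root (map_poly (intr : int -> rat) p) r.
  rewrite /root -(fmorph_eq0 (in_alg K)) -horner_map -map_poly_comp.
  by rewrite (eq_map_poly (g := intr)) // => n; rewrite /= -in_algE rmorph_int.
have : (ratr r : algC) \in Aint.
  apply: (@root_monic_Aint (map_poly intr p)); last 2 first.
  - by rewrite monicE (lead_coef_map_inj (f := intr)) ?(monicP mp) //; exact: intr_inj.
  - by apply/polyOverP => i; rewrite coef_map /= intr_int.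
  have -> : map_poly (intr : int -> algC) p = map_poly ratr (map_poly (intr : int -> rat) p).
    by rewrite -map_poly_comp; apply: eq_map_poly => n /=; rewrite rmorph_int.
  exact: rmorph_root.
move/(Cint_rat_Aint (Crat_rat _)); rewrite Cint_rat => /intrP[n ->].
by exists n.
Qed.

(** A Bézout relation. It lets divisibility by a prime [l] be checked after multiplication by an
    integer prime to [l]. *)
Lemma OK_coprime x (a b : int) : coprimez a b ->
  OK (a%:~R * x) -> OK (b%:~R * x) -> OK x.
Proof.
move=> /coprimezP[[u v] /= uv] Oa Ob.
have -> : x = u%:~R * (a%:~R * x) + v%:~R * (b%:~R * x).
  by rewrite !mulrA -!intrM -mulrDl -intrD uv mul1r.
by apply: OKD; apply: OKM => //; exact: OK_int.
Qed.

(* The radical of [l OK], i.e. the product of the primes above [l]. *)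
Definition rad (l : nat) : set K := [set x | OK x /\ exists n, OK (x ^+ n / l%:R)].

Lemma natr_neq0 (n : nat) : (0 < n)%N -> (n%:R : K) != 0.
Proof. by rewrite lt0n -(rmorph_nat (in_alg K)) fmorph_eq0 pnatr_eq0. Qed.

Lemma OK_dvdX x (c : K) i j : OK x -> (i <= j)%N -> OK (x ^+ i / c) -> OK (x ^+ j / c).
Proof.
move=> Ox ij Oi; rewrite -(subnKC ij) exprD mulrAC; apply: OKM => //; exact: OKX.
Qed.

Lemma rad_sub l : is_submodule (rad l).
Proof.
split.
- by split; [exact: OK0 | exists 1%N; rewrite expr1 mul0r; exact: OK0].
- move=> x y [Ox [i xi]] [Oy [j yj]]; split; first exact: OKD.
  (* In every binomial term the exponent of [x] is at least [i] or that of [y] is at least [j]. *)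
  exists (i + j)%N; rewrite exprDn mulr_suml; elim/big_ind: _.
  + exact: OK0.
  + exact: OKD.
  move=> k _; rewrite -mulr_natl -mulrA; apply: OKM; first exact: OK_nat.
  case: (leqP i (i + j - k)) => ik.
    by rewrite mulrAC; apply: OKM; [exact: OK_dvdX xi | exact: OKX].
  rewrite -mulrA; apply: OKM; first exact: OKX.
  by apply: OK_dvdX yj => //; lia.
- move=> a x Oa [Ox [n xn]]; split; first exact: OKM.
  by exists n; rewrite exprMn -mulrA; apply: OKM => //; exact: OKX.
Qed.

Lemma rad_OK l x : rad l x -> OK x. Proof. by case. Qed.

Lemma rad_nat l : rad l l%:R.
Proof.
split; first exact: OK_nat.
exists 1%N; rewrite expr1; case: l => [|l]; first by rewrite mul0r; exact: OK0.
by rewrite divff ?natr_neq0 //; exact: OK1.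
Qed.

Lemma rad_dvd l x : (0 < l)%N -> OK (x / l%:R) -> rad l x.
Proof.
move=> l0 Ox; split; last by exists 1%N; rewrite expr1.
by rewrite -[x](divfK (natr_neq0 l0)); apply: OKM => //; exact: OK_nat.
Qed.

Lemma rad_fractional l : is_fractional (rad l).
Proof.
split; first exact: rad_sub.
- case: l => [|l]; last by exists l.+1%:R; [exact: rad_nat | exact: natr_neq0].
  (* For [l = 0] the quotient by [l] is [0], so the radical is the whole ring. *)
  exists 1; last exact: oner_neq0.
  by split; [exact: OK1 | exists 0%N; rewrite invr0 mulr0; exact: OK0].
- exists 1; split; [exact: OK1 | exact: oner_neq0 | by move=> x /rad_OK; rewrite mul1r].
Qed.

Definition radI l : fracIdeal K := FracIdeal (rad_fractional l).

Lemma rad_conj (f : {rmorphism K -> K}) l x : rad l x -> rad l (f x).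
Proof.
case=> Ox [n xn]; split; first exact: OK_conj.
by exists n; move/(OK_conj f): xn; rewrite rmorphM fmorphV rmorphXn rmorph_nat.
Qed.

Lemma OK_intdiv (n : int) (l : nat) : (0 < l)%N -> OK (n%:~R / l%:R) -> (l %| n)%Z.
Proof.
move=> l0; have -> : n%:~R / l%:R = in_alg K (n%:~R / l%:R).
  by rewrite rmorphM fmorphV rmorph_int rmorph_nat.
move/OK_rat=> [k E]; apply/dvdzP; exists k; apply: (@intr_inj rat).
by rewrite intrM -E divfK // pnatr_eq0 -lt0n.
Qed.

Lemma rad_int l (n : int) : prime l -> rad l n%:~R -> (l %| n)%Z.
Proof.
move=> pl [_ [i]]; rewrite -(rmorphXn (intr : int -> K)) => /(OK_intdiv (prime_gt0 pl)).
rewrite !dvdzE /= abszX (Euclid_dvdX _ _ pl).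
by case/andP.
Qed.

End RingOfIntegers.

Lemma infinite_set_inj (T : Type) (A : set T) (f : nat -> T) :
  injective f -> (forall n, A (f n)) -> infinite_set A.
Proof.
move=> finj Af; apply/infiniteP.
have : (f @` [set: nat] #= [set: nat])%card by apply: inj_card_eq => i j _ _ /finj.
rewrite card_eq_le => /andP[_ le]; apply: card_le_trans le (subset_card_le _).
by move=> _ [n _ <-].
Qed.

(** * Primes above a rational prime *)

Section PrimesAbove.

Variable K : fieldExtType rat.
Implicit Types (x y z : K) (P Q I J : set K).
Notation OK := (@ringOfIntegers K).

Definition add_gen I a : set K := [set z | exists u c, [/\ I u, OK c & z = u + c * a]].

Lemma add_gen_sub I a : is_submodule I -> is_submodule (add_gen I a).
Proof.
move=> [I0 ID IM]; split.
- by exists 0, 0; split; [done | exact: OK0 | rewrite mul0r addr0].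
- move=> _ _ [u [c [Iu Oc ->]]] [v [e [Iv Oe ->]]].
  by exists (u + v), (c + e); split; [exact: ID | exact: OKD | ring].
- move=> b _ Ob [u [c [Iu Oc ->]]].
  by exists (b * u), (b * c); split; [exact: IM | exact: OKM | ring].
Qed.

Lemma add_gen_incl I a : I `<=` add_gen I a.
Proof. by move=> u Iu; exists u, 0; split; [done | exact: OK0 | rewrite mul0r addr0]. Qed.

Lemma add_gen_mem I a : is_submodule I -> add_gen I a a.
Proof. by move=> [I0 _ _]; exists 0, 1; split; [done | exact: OK1 | rewrite mul1r add0r]. Qed.

Lemma subN I x : is_submodule I -> I x -> I (- x).
Proof. by move=> [_ _ IM] Ix; rewrite -mulN1r; apply: IM => //; exact/OKN/OK1. Qed.

Lemma subB I x y : is_submodule I -> I x -> I y -> I (x - y).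
Proof. by move=> sI Ix Iy; case: (sI) => _ ID _; apply: ID => //; exact: subN. Qed.

(** An ideal maximal among those that contain [l] and no power of [x] is prime. Together with
    [rad_prime] this makes [rad l] the intersection of the primes containing [l]. *)
Lemma exists_prime_avoiding l x : OK x -> ~ rad l x ->
  exists P, [/\ is_prime_ideal P, P l%:R & ~ P x].
Proof.
move=> Ox nx.
pose good I := [/\ is_submodule I, I `<=` OK, I l%:R & forall n, ~ I (x ^+ n)].
have start : good [set z | OK z /\ OK (z / l%:R)].
  split.
  - split; first by rewrite /= mul0r; split; exact: OK0.
      move=> y z [Oy dy] [Oz dz] /=; rewrite mulrDl.
      by split; apply: OKD.
    by move=> a z Oa [Oz dz] /=; rewrite -mulrA; split; apply: OKM.
  - by move=> z [].
  - split; first exact: OK_nat.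
    have [->|l0] := eqVneq (l%:R : K) 0; first by rewrite mul0r; exact: OK0.
    by rewrite divff //; exact: OK1.
  - by move=> n [_ xn]; apply: nx; split => //; exists n.
have [P [goodP0 maxP]] : exists P, (P = set0 \/ good P) /\
    forall Q, P `<` Q -> ~ (Q = set0 \/ good Q).
  apply: Zorn_bigcup => F Fg Ftot.
  have [[I [FI I0]]|noI] := pselect (exists I, F I /\ I !=set0); last first.
    left; rewrite -subset0 => z [I FI Iz]; apply: noI; exists I; split => //.
    by exists z.
  right.
  have gd J z : F J -> J z -> good J.
    by move=> FJ Jz; case: (Fg J FJ) => // J0; rewrite J0 in Jz.
  have [i0 Ii0] := I0; have gI := gd _ _ FI Ii0.
  split.
  - split.
    + by exists I => //; case: gI => -[].
    + move=> y z [J FJ Jy] [L FL Lz].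
      have [JL|LJ] := Ftot _ _ FJ FL.
        exists L => //; case: (gd _ _ FL Lz) => -[_ LD _] _ _ _.
        by apply: LD => //; exact: JL.
      exists J => //; case: (gd _ _ FJ Jy) => -[_ LD _] _ _ _.
      by apply: LD => //; exact: LJ.
    + move=> a z Oa [J FJ Jz]; exists J => //.
      by case: (gd _ _ FJ Jz) => -[_ _ JM] _ _ _; exact: JM.
  - by move=> z [J FJ Jz]; case: (gd _ _ FJ Jz) => _ JO _ _; exact: JO.
  - by exists I => //; case: gI.
  - by move=> n [J FJ Jz]; case: (gd _ _ FJ Jz) => _ _ _ /(_ n).
have goodP : good P.
  case: goodP0 => // P0; exfalso; apply: (maxP [set z | OK z /\ OK (z / l%:R)]); last by right.
  split; first by rewrite P0.
  by move=> H; case: start => -[/H]; rewrite P0.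
have [sP PO Pl Px] := goodP.
have ext a : OK a -> ~ P a -> exists n, add_gen P a (x ^+ n).
  move=> Oa nPa; apply: contrapT => no; apply: (maxP (add_gen P a)).
    split; first exact: add_gen_incl.
    by move=> H; apply/nPa/H/add_gen_mem.
  right; split.
  - exact: add_gen_sub.
  - move=> _ [u [c [Pu Oc ->]]]; apply: OKD; [exact: PO | exact: OKM].
  - exact: add_gen_incl.
  - by move=> n H; apply: no; exists n.
exists P; split => //; last by move: (Px 1%N); rewrite expr1.
split => //; first by move: (Px 0%N); rewrite expr0.
move=> a b Oa Ob Pab.
have [Pa|nPa] := pselect (P a); first by left.
have [Pb|nPb] := pselect (P b); first by right.
(* Powers of [x] lie in [P + (a)] and in [P + (b)]; their product lies in [P + (a * b) = P], a
   contradiction. *)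
have [i [u [c [Pu Oc xi]]]] := ext a Oa nPa.
have [j [v [e [Pv Oe xj]]]] := ext b Ob nPb.
case: (Px (i + j)%N); rewrite exprD xi xj.
case: (sP) => P0 PD PM.
have -> : (u + c * a) * (v + e * b) = (v + e * b) * u + (c * a) * v + (c * e) * (a * b) by ring.
apply: (PD); first apply: (PD); apply: (PM) => //; try exact: OKM.
by apply: OKD; [exact: PO | exact: OKM].
Qed.

Lemma prime_ideal_prod P (T : Type) (s : seq T) (F : T -> K) :
  is_prime_ideal P -> (forall i, OK (F i)) -> P (\prod_(i <- s) F i) -> exists i, P (F i).
Proof.
move=> [sP PO P1 Pp] OF; elim: s => [|i s IH]; first by rewrite big_nil.
rewrite big_cons => /Pp[] //; last by exists i.
by elim/big_ind: _ => //; [exact: OK1 | exact: OKM].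
Qed.

Lemma prime_ideal_expn P x n : is_prime_ideal P -> OK x -> P (x ^+ n) -> P x.
Proof.
move=> [sP PO P1 Pp] Ox; elim: n => [|n IH]; first by rewrite expr0.
by rewrite exprS => /Pp[] //; exact: OKX.
Qed.

Lemma rad_prime P l : (0 < l)%N -> is_prime_ideal P -> P l%:R -> rad l `<=` P.
Proof.
move=> l0 pP Pl x [Ox [n xn]]; apply: (@prime_ideal_expn _ _ n) => //.
rewrite -[_ ^+ _](divfK (natr_neq0 K l0)).
by case: pP => -[_ _ PM] _ _ _; exact: PM.
Qed.

Definition add_coset P x : set K := [set x + y | y in P].

Lemma add_coset_eq P x y : is_submodule P -> (add_coset P x = add_coset P y) <-> P (x - y).
Proof.
move=> sP; have [P0 PD PM] := sP; split=> [E|Pxy].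
  have : add_coset P x x by exists 0; rewrite ?addr0.
  by rewrite E => -[z Pz <-]; rewrite addrAC subrr add0r.
apply/seteqP; split=> _ [z Pz <-]; rewrite /add_coset /=.
  by exists (x - y + z); [exact: PD | ring].
by exists (z - (x - y)); [exact: subB | ring].
Qed.

(** With finitely many residues, [a ^ i] and [a ^ j] agree modulo [P] for some [i < j]; cancelling
    [a ^ i] leaves an inverse of [a]. *)
Lemma prime_ideal_maximal P a : is_prime_ideal P -> finite_set (residues P) ->
  OK a -> ~ P a -> exists2 b, OK b & P (1 - a * b).
Proof.
move=> pP fin Oa nPa; have [sP PO P1 Pp] := pP.
have [i [j [ij Pij]]] : exists i j, (i < j)%N /\ P (a ^+ i - a ^+ j).
  apply: contrapT => no; apply: (_ : ~ finite_set (residues P)) => //.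
  apply: (@infinite_set_inj _ _ (fun n => add_coset P (a ^+ n))) => [i j|n]; last first.
    by exists (a ^+ n) => //; exact: OKX.
  move=> /(add_coset_eq _ _ sP) Pij; case: (ltngtP i j) => // ij; case: no.
    by exists i, j.
  by exists j, i; split => //; rewrite -opprB; exact: subN.
have : P (a ^+ i * (1 - a * a ^+ (j - i).-1)).
  rewrite mulrBr mulr1 -exprS -exprD prednK ?subn_gt0 // subnKC //; exact: ltnW.
have Ob := OKX (j - i).-1 Oa.
case/Pp; first exact: OKX; first by apply: OKB; [exact: OK1 | exact: OKM].
  by move/(prime_ideal_expn pP Oa).
by exists (a ^+ (j - i).-1).
Qed.

Lemma prime_ideal_incl_eq P Q : is_prime_ideal P -> finite_set (residues P) ->
  is_prime_ideal Q -> P `<=` Q -> P = Q.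
Proof.
move=> pP fin [sQ QO Q1 _] PQ; apply/seteqP; split => // x Qx; apply: contrapT => nPx.
have [b Ob /PQ Qb] := prime_ideal_maximal pP fin (QO _ Qx) nPx.
apply: Q1; case: sQ => _ QD QM; rewrite -[1](subrK (x * b)).
by apply: QD => //; rewrite mulrC; exact: QM.
Qed.

Lemma prime_ideal_comaximal P Q : is_prime_ideal P -> finite_set (residues P) ->
  is_submodule Q -> Q `<=` OK -> ~ (Q `<=` P) -> exists2 z, P z & Q (1 - z).
Proof.
move=> pP fin sQ QO nQP.
have [x [Qx nPx]] : exists x, Q x /\ ~ P x.
  by apply: contrapT => no; apply: nQP => x Qx; apply: contrapT => nPx; apply: no; exists x.
have [b Ob Pb] := prime_ideal_maximal pP fin (QO _ Qx) nPx.
exists (1 - x * b) => //; rewrite opprB addrC subrK mulrC.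
by case: sQ => _ _; apply.
Qed.

(** Conjugate primes have equal norms. Involutions suffice because the Galois group has exponent
    2. *)
Lemma residues_im (f : K -> K) P : cancel f f -> {morph f : x y / x + y} ->
  (forall x, OK x -> OK (f x)) -> (residues (f @` P) #= residues P)%card.
Proof.
move=> fK fD fO.
have finj : injective f by exact: can_inj fK.
have E : residues (f @` P) = [set f @` R | R in residues P].
  apply/seteqP; split=> [_ [x Ox <-]|_ [_ [x Ox <-] <-]].
    exists (add_coset P (f x)); first by exists (f x) => //; exact: fO.
    apply/seteqP; split=> [_ [_ [y Py <-] <-]|_ [_ [y Py <-] <-]].
      by rewrite fD fK; exists (f y) => //; exists y.
    by exists (f x + y); [exists y | rewrite fD fK].
  exists (f x); first exact: fO.
  apply/seteqP; split=> [_ [_ [y Py <-] <-]|_ [_ [y Py <-] <-]].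
    by exists (x + y); [exists y | rewrite fD].
  by rewrite fD; exists (f y) => //; exists y.
have imK R : f @` (f @` R) = R.
  by rewrite image_comp -[RHS]image_id; apply: eq_imagel => x _; rewrite /= fK.
by rewrite E; apply: inj_card_eq => R S _ _ RS; rewrite -(imK R) RS imK.
Qed.

Lemma prime_ideal_im (f : {rmorphism K -> K}) P : cancel f f ->
  is_prime_ideal P -> is_prime_ideal (f @` P).
Proof.
move=> fK [[P0 PD PM] PO P1 Pp].
have memf x : (f @` P) x <-> P (f x).
  by split=> [[y Py <-]|Pfx]; [rewrite fK | exists (f x)].
split.
- split; first by apply/memf; rewrite rmorph0.
    by move=> x y /memf fx /memf fy; apply/memf; rewrite rmorphD; exact: PD.
  by move=> a x Oa /memf fx; apply/memf; rewrite rmorphM; apply: PM => //; exact: OK_conj.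
- by move=> x /memf/PO/(OK_conj f); rewrite fK.
- by move/memf; rewrite rmorph1.
- move=> a b Oa Ob /memf; rewrite rmorphM => /Pp[]; try exact: OK_conj.
    by left; apply/memf.
  by right; apply/memf.
Qed.

End PrimesAbove.

(** * Orders of the residue rings killed by a rational prime *)

Section ElementaryQuotient.

Variable K : fieldExtType rat.
Variables (P : set K) (l : nat).
Notation OK := (@ringOfIntegers K).
Hypotheses (pl : prime l) (sP : is_submodule P) (Pl : P l%:R).

Let comb k (b : 'I_k -> K) (v : {ffun 'I_k -> 'I_l}) : K := \sum_i (v i)%:R * b i.

Let comb_OK k (b : 'I_k -> K) v : (forall i, OK (b i)) -> OK (comb b v).
Proof.
move=> Ob; rewrite /comb; elim/big_ind: _; [exact: OK0 | exact: OKD |].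
by move=> i _; apply: OKM; [exact: OK_nat | exact: Ob].
Qed.

(* [OK / P] is killed by [l]; a maximal family [b] independent over the prime field is a basis of it. *)
Lemma card_residues_prime_power : finite_set (residues P) ->
  exists k, (residues P #= `I_(l ^ k))%card.
Proof.
case=> N cardN; have [P0 PD PM] := sP.
pose indep k := exists2 b : 'I_k -> K, (forall i, OK (b i)) &
  injective (fun v => add_coset P (comb b v)).
have inj_le k (b : 'I_k -> K) : (forall i, OK (b i)) ->
    injective (fun v => add_coset P (comb b v)) -> (`I_(l ^ k) #<= residues P)%card.
  move=> Ob binj.
  have cT : #|{: {ffun 'I_k -> 'I_l}}| = (l ^ k)%N by rewrite card_ffun !card_ord.
  pose g (i : 'I_(l ^ k)) := add_coset P (comb b (enum_val (cast_ord (esym cT) i))).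
  have ginj : injective g by move=> i j /binj/enum_val_inj/cast_ord_inj.
  have : (g @` [set: 'I_(l ^ k)] #= [set: 'I_(l ^ k)])%card.
    by apply: inj_card_eq => i j _ _ /ginj.
  rewrite -(card_eqr card_II) card_eq_le => /andP[_ le].
  apply: card_le_trans le (subset_card_le _) => _ [i _ <-].
  by exists (comb b (enum_val (cast_ord (esym cT) i))) => //; exact: comb_OK.
have ex0 : exists k, `[< indep k >].
  exists 0%N; apply/asboolP; exists (fun=> 0) => [[]//|].
  by move=> v w _; apply/ffunP => -[].
have bnd k : `[< indep k >] -> (k <= N)%N.
  move=> /asboolP[b Ob binj]; have := inj_le _ _ Ob binj.
  rewrite (card_le_eqr cardN) card_le_II => /(leq_trans _); apply.
  exact/ltnW/ltn_expl/prime_gt1.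
case: (ex_maxnP ex0 bnd) => k /asboolP[b Ob binj] kmax.
exists k; rewrite card_eq_le (inj_le _ _ Ob binj) andbT.
have l0 : (0 < l)%N by exact: prime_gt0.
have l0z : (l%:Z != 0) by rewrite eqz_nat -lt0n.
pose modl (n : int) : 'I_l := Ordinal (ltn_pmod (`|(n %% l)%Z|%N) l0).
have modlE n : exists q : int, n%:~R = (modl n)%:R + l%:R * q%:~R :> K.
  exists (n %/ l)%Z; rewrite {1}(divz_eq n l) intrD intrM addrC mulrC; congr (_ + _).
  have := modz_ge0 n l0z; have : (n %% l < l)%Z by exact: ltz_pmod.
  by rewrite /=; case: (n %% l)%Z => // r rl _; rewrite modn_small.
have comb_mod (n : 'I_k -> int) : P (\sum_i (n i)%:~R * b i - comb b [ffun i => modl (n i)]).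
  rewrite /comb -sumrB; elim/big_ind: _ => // i _.
  have [q ->] := modlE (n i); rewrite ffunE mulrDl addrAC subrr add0r.
  by rewrite -mulrA mulrC; apply: PM => //; apply: OKM => //; exact: OK_int.
have surj x : OK x -> exists v, P (x - comb b v).
  move=> Ox.
  pose b' (i : 'I_k.+1) := if unlift ord0 i is Some j then b j else x.
  have Ob' i : OK (b' i) by rewrite /b'; case: unliftP.
  (* By maximality of [k], adjoining [x] to the family yields two combinations in the same class.
     The coefficient [e] of [x] in their difference cannot vanish, as [b] is independent. *)
  have [v [w [vw Pvw]]] : exists v w, v <> w /\ P (comb b' v - comb b' w).
    apply: contrapT => no; have : (k < k)%N; last by rewrite ltnn.
    apply: kmax; apply/asboolP; exists b' => // v w /(add_coset_eq _ _ sP) Pvw.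
    by apply: contrapT => nvw; apply: no; exists v, w.
  have combE v' : comb b' v' = (v' ord0)%:R * x + \sum_i (v' (lift ord0 i))%:R * b i.
    rewrite /comb big_ord_recl {1}/b' unlift_none; congr (_ + _).
    by apply: eq_bigr => i _; rewrite /b' liftK.
  pose e : int := (v ord0)%:Z - (w ord0)%:Z.
  pose n i : int := (v (lift ord0 i))%:Z - (w (lift ord0 i))%:Z.
  have {}Pvw : P (e%:~R * x + \sum_i (n i)%:~R * b i).
    move: Pvw; rewrite !combE; congr P; rewrite opprD addrACA -mulrBl -sumrB intrB -!pmulrn.
    congr (_ + _); apply: eq_bigr => i _; rewrite intrB -!pmulrn mulrBl //.
  have [e0|e0] := eqVneq (v ord0) (w ord0).
    case: vw; apply/ffunP => i; case: (unliftP ord0 i) => [j ->|-> //].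
    have /ffunP/(_ j) : [ffun j => v (lift ord0 j)] = [ffun j => w (lift ord0 j)].
      apply: binj; apply/(add_coset_eq _ _ sP).
      move: Pvw; rewrite /e e0 subrr mul0r add0r; congr P.
      rewrite /comb -sumrB; apply: eq_bigr => i' _.
      by rewrite !ffunE intrB -!pmulrn mulrBl.
    by rewrite !ffunE.
  have /coprimezP[[u s] /= us] : coprimez e l.
    rewrite coprimezE /= coprime_sym prime_coprime //.
    apply/negP => /dvdn_leq le; have : (l <= `|e|)%N.
      by apply: le; rewrite absz_gt0 subr_eq0 eqz_nat.
    have := ltn_ord (v ord0); have := ltn_ord (w ord0); rewrite /e; lia.
  (* As [u * e + s * l = 1], the integer [u] inverts [e] modulo [l] and the relation is solved for
     [x]. *)
  exists [ffun i => modl (- u * n i)].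
  have := comb_mod (fun i => - u * n i); set c := comb _ _ => Pc.
  have -> : x - c = u%:~R * (e%:~R * x + \sum_i (n i)%:~R * b i) + (s%:~R * x) * l%:R +
      (\sum_i (- u * n i)%:~R * b i - c).
    have -> : \sum_i (- u * n i)%:~R * b i = - u%:~R * \sum_i (n i)%:~R * b i.
      by rewrite mulr_sumr; apply: eq_bigr => i _; rewrite intrM rmorphN mulrA.
    have : (u * e + s * l)%:~R = 1 :> K by rewrite us.
    rewrite intrD !intrM -pmulrn => E.
    transitivity ((u%:~R * e%:~R + s%:~R * l%:R) * x - c); first by rewrite E mul1r.
    by ring.
  apply: (PD) => //; apply: (PD); apply: (PM) => //; first exact: OK_int.
  by apply: OKM => //; exact: OK_int.
have cT : #|{: {ffun 'I_k -> 'I_l}}| = (l ^ k)%N by rewrite card_ffun !card_ord.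
have -> : residues P = (fun v => add_coset P (comb b v)) @` [set: {ffun 'I_k -> 'I_l}].
  apply/seteqP; split=> [_ [x Ox <-]|_ [v _ <-]]; last by exists (comb b v) => //; exact: comb_OK.
  by have [v Pv] := surj x Ox; exists v => //; apply/add_coset_eq => //; rewrite -opprB; exact: subN.
apply: card_le_trans (card_image_le _ _) _.
rewrite (card_le_eqr card_II).
have rinj : injective (fun v : {ffun 'I_k -> 'I_l} => cast_ord cT (enum_rank v)).
  by move=> v w /cast_ord_inj/enum_rank_inj.
have : ((fun v => cast_ord cT (enum_rank v)) @` [set: {ffun 'I_k -> 'I_l}] #=
         [set: {ffun 'I_k -> 'I_l}])%card.
  by apply: inj_card_eq => v w _ _ /rinj.
rewrite card_eq_le => /andP[_ le].
exact: card_le_trans le (subset_card_le _).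
Qed.

End ElementaryQuotient.

(** Distinct primes with finite residue rings are comaximal, so their product is their
    intersection. *)
Lemma ideal_prodE (K : fieldExtType rat) (s : seq (fracIdeal K)) : uniq s ->
  (forall P, P \in s -> is_prime_ideal (P : set K) /\ finite_set (residues (P : set K))) ->
  (\big[@fmul K/@fone K]_(P <- s) P : set K) =
    [set x | @ringOfIntegers K x /\ forall P, P \in s -> (P : set K) x].
Proof.
elim: s => [_ _|Q s IH /= /andP[Qs us] Hs].
  by rewrite big_nil; apply/seteqP; split=> x /=; [split | case].
rewrite big_cons /=; have Hs' P : P \in s -> is_prime_ideal (P : set K) /\ finite_set (residues (P : set K)).
  by move=> Ps; apply: Hs; rewrite inE Ps orbT.
have E := IH us Hs'; have [pQ finQ] := Hs Q (mem_head _ _).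
set J := \big[_/_]_(P <- s) P in E *.
have sJ := fracIdeal_submodule J; have sQ := fracIdeal_submodule Q.
have JO : (J : set K) `<=` @ringOfIntegers K by rewrite E => x [].
have nJQ : ~ ((J : set K) `<=` Q).
  move=> JQ.
  (* Each remaining prime contains an element outside [Q]; the product of these elements lies in [J]
     but, [Q] being prime, not in [Q]. *)
  have /choice[g gP] : forall P : fracIdeal K, exists z : K,
      P \in s -> (P : set K) z /\ ~ (Q : set K) z.
    move=> P; apply: contrapT => no.
    have Ps : P \in s by apply: contrapT => nPs; apply: no; exists 0 => Ps.
    have [pP finP] := Hs' P Ps.
    have PQ : (P : set K) = Q.
      apply: prime_ideal_incl_eq => // x Px; apply: contrapT => nQx; apply: no; exists x => _.
      by split.
    by move/negP: Qs; apply; rewrite -(fracIdeal_inj PQ).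
  have : (Q : set K) (\prod_(P <- s) (if P \in s then g P else 1)).
    apply: JQ; rewrite E; split=> [|P Ps].
      elim/big_ind: _ => [||P _]; [exact: OK1 | exact: OKM |].
      case: ifP => [Ps|_]; last exact: OK1.
      by have [_ PO _ _] := (Hs' P Ps).1; apply: PO; case: (gP P Ps).
    rewrite (big_rem P) //= Ps mulrC.
    case: (Hs' P Ps) => -[[_ _ PM] PO _ _] _; apply: PM; last by case: (gP P Ps).
    elim/big_ind: _ => [||R _]; [exact: OK1 | exact: OKM |].
    case: ifP => [Rs|_]; last exact: OK1.
    by have [_ RO _ _] := (Hs' R Rs).1; apply: RO; case: (gP R Rs).
  move/(prime_ideal_prod pQ) => [|P].
    move=> P; case: ifP => [Ps|_]; last exact: OK1.
    by have [_ PO _ _] := (Hs' P Ps).1; apply: PO; case: (gP P Ps).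
  case: ifP => [Ps|_]; first by case: (gP P Ps).
  by case: pQ.
have [z Qz Jz] := prime_ideal_comaximal pQ finQ sJ JO nJQ.
have [_ QO _ _] := pQ.
apply/seteqP; split.
  apply: idealMul_min.
    split.
    - split; first exact: OK0.
      move=> P; rewrite inE => /orP[/eqP->|Ps]; first by case: sQ.
      by case: (Hs' P Ps) => -[[]].
    - move=> x y [Ox xP] [Oy yP]; split=> [|P Ps]; first exact: OKD.
      by case: (Hs P Ps) => -[[_ PD _] _ _ _] _; apply: PD; [exact: xP | exact: yP].
    - move=> a x Oa [Ox xP]; split=> [|P Ps]; first exact: OKM.
      by case: (Hs P Ps) => -[[_ _ PM] _ _ _] _; apply: PM => //; exact: xP.
  move=> x y Qx Jy; split=> [|P]; first by apply: OKM; [exact: QO | exact: JO].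
  rewrite inE => /orP[/eqP->|Ps].
    by rewrite mulrC; case: sQ => _ _; apply => //; exact: JO.
  case: (Hs' P Ps) => -[[_ _ PM] _ _ _] _; apply: PM; first exact: QO.
  by move: Jy; rewrite E => -[_ /(_ P Ps)].
move=> x [Ox xP]; have Qx := xP Q (mem_head _ _).
have Jx : (J : set K) x by rewrite E; split=> // P Ps; apply: xP; rewrite inE Ps orbT.
(* Here [z] is in [Q], [1 - z] is in [J] and [x] is in both, so both terms lie in the product
   ideal. *)
have -> : x = z * x + x * (1 - z) by ring.
by case: (idealMul_sub (J : set K) sQ) => _ ID _; apply: ID; exact: idealMul_in.
Qed.

(** * Conjugacy of the primes above [l] and the resulting Pólya ideals *)

Section Decomposition.

Variable K : fieldExtType rat.
Notation OK := (@ringOfIntegers K).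
Variable gal : bool * bool -> {rmorphism K -> K}.
Hypothesis galK : forall u, cancel (gal u) (gal u).
Hypothesis gal1 : forall x, gal (false, false) x = x.
Hypothesis gal_norm : forall x, exists r : rat, \prod_u gal u x = in_alg K r.
(** Finiteness of the ring of integers modulo [l], phrased through a map to a finite type that
    separates the classes. *)
Hypothesis fin_mod : forall l : nat, (0 < l)%N -> exists (T : finType) (c : K -> T),
  forall x y, OK x -> OK y -> c x = c y -> OK ((x - y) / l%:R).

Lemma finite_residues (P : set K) l : (0 < l)%N -> is_submodule P -> P l%:R ->
  finite_set (residues P).
Proof.
move=> l0 sP Pl; have [T [c cP]] := fin_mod l0.
(* The default [0] is only taken at values of [c] attained by no integer, which do not occur
   below. *)
pose g (t : T) := add_coset P (xget 0 [set x | OK x /\ c x = t]).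
apply: (sub_finite_set (B := g @` [set: T])); last first.
  exact/finite_image/finite_finset.
move=> _ [x Ox <-]; exists (c x) => //; apply/(add_coset_eq _ _ sP).
case: xgetP => [y _ [Oy cy]|/(_ x) no]; last by case: no.
have H := cP _ _ Oy Ox cy.
rewrite -[y - x](divfK (natr_neq0 K l0)).
by case: sP => _ _; apply.
Qed.

Lemma prime_int_dvd (P : set K) l (n : int) : is_prime_ideal P -> prime l -> P l%:R ->
  P n%:~R -> (l %| n)%Z.
Proof.
move=> [sP PO P1 _] pl Pl Pn; apply: contrapT => /negP nln; apply: P1.
have : coprimez l n by rewrite coprimezE prime_coprime //.
move/coprimezP=> [[u v] /= uv]; have -> : 1 = u%:~R * l%:R + v%:~R * n%:~R :> K.
  by rewrite pmulrn -!intrM -intrD uv.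
by case: sP => _ PD PM; apply: PD; apply: PM => //; exact: OK_int.
Qed.

(** If [P] differed from every conjugate of [Q], it would be comaximal with each of them. The
    element [w] built from this has a norm in [Q], so one of its conjugates is in [Q], although
    [1 - w] is in all conjugates of [Q]. *)
Lemma primes_conj (P Q : set K) l : prime l -> is_prime_ideal P -> is_prime_ideal Q ->
  P l%:R -> Q l%:R -> exists u, Q = gal u @` P.
Proof.
move=> pl pP pQ Pl Ql; apply: contrapT => no.
have l0 := prime_gt0 pl.
have [sP PO P1 Pp] := pP; have [sQ QO Q1 Qp] := pQ.
have finP := finite_residues l0 sP Pl.
have /choice[z zP] : forall u, exists z, P z /\ (gal u @` Q) (1 - z).
  move=> u; have pQu := prime_ideal_im (galK u) pQ.
  have [sQu QuO _ _] := pQu.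
  have Qul : (gal u @` Q) l%:R by exists l%:R; rewrite ?rmorph_nat.
  have nQuP : ~ (gal u @` Q `<=` P).
    move/(prime_ideal_incl_eq pQu (finite_residues l0 sQu Qul) pP) => E; apply: no; exists u.
    by rewrite -E image_comp -[LHS]image_id; apply: eq_imagel => x _; rewrite /= galK.
  by have [y Py Qy] := prime_ideal_comaximal pP finP sQu QuO nQuP; exists y.
(* [w] lies in [P] but in no conjugate of [Q], while its norm is an integer of [P], hence a multiple of [l]. *)
pose w := 1 - \prod_u (1 - z u).
have Oz u : OK (1 - z u) by apply: OKB; [exact: OK1 | apply: PO; case: (zP u)].
have Pw : P w.
  rewrite /w; elim/big_rec: _ => [|u y _ IH]; first by rewrite subrr; case: sP.
  have -> : 1 - (1 - z u) * y = 1 - y + y * z u by ring.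
  have [_ PD PM] := sP; apply: (PD) => //; apply: PM; last by case: (zP u).
  have : OK (1 - (1 - y)) by apply: OKB; [exact: OK1 | exact: PO].
  by rewrite opprB addrC subrK.
have Qw u : (gal u @` Q) (1 - w).
  have [[_ _ QM] _ _ _] := prime_ideal_im (galK u) pQ.
  rewrite opprB addrC subrK (bigD1 u) //= mulrC; apply: QM; last by case: (zP u).
  by elim/big_ind: _ => [||v _]; [exact: OK1 | exact: OKM | exact: Oz].
have Ow := PO _ Pw.
have [r Nr] := gal_norm w.
have ON : OK (\prod_u gal u w).
  by elim/big_ind: _ => [||v _]; [exact: OK1 | exact: OKM | exact: OK_conj].
have PN : P (\prod_u gal u w).
  rewrite (bigD1 (false, false)) //= gal1 mulrC; case: sP => _ _ PM; apply: PM => //.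
  by elim/big_ind: _ => [||v _]; [exact: OK1 | exact: OKM | exact: OK_conj].
have [n rn] : exists n : int, r = n%:~R by apply: (@OK_rat K); rewrite -Nr.
have Nn : \prod_u gal u w = n%:~R by rewrite Nr rn rmorph_int.
have : Q (\prod_u gal u w).
  move: PN; rewrite Nn => /(prime_int_dvd pP pl Pl)/dvdzP[k ->].
  by rewrite intrM -pmulrn; case: sQ => _ _ QM; apply: QM => //; exact: OK_int.
case/(prime_ideal_prod pQ) => [u|u Qu]; first exact: OK_conj.
have [[_ QD _] _ Qu1 _] := prime_ideal_im (galK u) pQ.
apply: Qu1; rewrite -[1](subrK w); apply: (QD _ _ (Qw u)).
by exists (gal u w); [exact: Qu | exact: galK].
Qed.

Lemma prime_fractional (P : set K) l : (0 < l)%N -> is_prime_ideal P -> P l%:R ->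
  is_fractional P.
Proof.
move=> l0 [sP PO _ _] Pl; split=> //; first by exists l%:R => //; exact: natr_neq0.
by exists 1; split; [exact: OK1 | exact: oner_neq0 | move=> x /PO; rewrite mul1r].
Qed.

Lemma prime_norm (P : set K) l : prime l -> is_prime_ideal P -> P l%:R ->
  exists2 k, (0 < k)%N & ideal_has_norm P (l ^ k).
Proof.
move=> pl pP Pl; have [sP PO P1 _] := pP.
have fin := finite_residues (prime_gt0 pl) sP Pl.
have [[|k] Ek] := card_residues_prime_power pl sP Pl fin; last by exists k.+1.
(* For [k = 0] there is a single class, so that [0] and [1] agree modulo [P]. *)
case: P1; move: Ek; rewrite expn0 => Ek.
have E : add_coset P 0 = add_coset P 1.
  apply: contrapT => ne.
  have : (`I_2 #<= `I_1)%card; last by rewrite card_le_II.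
  rewrite -(card_le_eqr Ek).
  have finj : {in `I_2 &, injective (fun i => add_coset P i%:R)}.
    move=> i j /set_mem /=; case: i => [|[|]] // _ /set_mem /=; case: j => [|[|]] // _.
    by move/esym.
  have := inj_card_eq finj; rewrite card_eq_le => /andP[_ le].
  apply: card_le_trans le (subset_card_le _) => _ [i _ <-].
  by exists i%:R => //; exact: OK_nat.
by have := (add_coset_eq 0 1 sP).1 E; rewrite sub0r => /(subN sP); rewrite opprK.
Qed.

(** Two naturals agree modulo [P] because the residues are finite; their difference is a positive
    integer in [P], and one of its prime factors is in [P]. *)
Lemma prime_above (P : set K) n : is_prime_ideal P -> ideal_has_norm P n ->
  exists l, [/\ prime l, P l%:R & exists2 k, (0 < k)%N & n = (l ^ k)%N].
Proof.
move=> pP En; have [sP PO P1 Pp] := pP.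
have fin : finite_set (residues P) by exists n.
have [i [j [ij Pij]]] : exists i j, (i < j)%N /\ P (j%:R - i%:R).
  apply: contrapT => no; apply: (_ : ~ finite_set (residues P)) => //.
  apply: (@infinite_set_inj _ _ (fun n => add_coset P n%:R)) => [i j|i]; last first.
    by exists i%:R => //; exact: OK_nat.
  move=> /(add_coset_eq _ _ sP) Pij; case: (ltngtP i j) => // ij; case: no.
    by exists i, j; split => //; rewrite -opprB; exact: subN.
  by exists j, i.
have Pk : P (j - i)%:R by rewrite natrB // ltnW.
have k0 : (0 < j - i)%N by rewrite subn_gt0.
move: Pk; rewrite (prod_prime_decomp k0) natr_prod big_seq_cond big_mkcond /=.
case/(prime_ideal_prod pP) => [f|[l e]].
  by case: ifP => _; [exact: OK_nat | exact: OK1].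
case: ifP => //= /andP[/mem_prime_decomp[pl e0 _] _].
rewrite natrX => /(prime_ideal_expn pP (OK_nat _ _)) Pl.
have [k k0' Ek] := prime_norm pl pP Pl.
exists l; split=> //; exists k => //.
have : (`I_n #= `I_(l ^ k))%card by rewrite -(card_eql En).
by move/card_eq_II.
Qed.

Lemma PolyaIdealE l : prime l -> exists2 k, (0 < k)%N &
  (PolyaIdeal K (l ^ k) = radI K l) /\
  forall k', (0 < k')%N -> k' != k -> PolyaIdeal K (l ^ k') = @fone K.
Proof.
move=> pl; have l0 := prime_gt0 pl.
have n1 : ~ rad l (1 : K).
  move/(@rad_int K l 1 pl); rewrite dvdzE /= dvdn1 => /eqP l1.
  by rewrite l1 in pl.
have [P [pP Pl _]] := exists_prime_avoiding (OK1 K) n1.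
have [k k0 Ek] := prime_norm pl pP Pl.
have norm_l n (Q : set K) : is_prime_ideal Q -> ideal_has_norm Q (l ^ n) -> (0 < n)%N -> Q l%:R.
  move=> pQ En n0; have [l' [pl' Ql' [k' k0' E]]] := prime_above pQ En.
  suff -> : l = l' by [].
  have := dvdn_exp n0 (dvdnn l).
  by rewrite E Euclid_dvdX // => /andP[]; rewrite dvdn_prime2 // => /eqP.
have norm_conj (Q : set K) : is_prime_ideal Q -> Q l%:R -> ideal_has_norm Q (l ^ k).
  move=> pQ Ql; have [u ->] := primes_conj pl pP pQ Pl Ql.
  rewrite /ideal_has_norm (card_eql (residues_im P (galK u) (rmorphD (gal u)) _)) //.
  by move=> x; exact: OK_conj.
exists k => //; split; last first.
  move=> k' k0' kk'; rewrite /PolyaIdeal (_ : primes_of_norm _ = set0) ?fsbig_set0 //.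
  rewrite -subset0 => Q [pQ En].
  have Ql := norm_l _ _ pQ En k0'.
  have : (`I_(l ^ k') #= `I_(l ^ k))%card by rewrite -(card_eql En); exact: norm_conj.
  by move/card_eq_II/eqP; rewrite eqn_exp2l ?prime_gt1 // (negbTE kk').
have memE (Q : fracIdeal K) : primes_of_norm (l ^ k) Q <-> is_prime_ideal (Q : set K) /\ (Q : set K) l%:R.
  split=> -[pQ H]; split=> //; last exact: norm_conj.
  exact: norm_l H k0.
have fin : finite_set (@primes_of_norm K (l ^ k)).
  have /choice[F FE] : forall u, exists F : fracIdeal K, (F : set K) = gal u @` P.
    move=> u; have pu := prime_ideal_im (galK u) pP.
    have Pul : (gal u @` P) l%:R by exists l%:R; rewrite ?rmorph_nat.
    by exists (FracIdeal (prime_fractional l0 pu Pul)).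
  apply: (sub_finite_set (B := F @` [set: bool * bool])); last exact/finite_image/finite_finset.
  move=> Q /memE[pQ Ql]; have [u E] := primes_conj pl pP pQ Pl Ql.
  by exists u => //; apply: fracIdeal_inj; rewrite FE E.
apply: fracIdeal_inj; rewrite /PolyaIdeal fsbig_finite //.
have memS (Q : fracIdeal K) : Q \in fset_set (primes_of_norm (l ^ k)) <-> is_prime_ideal (Q : set K) /\ (Q : set K) l%:R.
  by rewrite in_fset_set // -memE; split=> [/set_mem|/mem_set].
rewrite ideal_prodE ?fset_uniq //; last first.
  move=> Q /memS[pQ Ql]; split=> //; apply: finite_residues l0 _ Ql.
  exact: fracIdeal_submodule.
apply/seteqP; split=> x /=.
  move=> [Ox H]; apply: contrapT => nx.
  have [Q [pQ Ql Qx]] := exists_prime_avoiding Ox nx.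
  by apply: Qx; apply: (H (FracIdeal (prime_fractional l0 pQ Ql))); apply/memS.
move=> rx; split; first exact: rad_OK rx.
by move=> Q /memS[pQ Ql]; exact: (rad_prime l0 pQ Ql).
Qed.

End Decomposition.

(** * Ideals with principal square and the Pólya group *)

Section SquareIdeals.

Variable K : fieldExtType rat.
Implicit Types (x y z a : K) (I J : fracIdeal K).
Notation OK := (@ringOfIntegers K).

(* [I ^ 2 = (M)] *)
Definition sq_ideal I (M : K) :=
  (forall a b, (I : set K) a -> (I : set K) b -> OK (a * b / M)) /\ idealMul I I M.

Definition unit_int x := OK x /\ OK x^-1.

Lemma sq_ideal1 : sq_ideal (@fone K) 1.
Proof.
split; first by move=> a b Oa Ob; rewrite divr1; exact: OKM.
by rewrite -[1 in X in _ X]mulr1; apply: idealMul_in; exact: OK1.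
Qed.

Lemma scale_divl (M : K) : is_submodule [set z | OK (z / M)].
Proof.
split=> /=; first by rewrite mul0r; exact: OK0.
  by move=> x y Ox Oy; rewrite mulrDl; exact: OKD.
by move=> a x Oa Ox; rewrite -mulrA; exact: OKM.
Qed.

Lemma sq_idealM I J M N : sq_ideal I M -> sq_ideal J N -> sq_ideal (fmul I J) (M * N).
Proof.
move=> [IO IM] [JO JM].
have E : idealMul (fmul I J) (fmul I J) = idealMul (fmul I I) (fmul J J).
  suff : fmul (fmul I J) (fmul I J) = fmul (fmul I I) (fmul J J) by move/(congr1 (@fracIdeal_set K)).
  by rewrite -!fmulA; congr fmul; rewrite !fmulA (fmulC J).
split; last by rewrite E; exact: idealMul_in.
move=> a b Ha Hb; have : idealMul (fmul I J) (fmul I J) (a * b) by exact: idealMul_in.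
rewrite E; apply: (idealMul_min (S := [set z | OK (z / (M * N))])).
  exact: scale_divl.
move=> x y Hx Hy /=; rewrite invfM mulrACA; apply: OKM.
  by move: x Hx; apply: (idealMul_min (S := [set z | OK (z / M)])) => //; exact: scale_divl.
by move: y Hy; apply: (idealMul_min (S := [set z | OK (z / N)])) => //; exact: scale_divl.
Qed.

(** For the converse, the square of [a * y * j / N] is integral for [y] in [I] and [j] in [J], hence
    so is the element itself; expanding [N] as a sum of products from [J] puts [a * y] into [J]. *)
Lemma sq_ideal_sub I J M N a : M != 0 -> N != 0 -> sq_ideal I M -> sq_ideal J N ->
  (forall y, (I : set K) y -> (J : set K) (a * y)) <-> OK (a ^+ 2 * M / N).
Proof.
move=> M0 N0 [IO IM] [JO JN]; split=> [H|H y Iy].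
  have [n [b [c [Ib Ic ->]]]] := IM.
  rewrite mulr_sumr mulr_suml; elim/big_ind: _ => [||i _]; [exact: OK0 | exact: OKD |].
  by rewrite expr2 mulrACA; apply: JO; exact: H.
have key j : (J : set K) j -> OK (a * y * j / N).
  move=> Jj; apply: (@OK_of_expn _ _ 2) => //.
  have -> : (a * y * j / N) ^+ 2 = (a ^+ 2 * M / N) * (y * y / M) * (j * j / N) by field; rewrite M0 N0.
  by apply: OKM; [apply: OKM => //; exact: IO | exact: JO].
have sJ := fracIdeal_submodule J.
have [n [b [c [Jb Jc EN]]]] := JN.
have -> : a * y = \sum_i (a * y * b i / N) * c i.
  apply: (mulIf N0); rewrite {1}EN mulr_sumr mulr_suml; apply: eq_bigr => i _.
  by field.
by apply: sub_sum => // i; case: sJ => _ _; apply => //; exact: key.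
Qed.

Lemma cl_eq_sq I J M N : M != 0 -> N != 0 -> sq_ideal I M -> sq_ideal J N ->
  cl I = cl J <-> exists2 a, a != 0 & unit_int (a ^+ 2 * M / N).
Proof.
move=> M0 N0 sI sJ; rewrite cl_eq.
split=> [/ideal_equivP[a a0 H]|[a a0 [Oa OVa]]].
  exists a => //; split; first by apply: (sq_ideal_sub a M0 N0 sI sJ).1 => y /H.
  have -> : (a ^+ 2 * M / N)^-1 = a^-1 ^+ 2 * N / M by field; rewrite M0 N0 a0.
  apply: (sq_ideal_sub a^-1 N0 M0 sJ sI).1 => y Jy; apply/H.
  by rewrite mulrA divff // mul1r.
apply/ideal_equivP; exists a => // y; split.
  exact: (sq_ideal_sub a M0 N0 sI sJ).2.
have /(sq_ideal_sub a^-1 N0 M0 sJ sI).2 H : OK (a^-1 ^+ 2 * N / M).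
  by have -> : a^-1 ^+ 2 * N / M = (a ^+ 2 * M / N)^-1 by field; rewrite M0 N0 a0.
by move/H; rewrite mulrA mulVf // mul1r.
Qed.

(** Since [I ^ 2 = (M)], the inverse ideal is [M^-1 * I]. *)
Lemma cl_sq1 I M : M != 0 -> sq_ideal I M -> clinv (cl I) = cl I.
Proof.
move=> M0 sI; have [IO IM] := sI; rewrite -clV; apply/cl_eq/ideal_equivP; exists M => // y; split=> [Hy|IMy z Iz].
  have sJ := fracIdeal_submodule I; have [n [b [c [Ib Ic ->]]]] := IM.
  rewrite mulr_suml; apply: sub_sum => // i; rewrite mulrAC [_ * y]mulrC.
  by case: sJ => _ _; apply => //; exact: Hy.
have -> : y * z = M * y * z / M by field.
exact: IO.
Qed.

End SquareIdeals.

Lemma subgroup_iso_common (G H L : magmaType) (A : set G) (B : set H) (C : set L) :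
  (exists y0 : H, B y0) -> (forall x y, B x -> B y -> B (x * y)%g) ->
  (forall x y, A x -> A y -> A (x * y)%g) ->
  subgroup_iso A C -> subgroup_iso B C -> subgroup_iso A B.
Proof.
move=> [y0 By0] BM AM [f [fM [fAC finj fsurj]]] [g [gM [gBC ginj gsurj]]].
have /choice[h hP] : forall x, exists y, A x -> B y /\ g y = f x.
  move=> x; have [Ax|nAx] := pselect (A x); last by exists y0.
  by have [y By gy] := gsurj _ (fAC _ Ax); exists y.
exists h; split.
  move=> x y /set_mem Ax /set_mem Ay.
  have [Bx gx] := hP _ Ax; have [By gy] := hP _ Ay.
  have [Bxy gxy] := hP _ (AM _ _ Ax Ay).
  apply: ginj; [exact: mem_set | exact/mem_set/BM |].
  by rewrite gxy gM ?(mem_set Bx) ?(mem_set By) // gx gy fM //; exact: mem_set.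
split=> [x Ax|x y /set_mem Ax /set_mem Ay E|y By].
- by case: (hP _ Ax).
- by apply: finj; [exact: mem_set | exact: mem_set | rewrite -(hP _ Ax).2 -(hP _ Ay).2 E].
- have [x Ax fx] := fsurj _ (gBC _ By); exists x => //.
  have [Bx gx] := hP _ Ax.
  by apply: ginj; [exact: mem_set | exact: mem_set | rewrite gx].
Qed.

(** * Ramified classes as vectors over the field with two elements *)

Section PolyaClasses.

Variable K : fieldExtType rat.
Notation OK := (@ringOfIntegers K).
Variable T : seq nat.
Hypothesis T_prime : forall l, l \in T -> prime l.
Hypothesis ramified : forall l, l \in T -> sq_ideal (radI K l) l%:R.
Hypothesis unramified : forall l, prime l -> l \notin T ->
  forall x, rad l x -> OK (x / l%:R).
Hypothesis polya : forall l, prime l -> exists2 k, (0 < k)%N &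
  (PolyaIdeal K (l ^ k) = radI K l) /\
  forall k', (0 < k')%N -> k' != k -> PolyaIdeal K (l ^ k') = @fone K.

Local Notation t := (size T).
Local Notation vec := ('rV['F_2]_t).

Let tprime (i : 'I_t) : prime (nth 0%N T i). Proof. by apply/T_prime/mem_nth. Qed.

(** Sets of ramified primes are encoded as vectors, so that the product of classes becomes a sum and
    the rank of the group is found by linear algebra. *)
Definition ram_ideal (v : vec) : fracIdeal K :=
  \big[@fmul K/@fone K]_(i < t | v 0 i != 0) radI K (nth 0%N T i).
Definition ram_norm (v : vec) : nat := (\prod_(i < t | (v 0 i != 0)%R) nth 0 T i)%N.
Definition ram_class v := cl (ram_ideal v).

Lemma ram_norm_gt0 v : (0 < ram_norm v)%N.
Proof. by apply: prodn_cond_gt0 => i _; exact: prime_gt0. Qed.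

Lemma ram_sq v : sq_ideal (ram_ideal v) (ram_norm v)%:R.
Proof.
rewrite /ram_ideal /ram_norm natr_prod; elim/big_rec2: _ => [|i M I _ sI].
  exact: sq_ideal1.
by apply: sq_idealM => //; apply/ramified/mem_nth.
Qed.

Let nz v : (ram_norm v)%:R != 0 :> K. Proof. exact/natr_neq0/ram_norm_gt0. Qed.

Lemma F2_case (a : 'F_2) : (a == 0) || (a == 1).
Proof. by case: a => [[|[|]]]. Qed.

(** The primes common to both supports cancel in [v + w]; they make up the square. *)
Lemma ram_normD v w : (ram_norm v * ram_norm w = ram_norm (v + w)%R *
  (\prod_(i < t | ((v 0 i != 0) && (w 0 i != 0))%R) nth 0 T i) ^ 2)%N.
Proof.
have mk (P : pred 'I_t) : (\prod_(i < t | P i) nth 0 T i =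
    \prod_(i < t) (if P i then nth 0 T i else 1))%N by rewrite big_mkcond.
rewrite -mulnn /ram_norm !mk -!big_split /=.
apply: eq_bigr => i _; rewrite !mxE.
by case/orP: (F2_case (v 0 i)) => /eqP->; case/orP: (F2_case (w 0 i)) => /eqP->;
  rewrite ?muln1 ?mul1n.
Qed.

Lemma ram_classD v w : ram_class (v + w) = (ram_class v * ram_class w)%g.
Proof.
transitivity (cl (fmul (ram_ideal v) (ram_ideal w))); last exact: clM.
apply: (cl_eq_sq (nz _) (mulf_neq0 (nz v) (nz w)) (ram_sq _) (sq_idealM (ram_sq v) (ram_sq w))).2.
set g := (\prod_(i < t | ((v 0 i != 0) && (w 0 i != 0))%R) nth 0 T i)%N.
exists g%:R; first by apply/natr_neq0/prodn_cond_gt0 => i _; exact: prime_gt0.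
rewrite -!natrM ram_normD -/g natrM natrX [X in X / _]mulrC divff; last first.
  apply: mulf_neq0 (nz _) (expf_neq0 _ _).
  by apply/natr_neq0/prodn_cond_gt0 => i _; exact: prime_gt0.
by split; rewrite ?invr1; exact: OK1.
Qed.

Lemma ram_class_eq1 v : ram_class v = 1%g <->
  exists2 a : K, a != 0 & unit_int (a ^+ 2 / (ram_norm v)%:R).
Proof.
have -> : ram_class v = 1%g <-> cl (ram_ideal v) = cl (@fone K) by [].
split.
  move/esym/(cl_eq_sq (oner_neq0 K) (nz v) (@sq_ideal1 K) (ram_sq v)) => [a a0 u].
  by exists a; rewrite // -[_ ^+ 2]mulr1.
move=> [a a0 u]; apply/esym/(cl_eq_sq (oner_neq0 K) (nz v) (@sq_ideal1 K) (ram_sq v)).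
by exists a; rewrite // mulr1.
Qed.

Lemma ram_class0 : ram_class 0 = 1%g.
Proof. by rewrite /ram_class /ram_ideal big_pred0 // => i; rewrite mxE eqxx. Qed.

Lemma PolyaGroup_ram : PolyaGroup K = range ram_class.
Proof.
apply/seteqP; split=> [c|_ [v _ <-] A [A1 AM AV] Agen].
  apply; first split.
  - by exists 0; rewrite ?ram_class0.
  - by move=> _ _ [v _ <-] [w _ <-]; exists (v + w); rewrite ?ram_classD.
  - move=> _ [v _ <-]; exists v => //; apply/esym/cl_sq1; [exact: nz | exact: ram_sq].
  move=> _ [l [k [pl k0 ->]]].
  have [k1 k10 [E1 E2]] := polya pl.
  have [->|kk] := eqVneq k k1; last by rewrite E2 //; exists 0; rewrite ?ram_class0.
  rewrite E1; have [lT|lT] := boolP (l \in T); last first.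
    (* An unramified [l] has [rad l = (l)], which is principal. *)
    exists 0; rewrite // ram_class0; apply/esym/cl_eq/ideal_equivP.
    have l0 := natr_neq0 K (prime_gt0 pl).
    exists l%:R^-1; first by rewrite invr_eq0.
    move=> y; rewrite mulrC; split=> [/(unramified pl lT)//|].
    exact/rad_dvd/prime_gt0.
  have il : (index l T < t)%N by rewrite index_mem.
  exists (delta_mx 0 (Ordinal il)) => //; rewrite /ram_class /ram_ideal; congr cl.
  rewrite (big_pred1 (Ordinal il)) ?nth_index // => i; rewrite mxE eqxx /=.
  by case: (i == _).
rewrite /ram_class /ram_ideal; elim/big_ind: _ => [|I J AI AJ|i _]; first exact: A1.
  by rewrite clM; exact: AM.
have [k k0 [<- _]] := polya (tprime i).
by apply: Agen; exists (nth 0%N T i), k; split=> //; exact: tprime.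
Qed.

(** The group is the space of vectors modulo the row space of [M]. The column base [C] of
    [cokermx M] realises this quotient: its kernel is that row space, and it maps onto the vectors
    of length [r]. *)
Lemma PolyaGroup_iso (k : nat) (M : 'M['F_2]_(k, t)) r : (\rank M + r = t)%N ->
  (forall v, ram_class v = 1%g <-> (v <= M)%MS) ->
  subgroup_iso (PolyaGroup K) [set: 'rV['Z_2]_r].
Proof.
move=> rM ker; rewrite PolyaGroup_ram.
have Er : \rank (cokermx M) = r by apply: (@addnI (\rank M)); rewrite mxrank_coker rM subnKC // rank_leq_col.
case: r / Er {rM}; pose C := col_base (cokermx M).
have kerC v : v *m C = 0 <-> ram_class v = 1%g.
  have -> : ram_class v = 1%g <-> v *m cokermx M = 0.
    by rewrite ker submxE; split=> [/eqP|/eqP].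
  rewrite -[cokermx M in X in _ <-> X]mulmx_base mulmxA -/C; split=> [->|]; first by rewrite mul0mx.
  move/(congr1 (mulmx^~ (pinvmx (row_base (cokermx M))))).
  by rewrite mul0mx -mulmxA mulmxVp ?row_base_free // mulmx1.
have eqC v w : v *m C = w *m C <-> ram_class v = ram_class w.
  have sq w' : (ram_class w' * ram_class w' = 1)%g.
    rewrite -ram_classD -[RHS]ram_class0; congr ram_class.
    by apply/rowP => i; rewrite !mxE; case/orP: (F2_case (w' 0 i)) => /eqP->; apply/eqP.
  have opp : v - w = v + w.
    apply/rowP => i; rewrite !mxE; congr (_ + _).
    by case/orP: (F2_case (w 0 i)) => /eqP->; apply/eqP.
  split=> E.
    have /kerC : (v - w) *m C = 0 by rewrite mulmxBl E subrr.
    rewrite opp ram_classD => E1.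
    by rewrite -[LHS]mulg1 -(sq w) mulgA E1 mul1g.
  apply/eqP; rewrite -subr_eq0 -mulmxBl; apply/eqP/kerC.
  by rewrite opp ram_classD E sq.
(* A vector is chosen in each class; the default [0] is only taken outside the Pólya group. *)
pose f c := xget 0 [set v | ram_class v = c] *m C.
have fE v : f (ram_class v) = v *m C.
  rewrite /f; case: xgetP => [w _ /eqC -> //|/(_ v) no]; by case: no.
exists f; split.
  by move=> c d /set_mem[v _ <-] /set_mem[w _ <-]; rewrite -ram_classD !fE mulmxDl.
split=> [|c d /set_mem[v _ <-] /set_mem[w _ <-]|u _].
- by [].
- by rewrite !fE => /eqC.
- have full : row_full C by exact: col_base_full.
  exists (ram_class (u *m pinvmx C)); first by exists (u *m pinvmx C).
  by rewrite fE mulmxKpV // submx_full.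
Qed.

End PolyaClasses.

Lemma PolyaGroupM (K : fieldExtType rat) (c d : idealClass K) :
  PolyaGroup K c -> PolyaGroup K d -> PolyaGroup K (c * d)%g.
Proof. by move=> Hc Hd A sA Agen; case: (sA) => _ AM _; apply: AM; [exact: Hc | exact: Hd]. Qed.

Lemma F2_addxx (a : 'F_2) : a + a = 0.
Proof. by case/orP: (F2_case a) => /eqP->; apply/eqP. Qed.

Section DivisibilityVectors.

Variable T : seq nat.
Hypothesis T_prime : forall l, l \in T -> prime l.
Hypothesis T_uniq : uniq T.
Local Notation vec := ('rV['F_2]_(size T)).

Lemma logn_ram_norm l (v : vec) :
  logn l (ram_norm v) = (\sum_(i < size T | (v 0 i != 0)%R) (l == nth 0 T i))%N.
Proof.
have [] : logn l (ram_norm v) = (\sum_(i < size T | (v 0 i != 0)%R) (l == nth 0 T i))%N /\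
    (0 < ram_norm v)%N; last by [].
rewrite /ram_norm; elim/big_rec2: _ => [|i s m _ [<- m0]]; first by rewrite logn1.
have pi : prime (nth 0%N T i) by apply/T_prime/mem_nth.
have pi0 := prime_gt0 pi.
by rewrite lognM // logn_prime // muln_gt0 pi0.
Qed.

Lemma logn_ram_norm_nth (i : 'I_(size T)) (v : vec) : logn (nth 0%N T i) (ram_norm v) = (v 0 i != 0)%R.
Proof.
rewrite logn_ram_norm; have [vi|vi] := boolP (v 0 i != 0)%R.
  rewrite (bigD1 i) //= eqxx big1 // => j /andP[_ ji].
  by rewrite nth_uniq // eq_sym val_eqE (negbTE ji).
rewrite big1 // => j vj; rewrite nth_uniq // val_eqE.
by case: eqVneq => // ij; rewrite ij vj in vi.
Qed.

Lemma logn_ram_norm_notin l (v : vec) : l \notin T -> logn l (ram_norm v) = 0%N.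
Proof.
move=> lT; rewrite logn_ram_norm big1 // => i _; apply/eqP; rewrite eqb0.
by apply: contra lT => /eqP->; exact: mem_nth.
Qed.

Definition dvd_vec (n : nat) : vec := \row_i ((nth 0 T i %| n)%N)%:R.

Lemma dvd_vec_neq0 n i : (dvd_vec n 0 i != 0) = (nth 0 T i %| n)%N.
Proof. by rewrite mxE; case: (_ %| _)%N. Qed.

Lemma ram_norm_dvd_vec n : (0 < n)%N -> (forall l, prime l -> ~~ (l ^ 2 %| n)%N) ->
  (forall l, prime l -> (l %| n)%N -> l \in T) -> ram_norm (dvd_vec n) = n.
Proof.
move=> n0 sqf nT; apply: eqn_from_log => // [|l].
  by apply: prodn_cond_gt0 => i _; apply/prime_gt0/T_prime/mem_nth.
have logn_n : logn l n = (prime l && (l %| n)%N).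
  have [pl|npl] /= := boolP (prime l); last by rewrite lognE (negbTE npl).
  have -> : (l %| n)%N = (0 < logn l n)%N by rewrite logn_gt0 mem_primes pl n0.
  by have := sqf l pl; rewrite pfactor_dvdn // -ltnNge ltnS; case: (logn l n) => [|[]].
have [lT|lT] := boolP (l \in T).
  have il : (index l T < size T)%N by rewrite index_mem.
  have := logn_ram_norm_nth (Ordinal il) (dvd_vec n).
  by rewrite /= nth_index // dvd_vec_neq0 /= nth_index // => ->; rewrite logn_n T_prime.
rewrite logn_ram_norm_notin // logn_n.
by case: andP => // -[pl ln]; case/negP: lT; exact: nT.
Qed.

End DivisibilityVectors.

(** * Arithmetic of norms, parities and square classes *)

Lemma small_norm (d : nat) (A C : int) : (5 <= d)%N -> A ^+ 2 + d%:Z * C ^+ 2 <= 4 ->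
  C = 0 /\ - 2 <= A <= 2.
Proof.
move=> d5 le4; have A2 := sqr_ge0 A.
have C0 : C = 0.
  apply/eqP; apply: contraTT le4 => C0; rewrite -ltNge.
  have : d%:Z * 1 <= d%:Z * C ^+ 2.
    by apply: ler_wpM2l => //; rewrite -gtz0_ge1 exprn_even_gt0.
  by move: A2; set a := A ^+ 2; set c := _ * C ^+ 2; lia.
split=> //; move: le4; rewrite C0 expr0n mulr0 addr0 => le4.
have : `|A| ^+ 2 <= 2 ^+ 2 by rewrite real_normK ?num_real.
by rewrite ler_pXn2r ?nnegrE // ler_norml.
Qed.

Lemma int_parity (A : int) : (exists u, A = 2 * u) \/ (exists u, A = 2 * u + 1).
Proof.
have := divz_eq A 2; have := modz_ge0 A (isT : 2 != 0 :> int).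
have : (A %% 2 < 2)%Z by apply: ltz_pmod.
move=> h1 h2 h3; have [E|E] : (A %% 2)%Z = 0 \/ (A %% 2)%Z = 1 by lia.
  by left; exists (A %/ 2)%Z; lia.
by right; exists (A %/ 2)%Z; lia.
Qed.

Lemma intr_norm (R : pzRingType) (A B : int) (n : nat) :
  (A ^+ 2 + n%:Z * B ^+ 2)%:~R = A%:~R ^+ 2 + n%:R * B%:~R ^+ 2 :> R.
Proof.
rewrite (rmorphD (intr : int -> R)) (rmorphXn (intr : int -> R)); congr (_ + _).
by rewrite [LHS]intrM (rmorphXn (intr : int -> R)).
Qed.

(** [T] and [N] are the trace and the norm of (T + V sqrt d) / 2; reduction modulo 4 shows that the
    integers of Q(sqrt d) are Z[sqrt d]. *)
Lemma norm_mod4 (d : nat) (T V N : int) : (d %% 4 = 2)%N \/ (d %% 4 = 3)%N ->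
  T ^+ 2 = d%:Z * V ^+ 2 + 4 * N -> exists A C : int, T = 2 * A /\ V = 2 * C.
Proof.
move=> d4 E; have [r [j [r23 jE]]] : exists (r j : nat), (r = 2 \/ r = 3)%N /\ d = (4 * j + r)%N.
  by exists (d %% 4)%N, (d %/ 4)%N; rewrite {3}(divn_eq d 4) mulnC.
have [[u uE]|[u uE]] := int_parity T; have [[v vE]|[v vE]] := int_parity V.
- by exists u, v.
- have : 4 * u ^+ 2 = 4 * (j%:Z * V ^+ 2 + r%:Z * (v ^+ 2 + v) + N) + r%:Z.
    by transitivity (T ^+ 2); [rewrite uE | rewrite E jE vE]; ring.
  by case: r23 => ->; lia.
- have : 4 * (u ^+ 2 + u) + 1 = 4 * (d%:Z * v ^+ 2 + N).
    by transitivity (T ^+ 2); [rewrite uE | rewrite E vE]; ring.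
  by lia.
- have : 4 * (u ^+ 2 + u) + 1 = 4 * (j%:Z * V ^+ 2 + r%:Z * (v ^+ 2 + v) + N) + r%:Z.
    by transitivity (T ^+ 2); [rewrite uE | rewrite E jE vE]; ring.
  by case: r23 => ->; lia.
Qed.

Lemma intr_exp (R : pzRingType) (n : int) k : (n ^+ k)%:~R = n%:~R ^+ k :> R.
Proof. exact: (rmorphXn (intr : int -> R)). Qed.

(** The parity of a valuation is an invariant of the square class; all later non-square arguments
    are made prime by prime through it. *)
Lemma logn_sqr_class l (a b : nat) (r : rat) : (0 < a)%N -> (0 < b)%N ->
  a%:R * r ^+ 2 = b%:R -> odd (logn l a) = odd (logn l b).
Proof.
move=> a0 b0 E.
have r0 : r != 0.
  by apply: contraTneq b0 => r0; move/eqP: E; rewrite r0 expr0n mulr0 eq_sym pnatr_eq0 => /eqP->.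
have den0 : ((denq r)%:~R : rat) != 0 by rewrite intr_eq0 denq_neq0.
have {}E : a%:Z * numq r ^+ 2 = b%:Z * denq r ^+ 2.
  apply: (@intr_inj rat); rewrite [LHS]intrM [RHS]intrM !(rmorphXn (intr : int -> rat)) -!pmulrn -E -{2}(divq_num_den r).
  by field.
have {}E : (a * `|numq r| ^ 2 = b * `|denq r| ^ 2)%N.
  by rewrite -!abszX -[a]/(`|a%:Z|%N) -[b]/(`|b%:Z|%N) -!abszM E.
have := congr1 (logn l) E.
rewrite (lognM l a0) ?(lognM l b0) ?expn_gt0 ?absz_gt0 ?numq_eq0 ?r0 ?denq_neq0 // !lognX.
by rewrite !mul2n => /(congr1 odd); rewrite [LHS]oddD [RHS]oddD !odd_double !addbF.
Qed.

(** The square of the denominator of [r] would divide [n]. *)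
Lemma squarefree_sqr_int (n : nat) (r : rat) (k : int) : (0 < n)%N ->
  (forall l, prime l -> ~~ (l ^ 2 %| n)%N) -> n%:R * r ^+ 2 = k%:~R -> exists j : int, r = j%:~R.
Proof.
move=> n0 sqf E.
have den0 : ((denq r)%:~R : rat) != 0 by rewrite intr_eq0 denq_neq0.
have {}E : n%:Z * numq r ^+ 2 = k * denq r ^+ 2.
  apply: (@intr_inj rat); rewrite [LHS]intrM [RHS]intrM -E !(rmorphXn (intr : int -> rat)) -{2}(divq_num_den r).
  by rewrite -pmulrn; field.
have dvd : (`|denq r| ^ 2 %| n)%N.
  have : (`|denq r| ^ 2 %| n * `|numq r| ^ 2)%N.
    by apply/dvdnP; exists `|k|%N; rewrite -!abszX -abszM -E abszM.
  by rewrite Gauss_dvdl // coprime_pexpl // coprime_pexpr // coprime_sym coprime_num_den.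
have [den1|den1] := leqP `|denq r| 1.
  exists (numq r); rewrite -[LHS]divq_num_den.
  have -> : denq r = 1 by have := denq_gt0 r; move: den1; lia.
  by rewrite divr1.
case/negP: (sqf _ (pdiv_prime den1)); apply: dvdn_trans dvd.
by rewrite dvdn_exp2r // pdiv_dvd.
Qed.

(* The hypotheses say [(l, theta) ^ 2 = (l)] and [rad l * theta <= (l)], so that [rad l = (l, theta)]. *)
Lemma sq_ideal_rad (K : fieldExtType rat) l (theta a b c : K) : prime l ->
  let OK := @ringOfIntegers K in
  OK a -> OK b -> OK c -> OK theta -> OK (theta ^+ 2 / l%:R) ->
  1 = a * l%:R + b * theta + c * (theta ^+ 2 / l%:R) ->
  (forall z, rad l z -> OK (z * theta / l%:R)) -> sq_ideal (radI K l) l%:R.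
Proof.
move=> pl OK Oa Ob Oc Ot Ot2 one H; have l0 := natr_neq0 K (prime_gt0 pl).
have rt : rad l theta by split=> //; exists 2.
have rl := @rad_nat K l.
have [_ _ radM] := @rad_sub K l.
split=> [z w rz rw|].
  have Oz := rad_OK rz; have Ow := rad_OK rw.
  have -> : z * w / l%:R = a * (z * w) + b * ((z * theta / l%:R) * w) +
      c * ((z * theta / l%:R) * (w * theta / l%:R)).
    rewrite -[z * w / _]mulr1 [X in _ * X = _]one; by field.
  by do !apply: OKD; apply: OKM => //; apply: OKM => //; exact: H.
have -> : (l%:R : K) = (a * l%:R) * l%:R + (b * theta) * l%:R + (c * theta) * theta.
  by rewrite -[LHS]mul1r [X in X * _ = _]one; field.
have [_ ID _] := idealMul_sub (radI K l : set K) (@rad_sub K l).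
by apply: (ID); first apply: (ID); apply: idealMul_in => //; apply: radM.
Qed.

Lemma adjoin_sqrt (K : fieldExtType rat) (E : {subfield K}) (y z : K) :
  y ^+ 2 \in E -> z \in <<E; y>>%VS ->
  exists u v, [/\ u \in E, v \in E & z = u + v * y].
Proof.
move=> y2 /Fadjoin_polyP[p /polyOverP pE ->]; rewrite horner_coef.
elim/big_ind: _ => [|_ _ [u [v [Eu Ev ->]]] [u' [v' [Eu' Ev' ->]]]|i _].
- by exists 0, 0; rewrite mem0v mul0r addr0.
- by exists (u + u'), (v + v'); split; [exact: memvD | exact: memvD | ring].
have [u [v [Eu Ev ->]]] : exists u v, [/\ u \in E, v \in E & y ^+ i = u + v * y].
  elim: (nat_of_ord i) => [|n [u [v [Eu Ev IH]]]].
    by exists 1, 0; rewrite mem1v mem0v expr0 mul0r addr0.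
  exists (v * y ^+ 2), u; split=> //; first exact: memvM.
  by rewrite exprS IH; ring.
by exists (p`_i * u), (p`_i * v); split; [exact: memvM | exact: memvM | ring].
Qed.

(** * The field Q(sqrt (- M), sqrt d) *)

Section Biquadratic.

Variable K : fieldExtType rat.
Variable emb : {rmorphism rat -> K}.
Variables (M d : nat) (x y : K).
Hypothesis x2 : x ^+ 2 = - M%:R.
Hypothesis y2 : y ^+ 2 = d%:R.
Hypothesis gen : <<1 & [:: x; y]>>%VS = fullv.
Hypothesis M_gt0 : (0 < M)%N.
Hypothesis d_gt0 : (0 < d)%N.
Hypothesis d_nsq : forall r : rat, r ^+ 2 != d%:R.
Notation OK := (@ringOfIntegers K).

Lemma embE r : emb r = in_alg K r.
Proof. by rewrite !fmorph_eq_rat. Qed.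

Definition el (a b c e : rat) : K := emb a + emb b * x + emb c * y + emb e * (x * y).

Lemma el_surj z : exists q : rat * rat * rat * rat, z = el q.1.1.1 q.1.1.2 q.1.2 q.2.
Proof.
have zin : z \in <<<<1; x>>; y>>%VS.
  have : z \in <<1 & rcons [:: x] y>>%VS by rewrite [rcons _ _]/= gen memvf.
  by rewrite adjoin_rcons adjoin_seq1.
have y2in : y ^+ 2 \in <<1; x>>%VS by rewrite y2 rpredMn // mem1v.
have [u [v [Eu Ev ->]]] := adjoin_sqrt (E := <<1; x>>%AS) y2in zin.
have x2in : x ^+ 2 \in (1%AS : {subfield K}) by rewrite x2 rpredN rpredMn // mem1v.
have [_ [_ [/vlineP[a ->] /vlineP[b ->] Eu']]] := adjoin_sqrt (E := 1%AS) x2in Eu.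
have [_ [_ [/vlineP[c ->] /vlineP[e ->] Ev']]] := adjoin_sqrt (E := 1%AS) x2in Ev.
exists (a, b, c, e); rewrite /el /= !embE /= Eu' Ev'; ring.
Qed.

Lemma sqr_sum_eq0 (a b : rat) (n : nat) : (0 < n)%N -> a ^+ 2 + n%:R * b ^+ 2 = 0 -> a = 0 /\ b = 0.
Proof.
move=> n0 /eqP; rewrite paddr_eq0 ?sqr_ge0 //; last by rewrite mulr_ge0 ?sqr_ge0 ?ler0n.
rewrite sqrf_eq0 mulf_eq0 sqrf_eq0 pnatr_eq0 => /andP[/eqP-> /orP[|/eqP->//]].
by rewrite -leqn0 leqNgt n0.
Qed.

Lemma el2_eq0 a b : emb a + emb b * x = 0 -> a = 0 /\ b = 0.
Proof.
move=> E; apply: (sqr_sum_eq0 M_gt0); apply: (fmorph_inj emb); rewrite rmorph0.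
have : (emb a + emb b * x) * (emb a - emb b * x) = 0 by rewrite E mul0r.
move=> <-; ring: x2.
Qed.

Lemma d_sq_eq0 (a c : rat) : a ^+ 2 = d%:R * c ^+ 2 -> a = 0 /\ c = 0.
Proof.
have [-> /eqP|c0 E] := eqVneq c 0; first by rewrite expr0n mulr0 sqrf_eq0 => /eqP.
by case/eqP: (d_nsq (a / c)); rewrite expr_div_n E mulfK // expf_neq0.
Qed.

(** Multiplication by the conjugate over Q(x) gives [(a + b x) ^ 2 = d (c + e x) ^ 2]. Real parts
    and absolute values of both sides agree; adding and subtracting these two equations makes [d] a
    rational square unless all coordinates vanish. *)
Lemma el_eq0 a b c e : el a b c e = 0 -> [/\ a = 0, b = 0, c = 0 & e = 0].
Proof.
move=> E.
have E2 : emb (a ^+ 2 - M%:R * b ^+ 2 - d%:R * (c ^+ 2 - M%:R * e ^+ 2)) +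
    emb (2 * a * b - d%:R * (2 * c * e)) * x = 0.
  transitivity (el a b c e * (emb a + emb b * x - (emb c + emb e * x) * y)); last by rewrite E mul0r.
  by rewrite /el; ring: x2 y2.
have [E3 E4] := el2_eq0 E2.
have sq_ge0 (u v : rat) : 0 <= u ^+ 2 + M%:R * v ^+ 2.
  by apply: addr_ge0; [exact: sqr_ge0 | apply: mulr_ge0; [exact: ler0n | exact: sqr_ge0]].
(* The equality of absolute values, from the real and imaginary parts. *)
have N : a ^+ 2 + M%:R * b ^+ 2 = d%:R * (c ^+ 2 + M%:R * e ^+ 2).
  have s0 : 0 <= a ^+ 2 + M%:R * b ^+ 2 by apply: sq_ge0.
  have s1 : 0 <= d%:R * (c ^+ 2 + M%:R * e ^+ 2).
    by apply: mulr_ge0; [exact: ler0n | exact: sq_ge0].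
  apply/eqP; rewrite -(@eqrXn2 _ 2) // -subr_eq0; apply/eqP.
  transitivity ((a ^+ 2 - M%:R * b ^+ 2 - d%:R * (c ^+ 2 - M%:R * e ^+ 2)) *
      (a ^+ 2 - M%:R * b ^+ 2 + d%:R * (c ^+ 2 - M%:R * e ^+ 2)) +
    M%:R * (2 * a * b - d%:R * (2 * c * e)) * (2 * a * b + d%:R * (2 * c * e))); first by ring.
  by rewrite E3 E4; ring.
have [-> ->] : a = 0 /\ c = 0.
  apply: d_sq_eq0; apply: (mulfI (x := 2)) => //.
  transitivity ((a ^+ 2 - M%:R * b ^+ 2 - d%:R * (c ^+ 2 - M%:R * e ^+ 2)) + (a ^+ 2 + M%:R * b ^+ 2) + d%:R * (c ^+ 2 - M%:R * e ^+ 2)); first by ring.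
  by rewrite E3 N; ring.
have [-> ->] : b = 0 /\ e = 0.
  apply: d_sq_eq0; apply: (mulfI (x := 2 * M%:R)); first by rewrite mulf_neq0 // pnatr_eq0 -lt0n.
  transitivity (- (a ^+ 2 - M%:R * b ^+ 2 - d%:R * (c ^+ 2 - M%:R * e ^+ 2)) + (a ^+ 2 + M%:R * b ^+ 2) - d%:R * (c ^+ 2 - M%:R * e ^+ 2)); first by ring.
  by rewrite E3 N; ring.
by [].
Qed.

Lemma el_inj a b c e a' b' c' e' : el a b c e = el a' b' c' e' ->
  [/\ a = a', b = b', c = c' & e = e'].
Proof.
move/eqP; rewrite -subr_eq0 => /eqP E.
have /el_eq0[] : el (a - a') (b - b') (c - c') (e - e') = 0.
  by rewrite -E /el; ring.
by do 4!move/subr0_eq ->.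
Qed.

Definition coords z : rat * rat * rat * rat :=
  xget (0, 0, 0, 0) [set q | z = el q.1.1.1 q.1.1.2 q.1.2 q.2].

Lemma coords_el a b c e : coords (el a b c e) = (a, b, c, e).
Proof.
rewrite /coords; case: xgetP => [[[[a' b'] c'] e'] _ /= /el_inj[-> -> -> ->] //|].
by move=> /(_ (a, b, c, e)) no; case: no.
Qed.

Definition sgn (b : bool) (r : rat) : rat := if b then - r else r.

(* [gal (s, t)] sends [x] to [(-1)^s x] and [y] to [(-1)^t y]. *)
Definition galf (u : bool * bool) (z : K) : K :=
  let: (a, b, c, e) := coords z in
  el a (sgn u.1 b) (sgn u.2 c) (sgn (u.1 (+) u.2) e).

Lemma galf_el u a b c e :
  galf u (el a b c e) = el a (sgn u.1 b) (sgn u.2 c) (sgn (u.1 (+) u.2) e).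
Proof. by rewrite /galf coords_el. Qed.

Lemma el_sub a b c e a' b' c' e' :
  el a b c e - el a' b' c' e' = el (a - a') (b - b') (c - c') (e - e').
Proof. by rewrite /el; ring. Qed.

Lemma el_mul a b c e a' b' c' e' : el a b c e * el a' b' c' e' =
  el (a * a' - M%:R * (b * b') + d%:R * (c * c') - M%:R * d%:R * (e * e'))
     (a * b' + b * a' + d%:R * (c * e' + e * c'))
     (a * c' + c * a' - M%:R * (b * e' + e * b'))
     (a * e' + e * a' + b * c' + c * b').
Proof. by rewrite /el; ring: x2 y2. Qed.

Lemma galf_zmod u : zmod_morphism (galf u).
Proof.
move=> z w; have [[[[a b] c] e] /= ->] := el_surj z; have [[[[a' b'] c'] e'] /= ->] := el_surj w.
rewrite el_sub !galf_el el_sub; congr el; rewrite /sgn; case: ifP => // _; ring.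
Qed.

Lemma galf_monoid u : monoid_morphism (galf u).
Proof.
split.
  have -> : 1 = el 1 0 0 0 by rewrite /el; ring.
  by rewrite galf_el /sgn !oppr0 !if_same.
move=> z w; have [[[[a b] c] e] /= ->] := el_surj z; have [[[[a' b'] c'] e'] /= ->] := el_surj w.
by rewrite el_mul !galf_el el_mul; case: u => [[] []]; rewrite /sgn /=; congr el; ring.
Qed.

HB.instance Definition _ u := GRing.isZmodMorphism.Build K K (galf u) (galf_zmod u).
HB.instance Definition _ u := GRing.isMonoidMorphism.Build K K (galf u) (galf_monoid u).

Definition gal (u : bool * bool) : {rmorphism K -> K} := galf u.

Lemma gal_el u a b c e :
  gal u (el a b c e) = el a (sgn u.1 b) (sgn u.2 c) (sgn (u.1 (+) u.2) e).
Proof. exact: galf_el. Qed.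

Lemma galK u : cancel (gal u) (gal u).
Proof.
move=> z; have [[[[a b] c] e] /= ->] := el_surj z; rewrite !gal_el.
by case: u => [[] []]; rewrite /sgn /= ?opprK.
Qed.

Lemma gal1 z : gal (false, false) z = z.
Proof. by have [[[[a b] c] e] /= ->] := el_surj z; rewrite !gal_el. Qed.

Lemma gal_rat u r : gal u (emb r) = emb r.
Proof.
have -> : emb r = el r 0 0 0 by rewrite /el; ring.
by rewrite gal_el /sgn !oppr0 !if_same.
Qed.

Definition sigma := gal (true, false).
Definition tau := gal (false, true).

Lemma sigma_el a b c e : sigma (el a b c e) = el a (- b) c (- e). Proof. exact: gal_el. Qed.
Lemma tau_el a b c e : tau (el a b c e) = el a b (- c) (- e). Proof. exact: gal_el. Qed.

Lemma big_bool2 (R : Type) (idx : R) (op : Monoid.com_law idx) (F : bool * bool -> R) :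
  \big[op/idx]_u F u =
  op (op (F (true, true)) (F (true, false))) (op (F (false, true)) (F (false, false))).
Proof.
transitivity (\big[op/idx]_u F (u.1, u.2)); first by apply: eq_bigr => -[].
by rewrite -(pair_bigA _ (fun a b => F (a, b))) /= !big_bool.
Qed.

Lemma gal_norm z : exists r : rat, \prod_u gal u z = in_alg K r.
Proof.
have [[[[a b] c] e] /= ->] := el_surj z; rewrite big_bool2 /= !gal_el /sgn /=.
rewrite !el_mul.
set A := (X in el X _ _ _); set B := (X in el _ X _ _); set C := (X in el _ _ X _); set E := (X in el _ _ _ X).
have -> : B = 0 by rewrite /B; ring.
have -> : C = 0 by rewrite /C; ring.
have -> : E = 0 by rewrite /E; ring.
exists A; transitivity (emb A); last exact: embE.
by rewrite /el; ring.
Qed.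

Lemma emb_int (n : int) : emb n%:~R = n%:~R. Proof. exact: rmorph_int. Qed.
Lemma emb_nat (n : nat) : emb n%:R = n%:R. Proof. exact: rmorph_nat. Qed.

Lemma OKx : OK x.
Proof. by apply: (@OK_of_expn _ _ 2) => //; rewrite x2; apply/OKN/OK_nat. Qed.

Lemma OKy : OK y.
Proof. by apply: (@OK_of_expn _ _ 2) => //; rewrite y2; apply/OK_nat. Qed.

(** The trace is four times the first coordinate; multiplying by [x], [y] or [x * y] first brings
    another coordinate to that place. This bounds denominators both in the ring of integers and in
    [rad l]. *)
Lemma trace_stable (S : set K) a b c e : is_submodule S ->
  (forall u z, S z -> S (gal u z)) -> S (el a b c e) ->
  [/\ S (emb (4 * a)), S (emb (4 * M%:R * b)), S (emb (4 * d%:R * c))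
    & S (emb (4 * (M * d)%:R * e))].
Proof.
move=> sS stab; have [S0 SD SM] := sS.
have tr a' b' c' e' : S (el a' b' c' e') -> S (emb (4 * a')).
  move=> Sz; have -> : emb (4 * a') = \sum_u gal u (el a' b' c' e').
    by rewrite big_bool2 /= !gal_el /sgn /= /el; ring.
  by elim/big_ind: _ => // u _; exact: stab.
move=> Sz; split; first exact: tr Sz.
- have -> : emb (4 * M%:R * b) = - emb (4 * (- M%:R * b)) by ring.
  apply: subN => //.
  apply: (tr _ a (- M%:R * e) c).
  have -> : el (- M%:R * b) a (- M%:R * e) c = x * el a b c e by rewrite /el; ring: x2.
  by apply: SM => //; exact: OKx.
- have -> : emb (4 * d%:R * c) = emb (4 * (d%:R * c)) by ring.
  apply: (tr _ (d%:R * e) a b).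
  have -> : el (d%:R * c) (d%:R * e) a b = y * el a b c e by rewrite /el; ring: y2.
  by apply: SM => //; exact: OKy.
- have -> : emb (4 * (M * d)%:R * e) = - emb (4 * (- (M * d)%:R * e)) by ring.
  apply: subN => //.
  apply: (tr _ (d%:R * c) (- M%:R * b) a).
  have -> : el (- (M * d)%:R * e) (d%:R * c) (- M%:R * b) a = x * y * el a b c e.
    by rewrite /el natrM; ring: x2 y2.
  by apply: SM => //; apply: OKM; [exact: OKx | exact: OKy].
Qed.

Lemma OK_emb r : OK (emb r) -> exists n : int, r = n%:~R.
Proof. by rewrite embE; exact: OK_rat. Qed.

Lemma OK_coords a b c e : OK (el a b c e) ->
  exists k0 k1 k2 k3 : int, [/\ 4 * a = k0%:~R, 4 * M%:R * b = k1%:~R,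
    4 * d%:R * c = k2%:~R & 4 * (M * d)%:R * e = k3%:~R].
Proof.
case/(trace_stable (@OK_sub K) (fun u z => @OK_conj _ (gal u) z)).
by move=> /OK_emb[k0 ->] /OK_emb[k1 ->] /OK_emb[k2 ->] /OK_emb[k3 ->]; exists k0, k1, k2, k3.
Qed.

Lemma rad_coords l a b c e : prime l -> rad l (el a b c e) ->
  exists k0 k1 k2 k3 : int, [/\ 4 * a = k0%:~R * l%:R, 4 * M%:R * b = k1%:~R * l%:R,
    4 * d%:R * c = k2%:~R * l%:R & 4 * (M * d)%:R * e = k3%:~R * l%:R].
Proof.
move=> pl; case/(trace_stable (@rad_sub K l) (fun u z => @rad_conj _ (gal u) l z)).
have key r : rad l (emb r) -> exists k : int, r = k%:~R * l%:R.
  move=> rr; have [n rn] := OK_emb (rad_OK rr).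
  move: rr; rewrite rn emb_int => /(rad_int pl)/dvdzP[k ->]; exists k.
  by rewrite intrM -pmulrn.
by move=> /key[k0 ->] /key[k1 ->] /key[k2 ->] /key[k3 ->]; exists k0, k1, k2, k3.
Qed.

Lemma OK_el (a b c e : int) : OK (el a%:~R b%:~R c%:~R e%:~R).
Proof.
rewrite /el !emb_int; do !apply: OKD; do ?apply: OKM; try exact: OK_int;
  [exact: OKx | exact: OKy | exact: OKx | exact: OKy].
Qed.

Lemma fin_mod l : (0 < l)%N -> exists (T : finType) (c : K -> T),
  forall z w, OK z -> OK w -> c z = c w -> OK ((z - w) / l%:R).
Proof.
(* [4 * M * d] is a common denominator for the coordinates of integers, and the factor [l] makes
   elements of equal class differ by [l] times an integer. *)
move=> l0; pose D := (4 * (M * d) * l)%N.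
have D0 : (0 < D)%N by rewrite !muln_gt0 M_gt0 d_gt0 l0.
pose md (k : int) : 'I_D := Ordinal (ltn_pmod (`|(k %% D)%Z|%N) D0).
have mdP k k' : md k = md k' -> exists q : int, k - k' = q * D.
  move/(congr1 (@nat_of_ord _)) => /=.
  have D0z : D%:Z != 0 by rewrite eqz_nat -lt0n.
  have nn j : (`|(j %% D)%Z| %% D)%N = `|(j %% D)%Z|%N.
    have := modz_ge0 j D0z; have : (j %% D < D)%Z by exact: ltz_pmod.
    by case: (j %% D)%Z => // r rl _; rewrite modn_small.
  rewrite !nn => E.
  have {}E : (k %% D)%Z = (k' %% D)%Z by rewrite -(gez0_abs (modz_ge0 k D0z)) -(gez0_abs (modz_ge0 k' D0z)) E.
  exists ((k %/ D)%Z - (k' %/ D)%Z).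
  by rewrite {1}(divz_eq k D) {1}(divz_eq k' D) E; ring.
move: md mdP => md mdP.
have /choice[g gP] : forall z, exists k : int * int * int * int, OK z ->
    let: (a, b, c, e) := coords z in
    [/\ 4 * a = k.1.1.1%:~R, 4 * M%:R * b = k.1.1.2%:~R,
    4 * d%:R * c = k.1.2%:~R & 4 * (M * d)%:R * e = k.2%:~R].
  move=> z; have [[[[a b] c] e] /= ->] := el_surj z.
  have [Oz|nOz] := pselect (OK (el a b c e)); last by exists (0, 0, 0, 0).
  have [k0 [k1 [k2 [k3 Ek]]]] := OK_coords Oz.
  by exists (k0, k1, k2, k3) => _; rewrite coords_el.
exists ('I_D * 'I_D * 'I_D * 'I_D)%type.
exists (fun z => (md (g z).1.1.1, md (g z).1.1.2, md (g z).1.2, md (g z).2)).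
move=> z w Oz Ow [/mdP[q0 E0] /mdP[q1 E1] /mdP[q2 E2] /mdP[q3 E3]].
move: (g z) (g w) (gP _ Oz) (gP _ Ow) E0 E1 E2 E3 => k k'.
have [[[[a b] c] e] /= ->] := el_surj z; have [[[[a' b'] c'] e'] /= ->] := el_surj w.
rewrite !coords_el => -[a2 b2 c2 e2] [a1 b1 c1 e1] E0 E1 E2 E3.
have four : (4 : rat) != 0 by [].
have M0 : (M%:R : rat) != 0 by rewrite pnatr_eq0 -lt0n.
have dr0 : (d%:R : rat) != 0 by rewrite pnatr_eq0 -lt0n.
have DE : D%:R = 4 * M%:R * d%:R * l%:R :> rat by rewrite !natrM; ring.
have cast (i j q : int) : i - j = q * D -> i%:~R - j%:~R = q%:~R * D%:R :> rat.
  by move=> E; rewrite -intrB E intrM -pmulrn.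
have -> : (el a b c e - el a' b' c' e') / l%:R =
    el (q0 * (M * d)%:Z)%:~R (q1 * d%:Z)%:~R (q2 * M%:Z)%:~R q3%:~R.
  have -> : el a b c e - el a' b' c' e' = emb l%:R *
      el (q0 * (M * d)%:Z)%:~R (q1 * d%:Z)%:~R (q2 * M%:Z)%:~R q3%:~R.
    have -> : a = a' + l%:R * (q0 * (M * d)%:Z)%:~R.
      apply: (mulfI four); rewrite mulrDr a1 a2; rewrite -[LHS](subrK k'.1.1.1%:~R) (cast _ _ _ E0) DE.
      by rewrite intrM -!pmulrn natrM; ring.
    have -> : b = b' + l%:R * (q1 * d%:Z)%:~R.
      apply: (mulfI (mulf_neq0 four M0)); rewrite mulrDr b1 b2 -[LHS](subrK k'.1.1.2%:~R) (cast _ _ _ E1) DE.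
      by rewrite intrM -!pmulrn; ring.
    have -> : c = c' + l%:R * (q2 * M%:Z)%:~R.
      apply: (mulfI (mulf_neq0 four dr0)); rewrite mulrDr c1 c2 -[LHS](subrK k'.1.2%:~R) (cast _ _ _ E2) DE.
      by rewrite intrM -!pmulrn; ring.
    have -> : e = e' + l%:R * q3%:~R.
      have Md0 : ((M * d)%:R : rat) != 0 by rewrite natrM mulf_neq0.
      apply: (mulfI (mulf_neq0 four Md0)); rewrite mulrDr e1 e2 -[LHS](subrK k'.2%:~R) (cast _ _ _ E3) DE natrM.
      by ring.
    by rewrite /el; ring.
  by rewrite emb_nat mulrAC divff ?natr_neq0 // mul1r.
exact: OK_el.
Qed.

Lemma elE a b c e : el a b c e = a *: 1 + b *: x + c *: y + e *: (x * y).
Proof. by rewrite /el !embE !in_algE !mulr_algl. Qed.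

Lemma dim_biquadratic : \dim {: K} = 4.
Proof.
pose X := [:: 1; x; y; x * y].
have XE (k : 'I_4 -> rat) : \sum_(i < 4) k i *: X`_i =
    el (k ord0) (k (lift ord0 ord0)) (k (lift ord0 (lift ord0 ord0)))
       (k (lift ord0 (lift ord0 (lift ord0 ord0)))).
  by rewrite !big_ord_recl big_ord0 addr0 elE !addrA.
have bX : basis_of fullv X.
  apply/andP; split; last first.
    change (is_true (free (in_tuple X))); apply/freeP => k kX.
    have [a0 b0 c0 e0] := el_eq0 (etrans (esym (XE k)) kX).
    move=> i.
    case: (unliftP ord0 i) => [j ->|->] //; case: (unliftP ord0 j) => [j' ->|->] //.
    by case: (unliftP ord0 j') => [j'' ->|->] //; rewrite (ord1 j'').
  rewrite eqEsubv subvf /=; apply/subvP => z _.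
  have [[[[a b] c] e] /= ->] := el_surj z; rewrite elE.
  have mX w : w \in X -> w \in <<X>>%VS by exact: memv_span.
  apply: memvD; first apply: memvD; first apply: memvD;
    by apply/memvZ/mX; rewrite !inE eqxx ?orbT.
exact: (size_basis (X := in_tuple X) bX).
Qed.

(** Every automorphism fixes [z] up to sign, so [z] is a rational multiple of [1], [x], [y] or
    [x * y]. *)
Lemma rational_sqr z r : z ^+ 2 = emb r ->
  exists s : rat, [\/ r = s ^+ 2, r = - M%:R * s ^+ 2, r = d%:R * s ^+ 2 | r = - M%:R * (d%:R * s ^+ 2)].
Proof.
have [[[[a b] c] e] /= ->] := el_surj z => E.
have sq u : gal u (el a b c e) = el a b c e \/ gal u (el a b c e) = - el a b c e.
  have : gal u (el a b c e) ^+ 2 == el a b c e ^+ 2 by rewrite -rmorphXn E gal_rat.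
  by rewrite eqf_sqr => /orP[]/eqP; [left | right].
have elN : - el a b c e = el (- a) (- b) (- c) (- e) by rewrite /el; ring.
have s1 := sq (true, false); have s2 := sq (false, true).
rewrite !gal_el elN /sgn /= in s1 s2.
have E' k : el a b c e ^+ 2 = emb k -> r = k by rewrite E => /fmorph_inj.
have zero (k : rat) : k = - k -> k = 0 by lra.
case: s1 => /el_inj[h1 h2 h3 h4]; case: s2 => /el_inj[g1 g2 g3 g4].
- have b0 := zero _ (esym h2); have e0 := zero _ (esym h4); have c0 := zero _ (esym g3).
  by exists a; constructor 1; apply: E'; rewrite b0 c0 e0 /el; ring.
- have b0 := zero _ (esym h2); have e0 := zero _ (esym h4); have a0 := zero _ g1.
  by exists c; constructor 3; apply: E'; rewrite b0 a0 e0 /el; ring: y2.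
- have a0 := zero _ h1; have c0 := zero _ h3; have e0 := zero _ (esym g4).
  by exists b; constructor 2; apply: E'; rewrite a0 c0 e0 /el; ring: x2.
- have a0 := zero _ h1; have c0 := zero _ h3; have b0 := zero _ g2.
  by exists e; constructor 4; apply: E'; rewrite a0 c0 b0 /el; ring: x2 y2.
Qed.

(** * Ramification of the rational primes *)

Variable d0 : nat.
Hypothesis d0_prime : prime d0.
Hypothesis d0_odd : odd d0.
Hypothesis dE : d = (2 * d0)%N \/ d = d0 /\ (d %% 4 = 3)%N.
Hypothesis M_sqf : forall l, prime l -> ~~ (l ^ 2 %| M)%N.
Hypothesis M_mod4 : (M %% 4 = 3)%N.

Lemma d_sqf l : prime l -> ~~ (l ^ 2 %| d)%N.
Proof.
move=> pl; apply/negP => l2d.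
have ld0 : (l %| d0)%N -> l = d0 by rewrite dvdn_prime2 // => /eqP.
have [ll|l2] := eqVneq l 2%N.
  move: l2d; rewrite ll; have := d0_odd; case: dE => [->|[-> _]].
    by rewrite -mulnn dvdn_pmul2l // dvdn2 => ->.
  by move=> od; move/(dvdn_trans (dvdn_exp _ (dvdnn 2))) => /(_ isT); rewrite dvdn2 od.
have : (l ^ 2 %| d0)%N.
  move: l2d; case: dE => [->|[-> _] //]; rewrite Gauss_dvdr // coprime_pexpl //.
  by rewrite prime_coprime // dvdn_prime2.
move=> l2d0; have El : l = d0 by apply/ld0/(dvdn_trans _ l2d0)/dvdn_exp.
move: l2d0; rewrite -El => /(dvdn_leq (prime_gt0 pl)).
by rewrite leqNgt -{1}(expn1 l) ltn_exp2l // prime_gt1.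
Qed.

Let rM0 : (M%:R : K) != 0. Proof. exact: natr_neq0. Qed.
Let rd0 : (d%:R : K) != 0. Proof. exact: natr_neq0. Qed.
Let qM0 : (M%:R : rat) != 0. Proof. by rewrite pnatr_eq0 -lt0n. Qed.
Let qd0 : (d%:R : rat) != 0. Proof. by rewrite pnatr_eq0 -lt0n. Qed.
Let rl0 l : prime l -> (l%:R : K) != 0. Proof. by move/prime_gt0/natr_neq0. Qed.

Lemma rad_param l z : prime l -> rad l z -> exists k0 k1 k2 k3 : int,
  z * (4 * M%:R * d%:R) = l%:R * (k0%:~R * (M%:R * d%:R) + k1%:~R * d%:R * x + k2%:~R * M%:R * y + k3%:~R * (x * y)).
Proof.
move=> pl; have [[[[a b] c] e] /= ->] := el_surj z.
move/(rad_coords pl) => [k0 [k1 [k2 [k3 [E0 E1 E2 E3]]]]]; exists k0, k1, k2, k3.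
rewrite /el; transitivity (emb (4 * a) * (M%:R * d%:R) + emb (4 * M%:R * b) * d%:R * x +
   emb (4 * d%:R * c) * M%:R * y + emb (4 * (M * d)%:R * e) * (x * y)).
  by rewrite natrM; ring.
by rewrite E0 E1 E2 E3; ring.
Qed.

Lemma OK_lin (k0 k1 k2 k3 : int) : OK (k0%:~R + k1%:~R * x + k2%:~R * y + k3%:~R * (x * y)).
Proof. by rewrite -!emb_int; exact: OK_el. Qed.

Lemma OK_prime_coprime l (n : nat) (z : K) : prime l -> ~~ (l %| n)%N ->
  OK (n%:R * z) -> OK (l%:R * z) -> OK z.
Proof.
move=> pl nl; rewrite !pmulrn; apply: OK_coprime.
by rewrite coprimezE /= coprime_sym prime_coprime.
Qed.

Lemma not_dvd4M l n : prime l -> l != 2%N -> ~~ (l %| n)%N -> ~~ (l %| 4 * n)%N.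
Proof.
move=> pl l2 nl; rewrite Euclid_dvdM // negb_or nl andbT.
by rewrite (_ : 4 = 2 ^ 2)%N // Euclid_dvdX // andbT dvdn_prime2.
Qed.

(** The denominators, which divide [4 * M * d], are prime to [l]. *)
Lemma unramified_odd l z : prime l -> l != 2%N -> ~~ (l %| M)%N -> ~~ (l %| d)%N ->
  rad l z -> OK (z / l%:R).
Proof.
move=> pl l2 lM ld rz; have [k0 [k1 [k2 [k3 E]]]] := rad_param pl rz.
have nl : ~~ (l %| 4 * (M * d))%N by apply: not_dvd4M => //; rewrite Euclid_dvdM // negb_or lM.
apply: (OK_prime_coprime pl nl); last first.
  by rewrite mulrC divfK ?rl0 //; exact: rad_OK rz.
have -> : (4 * (M * d))%:R * (z / l%:R) = z * (4 * M%:R * d%:R) / l%:R by rewrite !natrM; ring.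
rewrite E [l%:R * _]mulrC mulfK ?rl0 //.
have -> : k0%:~R * (M%:R * d%:R) + k1%:~R * d%:R * x + k2%:~R * M%:R * y + k3%:~R * (x * y) =
  (k0 * (M%:Z * d%:Z))%:~R + (k1 * d%:Z)%:~R * x + (k2 * M%:Z)%:~R * y + k3%:~R * (x * y).
  by rewrite !intrM -!pmulrn.
exact: OK_lin.
Qed.

(** Here [rad l = (l, x)]: as [M] is squarefree, [x ^ 2 / l = - M'] is prime to [l]. *)
Lemma ramified_x l : prime l -> l != 2%N -> (l %| M)%N -> ~~ (l %| d)%N ->
  sq_ideal (radI K l) l%:R.
Proof.
move=> pl l2 /dvdnP[M' ME] ld.
have : coprimez l M'.
  rewrite coprimezE /= prime_coprime //; apply: contra (M_sqf pl) => /dvdnP[k kE].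
  by rewrite ME kE -mulnA dvdn_mull.
move=> /coprimezP[[u v] /= uv].
have MK : M%:R = M'%:R * l%:R :> K by rewrite ME natrM.
have x2l : x ^+ 2 / l%:R = - M'%:R by rewrite x2 MK -mulNr mulfK ?rl0.
apply: (@sq_ideal_rad _ _ x u%:~R 0 (- v%:~R)) => //.
- exact: OK_int.
- exact: OK0.
- exact/OKN/OK_int.
- exact: OKx.
- by rewrite x2l; exact/OKN/OK_nat.
- by rewrite x2l mul0r addr0 mulrNN !pmulrn -!intrM -intrD uv.
move=> z rz; have [k0 [k1 [k2 [k3 E]]]] := rad_param pl rz.
apply: (OK_prime_coprime pl (not_dvd4M pl l2 ld)); last first.
  by rewrite mulrC divfK ?rl0 //; apply: OKM; [exact: rad_OK rz | exact: OKx].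
(* Multiplication by [x] clears the factor [M] of the denominators; what remains is prime to [l]. *)
have -> : (4 * d)%:R * (z * x / l%:R) =
    (- (k1 * d%:Z))%:~R + (k0 * d%:Z)%:~R * x + (- k3)%:~R * y + k2%:~R * (x * y).
  apply: (mulfI rM0); apply: (mulfI (rl0 pl)).
  transitivity (z * (4 * M%:R * d%:R) * x); first by rewrite natrM; field; exact: rl0.
  by rewrite E !intrM; ring: x2.
exact: OK_lin.
Qed.

Lemma ramified_y l : prime l -> l != 2%N -> ~~ (l %| M)%N -> (l %| d)%N ->
  sq_ideal (radI K l) l%:R.
Proof.
move=> pl l2 lM /dvdnP[d' dd].
have : coprimez l d'.
  rewrite coprimezE /= prime_coprime //; apply: contra (d_sqf pl) => /dvdnP[k kE].
  by rewrite dd kE -mulnA dvdn_mull.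
move=> /coprimezP[[u v] /= uv].
have dK : d%:R = d'%:R * l%:R :> K by rewrite dd natrM.
have y2l : y ^+ 2 / l%:R = d'%:R by rewrite y2 dK mulfK ?rl0.
apply: (@sq_ideal_rad _ _ y u%:~R 0 v%:~R) => //.
- exact: OK_int.
- exact: OK0.
- exact: OK_int.
- exact: OKy.
- by rewrite y2l; exact: OK_nat.
- by rewrite y2l mul0r addr0 !pmulrn -!intrM -intrD uv.
move=> z rz; have [k0 [k1 [k2 [k3 E]]]] := rad_param pl rz.
apply: (OK_prime_coprime pl (not_dvd4M pl l2 lM)); last first.
  by rewrite mulrC divfK ?rl0 //; apply: OKM; [exact: rad_OK rz | exact: OKy].
have -> : (4 * M)%:R * (z * y / l%:R) =
    (k2 * M%:Z)%:~R + k3%:~R * x + (k0 * M%:Z)%:~R * y + k1%:~R * (x * y).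
  apply: (mulfI rd0); apply: (mulfI (rl0 pl)).
  transitivity (z * (4 * M%:R * d%:R) * y); first by rewrite natrM; field; exact: rl0.
  by rewrite E !intrM; ring: y2.
exact: OK_lin.
Qed.

(** Again [rad l = (l, x)], but the denominators contain [l] twice. The second factor is absorbed by
    the integer [x * y / l], a square root of [- M' * d']. *)
Lemma ramified_xy l : prime l -> l != 2%N -> (l %| M)%N -> (l %| d)%N ->
  sq_ideal (radI K l) l%:R.
Proof.
move=> pl l2 /dvdnP[M' ME] /dvdnP[d' dd].
have : coprimez l M'.
  rewrite coprimezE /= prime_coprime //; apply: contra (M_sqf pl) => /dvdnP[k kE].
  by rewrite ME kE -mulnA dvdn_mull.
have ld' : ~~ (l %| d')%N.
  apply: contra (d_sqf pl) => /dvdnP[k kE].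
  by rewrite dd kE -mulnA dvdn_mull.
move=> /coprimezP[[u v] /= uv].
have MK : M%:R = M'%:R * l%:R :> K by rewrite ME natrM.
have dK : d%:R = d'%:R * l%:R :> K by rewrite dd natrM.
have M'0 : (M'%:R : K) != 0 by apply: contra_neq rM0; rewrite MK => ->; rewrite mul0r.
have d'0 : (d'%:R : K) != 0 by apply: contra_neq rd0; rewrite dK => ->; rewrite mul0r.
have x2l : x ^+ 2 / l%:R = - M'%:R by rewrite x2 MK -mulNr mulfK ?rl0.
have Oxy : OK (x * y / l%:R).
  apply: (@OK_of_expn _ _ 2) => //.
  have -> : (x * y / l%:R) ^+ 2 = - (M' * d')%:R.
    rewrite expr_div_n exprMn x2 y2 MK dK natrM; field; exact: rl0.
  exact/OKN/OK_nat.
apply: (@sq_ideal_rad _ _ x u%:~R 0 (- v%:~R)) => //.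
- exact: OK_int.
- exact: OK0.
- exact/OKN/OK_int.
- exact: OKx.
- by rewrite x2l; exact/OKN/OK_nat.
- by rewrite x2l mul0r addr0 mulrNN !pmulrn -!intrM -intrD uv.
move=> z rz.
(* [x * y / l * z] is in the radical too; comparing its first coordinate with the last one of [z]
   shows that [l] divides [k3]. *)
have [j Ej] : exists j : int, forall k0 k1 k2 k3 : int,
    z * (4 * M%:R * d%:R) = l%:R * (k0%:~R * (M%:R * d%:R) + k1%:~R * d%:R * x + k2%:~R * M%:R * y + k3%:~R * (x * y)) ->
    k3%:~R = j%:~R * l%:R :> K.
  have rz' : rad l (x * y / l%:R * z) by case: (@rad_sub K l) => _ _; apply.
  have [j0 [j1 [j2 [j3 E']]]] := rad_param pl rz'.
  exists (- j0) => k0 k1 k2 k3 E.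
  have E2 : l%:R * (x * y / l%:R * z * (4 * M%:R * d%:R)) = x * y * (z * (4 * M%:R * d%:R)).
    by field; exact: rl0.
  move: E2; rewrite E E' => E2.
  have := el_eq0; move=> /(_ (j0%:~R * M%:R * d%:R * l%:R + k3%:~R * M%:R * d%:R)
     (j1%:~R * d%:R * l%:R - k2%:~R * M%:R * d%:R) (j2%:~R * M%:R * l%:R + k1%:~R * d%:R * M%:R) 
     (j3%:~R * l%:R - k0%:~R * M%:R * d%:R)).
  case.
    apply: (mulfI (rl0 pl)); rewrite mulr0 /el.
    transitivity (l%:R * (l%:R * (j0%:~R * (M%:R * d%:R) + j1%:~R * d%:R * x + j2%:~R * M%:R * y + j3%:~R * (x * y))) -
       x * y * (l%:R * (k0%:~R * (M%:R * d%:R) + k1%:~R * d%:R * x + k2%:~R * M%:R * y + k3%:~R * (x * y)))).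
      by ring: x2 y2.
    by rewrite E2 subrr.
  move=> H _ _ _; rewrite rmorphN /= mulNr; apply/eqP; rewrite -addr_eq0 -(rmorph_int emb) -(rmorph_nat emb) -(rmorph_int emb) -rmorphM -rmorphD fmorph_eq0.
  apply/eqP/(mulfI (mulf_neq0 qM0 qd0)); rewrite mulr0 -H; ring.
have [k0 [k1 [k2 [k3 E]]]] := rad_param pl rz.
have k3E := Ej _ _ _ _ E.
apply: (OK_prime_coprime pl (not_dvd4M pl l2 ld')); last first.
  by rewrite mulrC divfK ?rl0 //; apply: OKM; [exact: rad_OK rz | exact: OKx].
have -> : (4 * d')%:R * (z * x / l%:R) =
    (- (k1 * d'%:Z))%:~R + (k0 * d'%:Z)%:~R * x + (- j)%:~R * y + 0%:~R * (x * y) + k2%:~R * (x * y / l%:R).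
  apply: (mulfI rM0); apply: (mulfI (rl0 pl)); apply: (mulfI (rl0 pl)).
  transitivity (z * (4 * M%:R * d%:R) * x); first by rewrite natrM dK; field; exact: rl0.
  rewrite E k3E dK !intrM.
  transitivity (l%:R * (l%:R * (M%:R * ((- (k1%:~R * d'%:R)) + (k0%:~R * d'%:R) * x + (- j%:~R) * y))) + k2%:~R * M%:R * (x * y) * l%:R).
    by ring: x2.
  by field; exact: rl0.
by apply: OKD; [exact: OK_lin | apply: OKM => //; exact: OK_int].
Qed.

Lemma tau_x : tau x = x.
Proof.
have -> : x = el 0 1 0 0 by rewrite /el; ring.
by rewrite tau_el !oppr0.
Qed.

Lemma tau_y : tau y = - y.
Proof.
have -> : y = el 0 0 1 0 by rewrite /el; ring.
by rewrite tau_el /el; ring.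
Qed.

Lemma tauK z : tau (tau z) = z. Proof. exact: galK. Qed.

Lemma OK_int_eq (z : K) r : OK z -> z = emb r -> exists n : int, r = n%:~R.
Proof. by move=> Oz E; apply: OK_emb; rewrite -E. Qed.

(* 2 is unramified in [Q(x)], the fixed field of [tau], as [- M = 1 (mod 4)]. *)
Lemma rad2_tau_fixed w : rad 2 w -> tau w = w -> OK (w / 2).
Proof.
move=> rw; have [[[[a b] c] e] /= Ew] := el_surj w.
move=> Et; have [_ _ c0 e0] : [/\ a = a, b = b, - c = c & - e = e].
  by apply: el_inj; rewrite -tau_el -Ew.
have {}c0 : c = 0 by lra.
have {}e0 : e = 0 by lra.
have Ew' : w = emb a + emb b * x by rewrite Ew c0 e0 /el; ring.
have sE : sigma w = emb a - emb b * x by rewrite Ew sigma_el c0 e0 /el; ring.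
have [_ rD rM] := @rad_sub K 2.
have rs : rad 2 (sigma w) by exact: rad_conj.
have int2 r : rad 2 (emb r) -> exists n : int, r = 2 * n%:~R.
  move=> rr; have [n rn] := OK_emb (rad_OK rr).
  move: rr; rewrite rn emb_int => /(rad_int (isT : prime 2))/dvdzP[k ->]; exists k.
  by rewrite intrM mulrC.
(* The trace [2 a] and the norm [a ^ 2 + M b ^ 2] of [w] are rational elements of [rad 2], hence
   even integers. *)
have [A aE] : exists A : int, a = A%:~R.
  have [|A aA] := int2 (2 * a).
    have -> : emb (2 * a) = w + sigma w by rewrite sE Ew'; ring.
    exact: rD.
  by exists A; apply: (mulfI (x := 2)).
have [N NE] : exists N : int, a ^+ 2 + M%:R * b ^+ 2 = 2 * N%:~R.
  apply: int2; have -> : emb (a ^+ 2 + M%:R * b ^+ 2) = w * sigma w.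
    by rewrite sE Ew'; ring: x2.
  by apply: rM => //; exact: rad_OK rw.
have [B bE] : exists B : int, b = B%:~R.
  apply: (squarefree_sqr_int (n := M) (k := 2 * N - A ^+ 2)) => //.
  rewrite intrB intrM (rmorphXn (intr : int -> rat)) -NE aE; ring.
have NE' : A ^+ 2 + M%:Z * B ^+ 2 = 2 * N.
  apply: (@intr_inj rat); rewrite intr_norm [RHS]intrM -aE -bE.
  exact: NE.
(* The sum is even, so [A] and [B] have the same parity, and [M = 3 (mod 4)] makes it divisible by
   4. Then [w / 2] has trace [A] and norm [k]. *)
have [k kE] : exists k : int, A ^+ 2 + M%:Z * B ^+ 2 = 4 * k.
  have [j ME] : exists j : nat, M = (4 * j + 3)%N.
    by exists (M %/ 4)%N; rewrite {1}(divn_eq M 4) M_mod4 mulnC.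
  have BA : exists h : int, B = A + 2 * h.
    have [[u uE]|[u uE]] := int_parity A; have [[v vE]|[v vE]] := int_parity B.
    - by exists (v - u); lia.
    - have E : A ^+ 2 + M%:Z * B ^+ 2 =
          2 * (2 * (u ^+ 2 + M%:Z * (v ^+ 2 + v) + j%:Z) + 1) + 1.
        by rewrite uE vE ME; ring.
      by lia.
    - have E : A ^+ 2 + M%:Z * B ^+ 2 = 2 * (2 * (u ^+ 2 + u + M%:Z * v ^+ 2)) + 1.
        by rewrite uE vE ME; ring.
      by lia.
    - by exists (v - u); lia.
  have [h ->] := BA.
  exists (A ^+ 2 + j%:Z * A ^+ 2 + M%:Z * (A * h + h ^+ 2)).
  by rewrite ME; ring.
apply: (@OK_quadratic _ _ A k).
have kK : A%:~R ^+ 2 + M%:R * B%:~R ^+ 2 = 4 * k%:~R :> K by rewrite -intr_norm kE intrM.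
apply: (mulfI (x := 4)); first exact: (@natr_neq0 K 4).
rewrite mulr0 Ew' aE bE !emb_int.
have n2 : (2 : K) != 0 by exact: (@natr_neq0 K 2).
transitivity (- (A%:~R ^+ 2 + M%:R * B%:~R ^+ 2) + 4 * k%:~R : K); last by rewrite kK addNr.
transitivity ((A%:~R + B%:~R * x) ^+ 2 - 2 * A%:~R * (A%:~R + B%:~R * x) + 4 * k%:~R).
  by field.
by ring: x2.
Qed.

(** Elements of [rad 2] fixed by [tau] are twice an integer. With [z = u + v * y] over the fixed
    field, relative traces and norms therefore bound the denominators of [u] and [v]. The generator
    is [y] for even [d] and [1 + y] for [d = 3 (mod 4)]. *)
Lemma ramified_2 : sq_ideal (radI K 2) 2.
Proof.
have p2 : prime 2 by [].
have n2 : (2 : K) != 0 by exact: (@natr_neq0 K 2).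
have [_ rD rM] := @rad_sub K 2.
have split_z z : exists u v, [/\ tau u = u, tau v = v & z = u + v * y].
  have [[[[a b] c] e] /= ->] := el_surj z.
  exists (emb a + emb b * x), (emb c + emb e * x); split; last by rewrite /el; ring.
    by rewrite rmorphD rmorphM !gal_rat tau_x.
  by rewrite rmorphD rmorphM !gal_rat tau_x.
have OKd : OK d%:R by exact: OK_nat.
have rad_sq w : OK (w ^+ 2 / 2) -> rad 2 w.
  move=> O2; split; last by exists 2.
  apply: (@OK_of_expn _ _ 2) => //.
  by rewrite -[_ ^+ 2](divfK n2); apply: OKM => //; exact: OK_nat.
have trace_u z u v : rad 2 z -> tau u = u -> tau v = v -> z = u + v * y -> OK u.
  move=> rz tu tv E.
  have -> : u = (z + tau z) / 2.
    by rewrite E rmorphD rmorphM tu tv tau_y; field.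
  apply: rad2_tau_fixed; first by apply: rD => //; exact: rad_conj.
  by rewrite rmorphD tauK addrC.
have norm_z z u v : rad 2 z -> tau u = u -> tau v = v -> z = u + v * y ->
    OK ((u ^+ 2 - d%:R * v ^+ 2) / 2).
  move=> rz tu tv E.
  have -> : u ^+ 2 - d%:R * v ^+ 2 = z * tau z.
    by rewrite E rmorphD rmorphM tu tv tau_y; ring: y2.
  apply: rad2_tau_fixed; first by apply: rM; [exact: rad_OK rz | exact: rad_conj].
  by rewrite rmorphM tauK mulrC.
have tau_nat n : tau n%:R = n%:R by rewrite rmorph_nat.
case: dE => [dd|[dd d4]].
  have dK : d%:R = 2 * d0%:R :> K by rewrite dd natrM.
  have [j jE] : exists j, d0 = (2 * j + 1)%N.
    by exists d0./2; have := odd_double_half d0; rewrite d0_odd; lia.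
  have Et2 : y ^+ 2 / 2 = d0%:R by rewrite y2 dK; field.
  (* The coefficients express [1 = - j * 2 + d0], where [y ^ 2 / 2 = d0]. *)
  apply: (@sq_ideal_rad _ _ y (- j%:R) 0 1) => //.
  - exact/OKN/OK_nat.
  - exact: OK0.
  - exact: OK1.
  - exact: OKy.
  - by rewrite Et2; exact: OK_nat.
  - by rewrite Et2 jE natrD natrM; ring.
  move=> z rz; have [u [v [tu tv E]]] := split_z z.
  have Ou := trace_u _ _ _ rz tu tv E; have ON := norm_z _ _ _ rz tu tv E.
  set N := (u ^+ 2 - d%:R * v ^+ 2) / 2 in ON.
  have Od0 := OK_nat K d0.
  have Odv : OK ((d%:R * v) / 2).
    apply: rad2_tau_fixed; last by rewrite rmorphM tv tau_nat.
    apply: rad_sq.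
    have -> : (d%:R * v) ^+ 2 / 2 = d0%:R * (u ^+ 2 - 2 * N) by rewrite /N dK; field.
    apply: OKM => //; apply: OKB; first exact: OKX.
    by apply: OKM => //; exact: OK_nat.
  have {}Odv : OK (d0%:R * v) by move: Odv; congr (OK _); rewrite dK; field.
  have Odu : OK ((d0%:R * u) / 2).
    apply: rad2_tau_fixed; last by rewrite rmorphM tu tau_nat.
    apply: rad_sq.
    have -> : (d0%:R * u) ^+ 2 / 2 = d0%:R ^+ 2 * N + d0%:R * (d0%:R * v) ^+ 2.
      by rewrite /N dK; field.
    by apply: OKD; apply: OKM => //; exact: OKX.
  apply: (@OK_prime_coprime 2 d0) => //; first by rewrite dvdn2 d0_odd.
    have -> : d0%:R * (z * y / 2) = (d0%:R * u / 2) * y + (d0%:R * v) * d0%:R.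
      by rewrite E; field: y2 dK.
    by apply: OKD; apply: OKM => //; exact: OKy.
  by rewrite mulrC divfK //; apply: OKM; [exact: rad_OK rz | exact: OKy].
have [j jE] : exists j, d = (4 * j + 3)%N.
  by exists (d %/ 4)%N; rewrite {1}(divn_eq d 4) d4 mulnC.
have dK : d%:R = 4 * j%:R + 3 :> K by rewrite jE natrD natrM.
have O1y : OK (1 + y) by apply: OKD; [exact: OK1 | exact: OKy].
have Et2 : (1 + y) ^+ 2 / 2 = 2 * j%:R + 2 + y.
  by transitivity ((1 + 2 * y + y ^+ 2) / 2); [field | rewrite y2 dK; field].
(* The coefficients come from [(1 + y) ^ 2 / 2 = 2 * j + 2 + y]. *)
apply: (@sq_ideal_rad _ _ (1 + y) (j%:R + 1) 1 (- 1)) => //.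
- by apply: OKD; [exact: OK_nat | exact: OK1].
- exact: OK1.
- exact/OKN/OK1.
- rewrite Et2; apply: OKD; last exact: OKy.
  by apply: OKD; [apply: OKM|]; exact: OK_nat.
- by rewrite Et2; ring.
move=> z rz; have [u [v [tu tv E]]] := split_z z.
have Ou := trace_u _ _ _ rz tu tv E; have ON := norm_z _ _ _ rz tu tv E.
set N := (u ^+ 2 - d%:R * v ^+ 2) / 2 in ON.
(* [d * v] is the [tau]-fixed part of [z * y], which is in [rad 2] as well. *)
have Odv : OK (d%:R * v).
  apply: (trace_u (z * y) _ u) => //.
  - by rewrite mulrC; apply: rM => //; exact: OKy.
  - by rewrite rmorphM tv tau_nat.
  - by rewrite E; ring: y2.
have Odu : OK (d%:R * u) by exact: OKM.
have O2 : OK ((d%:R * u + d%:R * v) / 2).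
  apply: rad2_tau_fixed; last by rewrite rmorphD !rmorphM tu tv !tau_nat.
  apply: rad_sq.
  have -> : (d%:R * u + d%:R * v) ^+ 2 / 2 =
      d%:R ^+ 2 * N + (2 * j%:R + 2) * (d%:R * v) ^+ 2 + (d%:R * u) * (d%:R * v).
    have dj : 2 * j%:R + 2 = (d%:R + 1) / 2 :> K by rewrite dK; field.
    by rewrite dj /N; field.
  apply: OKD; last exact: OKM.
  apply: OKD; apply: OKM => //; try exact: OKX.
  by apply: OKD; [apply: OKM|]; exact: OK_nat.
apply: (@OK_prime_coprime 2 d) => //; first by rewrite dvdn2 jE; lia.
  have -> : d%:R * (z * (1 + y) / 2) =
      (d%:R * u + d%:R * v) / 2 * (1 + y) + (d%:R * v) * (2 * j%:R + 1).
    have dj : 2 * j%:R + 1 = (d%:R - 1) / 2 :> K by rewrite dK; field.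
    by rewrite dj E; field: y2.
  apply: OKD; apply: OKM => //.
  by apply: OKD; [apply: OKM; exact: OK_nat | exact: OK1].
by rewrite mulrC divfK //; apply: OKM => //; exact: rad_OK rz.
Qed.

(** * Units and the possible relations between ramified classes *)

Hypothesis d_ge5 : (5 <= d)%N.
Variable l0 : nat.
Hypothesis l0_prime : prime l0.
Hypothesis l0_ge5 : (5 <= l0)%N.
Hypothesis l0_M : (l0 %| M)%N.
Hypothesis l0_d : ~~ (l0 %| d)%N.

Lemma logn_M l : prime l -> logn l M = (l %| M)%N.
Proof.
move=> pl; have := M_sqf pl; rewrite pfactor_dvdn // -ltnNge ltnS.
have -> : (l %| M)%N = (0 < logn l M)%N by rewrite logn_gt0 mem_primes pl M_gt0.
by case: (logn l M) => [|[]].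
Qed.

(* [sigma] is complex conjugation, so these are the units of absolute value 1 at all places. *)
Lemma norm1_unit z : OK z -> z * sigma z = 1 -> z = 1 \/ z = - 1.
Proof.
have [[[[a b] c] e] /= ->] := el_surj z => Oz Nz.
have [E1 _ E2 _] : [/\ a ^+ 2 + d%:R * c ^+ 2 + M%:R * (b ^+ 2 + d%:R * e ^+ 2) = 1, 0 = 0 :> rat,
    2 * (a * c) + 2 * M%:R * (b * e) = 0 & 0 = 0 :> rat].
  apply: el_inj; transitivity (1 : K); last by rewrite /el; ring.
  by rewrite -Nz sigma_el /el; ring: x2 y2.
(* The relative trace [2 a + 2 c y] is an integer of Q(y), so [2 a] and [2 c] will be rational
   integers. *)
pose w := el a b c e + sigma (el a b c e).
have Ow : OK w by apply: OKD => //; exact: OK_conj.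
have wE : w = el (2 * a) 0 (2 * c) 0 by rewrite /w sigma_el /el; ring.
have Otw : OK (tau w) by exact: OK_conj.
have twE : tau w = el (2 * a) 0 (- (2 * c)) 0 by rewrite wE tau_el oppr0.
have [T TE] : exists T : int, 4 * a = T%:~R.
  apply: (OK_int_eq (OKD Ow Otw)); rewrite wE tau_el /el; ring.
have [N NE] : exists N : int, 4 * a ^+ 2 - 4 * d%:R * c ^+ 2 = N%:~R.
  apply: (OK_int_eq (OKM Ow Otw)); rewrite wE tau_el /el; ring: y2.
have [V VE] : exists V : int, 4 * c = V%:~R.
  apply: (squarefree_sqr_int (n := d) (k := T ^+ 2 - 4 * N)) => //; first exact: d_sqf.
  rewrite intrB intr_exp [(4 * N)%:~R]intrM -TE -NE; ring.
have NE' : T ^+ 2 = d%:Z * V ^+ 2 + 4 * N.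
  apply: (@intr_inj rat); rewrite intrD intr_exp [(4 * N)%:~R]intrM.
  by rewrite [(d%:Z * _)%:~R]intrM intr_exp -TE -NE -VE -pmulrn; ring.
have d24 : (d %% 4 = 2)%N \/ (d %% 4 = 3)%N.
  case: dE => [->|[_ d4]]; last by right.
  left; have -> : (2 * d0 = d0./2 * 4 + 2)%N.
    by have := odd_double_half d0; rewrite d0_odd; clear; lia.
  by rewrite modnMDl.
have [A [C [TA VC]]] := norm_mod4 d24 NE'.
have AE : 2 * a = A%:~R by move: TE; rewrite TA intrM; lra.
have CE : 2 * c = C%:~R by move: VE; rewrite VC intrM; lra.
have sum4 : A%:~R ^+ 2 + d%:R * C%:~R ^+ 2 + M%:R * (4 * b ^+ 2 + d%:R * (4 * e ^+ 2)) = 4 :> rat.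
  transitivity (4 * (a ^+ 2 + d%:R * c ^+ 2 + M%:R * (b ^+ 2 + d%:R * e ^+ 2))); last by rewrite E1 mulr1.
  by rewrite -AE -CE; ring.
have rest0 : 0 <= M%:R * (4 * b ^+ 2 + d%:R * (4 * e ^+ 2)) :> rat.
  have sq4 (r : rat) : 0 <= 4 * r ^+ 2 by apply: mulr_ge0 => //; exact: sqr_ge0.
  apply: mulr_ge0; first exact: ler0n.
  by apply: addr_ge0 => //; apply: mulr_ge0 => //; exact: ler0n.
have AC4 : A ^+ 2 + d%:Z * C ^+ 2 <= 4.
  have le4 : A%:~R ^+ 2 + d%:R * C%:~R ^+ 2 <= 4 :> rat by rewrite -[leRHS]sum4 lerDl.
  by rewrite -(ler_int rat) intr_norm.
have [C0 A3] := small_norm d_ge5 AC4.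
have c0 : c = 0 by move: CE; rewrite C0; lra.
have be0 : b * e = 0.
  apply: (mulfI (x := 2 * M%:R)); first by rewrite mulf_neq0.
  by rewrite mulr0 -E2 c0; ring.
(* For [A] other than [2] and [- 2], the value [4 - A ^ 2] is 3 or 4; since [b * e = 0], it would be
   [M] or [M * d] times a square, of odd valuation at [l0 >= 5]. *)
have sq_no (n : nat) (r : rat) : n = 3 \/ n = 4 -> M%:R * r ^+ 2 != n%:R.
  move=> n34; have n0 : (0 < n)%N by case: n34 => ->.
  apply/eqP => /(logn_sqr_class l0 M_gt0 n0); rewrite logn_M // l0_M.
  rewrite lognE l0_prime n0 /= gtnNdvd //.
  by case: n34 => ->; apply: leq_trans l0_ge5.
have sq_no' (n : nat) (r : rat) : n = 3 \/ n = 4 -> (M * d)%:R * r ^+ 2 != n%:R.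
  move=> n34; have n0 : (0 < n)%N by case: n34 => ->.
  have Md0 : (0 < M * d)%N by rewrite muln_gt0 M_gt0.
  apply/eqP => /(logn_sqr_class l0 Md0 n0); rewrite lognM // logn_M // l0_M.
  have -> : logn l0 d = 0%N by rewrite lognE (negbTE l0_d) !andbF.
  rewrite lognE l0_prime n0 /= gtnNdvd //.
  by case: n34 => ->; apply: leq_trans l0_ge5.
have rE : M%:R * (4 * b ^+ 2 + d%:R * (4 * e ^+ 2)) = 4 - A%:~R ^+ 2 :> rat.
  by rewrite -[X in X - _]sum4 C0; ring.
have A_cases : [\/ A = 2, A = - 2 | exists2 n : nat, (n = 3 \/ n = 4)%N & 4 - A%:~R ^+ 2 = n%:R :> rat].
  have [->|A2] := eqVneq A 2; first by constructor 1.
  have [->|A2'] := eqVneq A (-2); first by constructor 2.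
  constructor 3; have : A = -1 \/ A = 0 \/ A = 1 by move: A3 A2 A2'; clear; lia.
  by case=> [->|[->|->]]; [exists 3%N | exists 4%N | exists 3%N]; auto.
have big0 : 4 - A%:~R ^+ 2 = 0 :> rat -> b = 0 /\ e = 0.
  move=> z0; move/eqP: rE; rewrite z0 mulf_eq0 (negbTE qM0) /= => /eqP E.
  have [b0 e0] : 2 * b = 0 /\ 2 * e = 0 by apply: (sqr_sum_eq0 d_gt0); rewrite -E; ring.
  by split; lra.
case: A_cases => [A2|A2|[n n34 nE]].
- left; have [-> ->] : b = 0 /\ e = 0 by apply: big0; rewrite A2.
  have -> : a = 1 by move: AE; rewrite A2 => H; apply: (mulfI (x := 2)).
  by rewrite c0 /el; ring.
- right; have [-> ->] : b = 0 /\ e = 0 by apply: big0; rewrite A2.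
  have -> : a = - 1 by move: AE; rewrite A2 => H; apply: (mulfI (x := 2)).
  by rewrite c0 /el; ring.
- move/eqP: be0; rewrite mulf_eq0 => /orP[/eqP b0|/eqP e0].
    case/eqP: (sq_no' n (2 * e) n34); rewrite -nE -rE b0 natrM; ring.
  case/eqP: (sq_no n (2 * b) n34); rewrite -nE -rE e0; ring.
Qed.

(* The prime of [Q(sqrt d)] above 2 is principal: one more relation between the ramified classes. *)
Definition two_norm := exists X Y : int, X ^+ 2 - d%:Z * Y ^+ 2 = 2 \/ X ^+ 2 - d%:Z * Y ^+ 2 = - 2.

(* [n] is the norm of [beta] from [Q(y)], and [T] the trace of [beta / tau beta = beta ^ 2 / n]. *)
Lemma real_unit_norm (beta : K) N : (0 < N)%N -> beta != 0 -> sigma beta = beta ->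
  unit_int (beta ^+ 2 / N%:R) ->
  exists (s t : rat) (T n : int), [/\ `|n|%N = N, n%:~R = s ^+ 2 - d%:R * t ^+ 2,
    n%:~R * (T + 2)%:~R = (2 * s) ^+ 2 & n%:~R * (T - 2)%:~R = d%:R * (2 * t) ^+ 2].
Proof.
move=> N0; have [[[[s b] t] e] /= Eb] := el_surj beta => beta0 sb [Ow OwV].
have [_ b0 _ e0] : [/\ s = s, - b = b, t = t & - e = e].
  by apply: el_inj; rewrite -sigma_el -Eb.
have {}b0 : b = 0 by lra.
have {}e0 : e = 0 by lra.
have Eb' : beta = emb s + emb t * y by rewrite Eb b0 e0 /el; ring.
have tE : tau beta = emb s - emb t * y by rewrite Eb tau_el b0 e0 /el; ring.
have tb0 : tau beta != 0 by rewrite fmorph_eq0.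
have NK : N%:R != 0 :> K by exact: natr_neq0.
have Nq : N%:R != 0 :> rat by rewrite pnatr_eq0 -lt0n.
pose q := s ^+ 2 - d%:R * t ^+ 2.
have qE : emb q = beta * tau beta by rewrite tE Eb' /q; ring: y2.
have q0 : q != 0 by rewrite -(fmorph_eq0 emb) qE mulf_neq0.
have tw z : OK z -> OK (z * tau z) by move=> Oz; apply: OKM => //; exact: OK_conj.
have twE : tau (beta ^+ 2 / N%:R) = tau beta ^+ 2 / N%:R.
  by rewrite rmorphM fmorphV rmorphXn rmorph_nat.
(* This is the norm of the unit [beta ^ 2 / N]; it and its inverse are integers, which forces
   [q = N] or [q = - N]. *)
have [i iE] : exists i : int, (q / N%:R) ^+ 2 = i%:~R.
  apply: (OK_int_eq (tw _ Ow)).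
  by rewrite twE rmorphXn rmorphM fmorphV rmorph_nat qE; field.
have [j jE] : exists j : int, (N%:R / q) ^+ 2 = j%:~R.
  apply: (OK_int_eq (tw _ OwV)).
  by rewrite fmorphV twE rmorphXn rmorphM fmorphV rmorph_nat qE; field; rewrite beta0 tb0 NK.
have ij : i * j = 1.
  apply: (@intr_inj rat); rewrite intrM -iE -jE; field.
  by rewrite Nq q0.
have i1 : i = 1.
  have : 0 <= i by rewrite -(ler_int rat) -iE sqr_ge0.
  move=> i0; have /eqP := congr1 absz ij.
  by rewrite abszM muln_eq1 => /andP[/eqP i1 _]; rewrite -(gez0_abs i0) i1.
have qN : q = N%:R \/ q = - N%:R.
  have : (q / N%:R) ^+ 2 == 1 by rewrite iE i1.
  rewrite sqrf_eq1 => /orP[]/eqP E; [left|right]; apply: (mulIf (invr_neq0 Nq)).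
    by rewrite E divff.
  by rewrite E mulNr divff.
have [n nq nN] : exists2 n : int, n%:~R = q & `|n|%N = N.
  by case: qN => ->; [exists N%:Z | exists (- N%:Z)]; rewrite ?abszN // ?rmorphN ?pmulrn.
have Ow' : OK (beta ^+ 2 / emb q).
  case: qN => ->; rewrite ?rmorphN rmorph_nat // invrN mulrN; exact: OKN.
have [T TE] : exists T : int, 2 * (s ^+ 2 + d%:R * t ^+ 2) / q = T%:~R.
  apply: (OK_int_eq (OKD Ow' (OK_conj tau Ow'))).
  have eq0 : emb q != 0 by rewrite fmorph_eq0.
  rewrite rmorphM fmorphV gal_rat rmorphXn tE Eb' rmorphM fmorphV.
  by rewrite -mulrDl; congr (_ / _); ring: y2.
exists s, t, T, n; split=> //.
  rewrite intrD -TE nq; transitivity (2 * (s ^+ 2 + d%:R * t ^+ 2) + q * 2); first by field.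
  by rewrite /q; ring.
rewrite intrB -TE nq; transitivity (2 * (s ^+ 2 + d%:R * t ^+ 2) - q * 2); first by field.
by rewrite /q; ring.
Qed.

(** [N] is in the square class of [T + 2] up to sign, and [(T + 2) * (T - 2)] in that of [d]. An odd
    [l] dividing [T + 2] does not divide [T - 2], so outside [d] its valuation in [T + 2] is
    even. *)
Lemma real_unit_logn (beta : K) N l : (0 < N)%N -> beta != 0 -> sigma beta = beta ->
  unit_int (beta ^+ 2 / N%:R) -> prime l -> l != 2%N -> ~~ (l %| d)%N -> ~~ odd (logn l N).
Proof.
move=> N0 b0 sb ub pl l2 ld.
have [s [t [T [n [nN E0 E1 E2]]]]] := real_unit_norm N0 b0 sb ub.
have nabs : n = N \/ n = - N%:Z by lia.
have sgnE (r : rat) : (n%:~R = r -> 0 <= r -> N%:R = r) /\ (n%:~R = - r -> 0 <= r -> N%:R = r).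
  have N0' : 0 <= N%:R :> rat by exact: ler0n.
  by case: nabs => ->; rewrite ?rmorphN /= -?pmulrn; split=> *; lra.
have ld0 : logn l d = 0%N by rewrite lognE (negbTE ld) !andbF.
(* For [s = 0] or [t = 0] one of [T + 2], [T - 2] is zero and has no valuation; then [N] is
   [d * t ^ 2] or [s ^ 2]. *)
have [s0|s0] := eqVneq s 0.
  have : d%:R * t ^+ 2 = N%:R.
    by apply/esym/(sgnE _).2; [rewrite E0 s0; ring | rewrite mulr_ge0 ?ler0n ?sqr_ge0].
  by move/(logn_sqr_class l d_gt0 N0) <-; rewrite ld0.
have [t0|t0] := eqVneq t 0.
  have : 1%:R * s ^+ 2 = N%:R.
    by rewrite mul1r; apply/esym/(sgnE _).1; [rewrite E0 t0; ring | rewrite sqr_ge0].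
  by move/(logn_sqr_class l (ltn0Sn 0) N0) <-; rewrite logn1.
have n0 : n != 0 by rewrite -absz_gt0 nN.
have nq : (n%:~R : rat) != 0 by rewrite intr_eq0.
have [P [Q [PE QE PQ]]] : exists P Q, [/\ P = T + 2, Q = T - 2 & P = Q + 4].
  by exists (T + 2), (T - 2); split=> //; ring.
rewrite -PE in E1; rewrite -QE in E2.
have Tp : P != 0.
  by rewrite -(intr_eq0 rat); apply: contra_neq s0 => z; move/eqP: E1; rewrite z mulr0 eq_sym sqrf_eq0 mulf_eq0 => /eqP.
have Tm : Q != 0.
  rewrite -(intr_eq0 rat); apply: contra_neq t0 => z; move/eqP: E2.
  by rewrite z mulr0 eq_sym mulf_eq0 (negbTE qd0) sqrf_eq0 mulf_eq0 => /eqP.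
have Tp0 : (0 < `|P|)%N by rewrite absz_gt0.
have Tm0 : (0 < `|Q|)%N by rewrite absz_gt0.
have parity1 : odd (logn l N) = odd (logn l `|P|%N).
  apply: (logn_sqr_class (r := P%:~R / (2 * s)) _ N0 Tp0).
  have s2 : 2 * s != 0 by rewrite mulf_neq0.
  have nonneg : 0 <= n%:~R * P%:~R :> rat by rewrite E1 sqr_ge0.
  have NT : N%:R * `|P|%N%:R = (2 * s) ^+ 2 :> rat.
    rewrite -E1 -nN !natr_absz -!intrM -normrM; congr (_%:~R).
    by rewrite ger0_norm // -(ler_int rat) intrM.
  apply: (mulfI (x := (2 * s) ^+ 2)); first by rewrite expf_neq0.
  rewrite -{2}NT natr_absz; transitivity (N%:R * P%:~R ^+ 2 : rat); first by field.
  by rewrite -mulrA -expr2 -!intr_exp real_normK ?num_real.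
have parity2 : odd (logn l (`|P| * `|Q|)%N) = odd (logn l d).
  have TT0 : (0 < `|P| * `|Q|)%N by rewrite muln_gt0 Tp0.
  apply/esym/(logn_sqr_class (r := 4 * s * t / n%:~R) _ d_gt0 TT0).
  have EE : n%:~R ^+ 2 * (P * Q)%:~R = d%:R * (4 * s * t) ^+ 2 :> rat.
    transitivity ((n%:~R * P%:~R) * (n%:~R * Q%:~R) : rat).
      by rewrite intrM; ring.
    by rewrite E1 E2; ring.
  have TTn : 0 <= P * Q.
    rewrite -(ler_int rat) -(pmulr_rge0 _ (_ : 0 < n%:~R ^+ 2 :> rat)); last by rewrite exprn_even_gt0.
    by rewrite EE mulr_ge0 ?ler0n ?sqr_ge0.
  rewrite -abszM natr_absz ger0_norm //.
  apply: (mulfI (x := n%:~R ^+ 2)); first by rewrite expf_neq0.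
  by rewrite EE; field.
rewrite parity1; have [lT|lT] := boolP (l %| `|P|)%N; last first.
  by rewrite lognE (negbTE lT) !andbF.
move: parity2; rewrite lognM // ld0 oddD.
suff -> : logn l `|Q|%N = 0%N by rewrite addbF => ->.
rewrite lognE; case: and3P => // -[_ _ lT']; case/negP: l2.
have : (l%:Z %| (P - Q)%R)%Z by apply: rpredB; rewrite dvdzE.
have -> : P - Q = 4%:Z by rewrite PQ addrC addKr.
by rewrite dvdzE /= (_ : 4 = 2 ^ 2)%N // Euclid_dvdX // andbT dvdn_prime2.
Qed.

(** For [n = 2] or [n = - 2] the first relation makes [2 * s ^ 2] an integer, so [s] is one; then
    [d * t ^ 2 = s ^ 2 - n] makes [t] one. *)
Lemma real_unit_two (beta : K) : beta != 0 -> sigma beta = beta ->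
  unit_int (beta ^+ 2 / 2) -> two_norm.
Proof.
move=> b0 sb ub.
have [s [t [T [n [nN E0 E1 E2]]]]] := real_unit_norm (isT : 0 < 2)%N b0 sb ub.
have n2 : n = 2 \/ n = - 2 by lia.
have sqf2 l : prime l -> ~~ (l ^ 2 %| 2)%N.
  move=> pl; apply/negP => /dvdn_leq -/(_ isT); have := prime_gt1 pl; nia.
have [X XE] : exists X : int, s = X%:~R.
  case: n2 => nE; [apply: (squarefree_sqr_int (n := 2) (k := T + 2)) | apply: (squarefree_sqr_int (n := 2) (k := - (T + 2)))] => //.
    by move: E1; rewrite nE => E1; apply: (mulfI (x := 2)) => //; rewrite E1; ring.
  move: E1; rewrite nE => E1; apply: (mulfI (x := 2)) => //; rewrite rmorphN /=.
  by transitivity ((2 * s) ^+ 2); [ring | rewrite -E1 rmorphN /=; ring].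
have [Y YE] : exists Y : int, t = Y%:~R.
  apply: (squarefree_sqr_int (n := d) (k := X ^+ 2 - n)) => //; first exact: d_sqf.
  by rewrite intrB intr_exp E0 -XE; ring.
exists X, Y; have EE : X ^+ 2 - d%:Z * Y ^+ 2 = n.
  apply: (@intr_inj rat); rewrite E0 intrB intr_exp -XE.
  by rewrite [(d%:Z * _)%:~R]intrM intr_exp -YE.
by rewrite EE.
Qed.

Lemma sigma_x : sigma x = - x.
Proof.
have -> : x = el 0 1 0 0 by rewrite /el; ring.
by rewrite sigma_el /el; ring.
Qed.

Lemma kernel_real (alpha : K) N : (0 < N)%N -> alpha != 0 -> unit_int (alpha ^+ 2 / N%:R) ->
  exists (e : bool) (beta : K), [/\ beta != 0, sigma beta = beta &
    unit_int (beta ^+ 2 / (N * M ^ e)%:R)].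
Proof.
move=> N0 a0 [Ou OuV]; have NK : N%:R != 0 :> K by exact: natr_neq0.
have sa0 : sigma alpha != 0 by rewrite fmorph_eq0.
have x0 : x != 0 by rewrite -sqrf_eq0 x2 oppr_eq0.
have sigmaK z : sigma (sigma z) = z by exact: galK.
(* With the unit [u = alpha ^ 2 / N], the square of this quotient is [u / sigma u]. *)
have Oz : OK (alpha / sigma alpha).
  apply: (@OK_of_expn _ _ 2) => //.
  have -> : (alpha / sigma alpha) ^+ 2 = (alpha ^+ 2 / N%:R) * sigma ((alpha ^+ 2 / N%:R)^-1).
    by rewrite fmorphV rmorphM fmorphV rmorphXn rmorph_nat; field; rewrite NK sa0.
  by apply: OKM => //; exact: OK_conj.
have Nz : alpha / sigma alpha * sigma (alpha / sigma alpha) = 1.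
  by rewrite rmorphM fmorphV sigmaK; field; rewrite a0 sa0.
case: (norm1_unit Oz Nz) => E.
  exists false, alpha; rewrite expn0 muln1; split=> //.
  by rewrite -[RHS](divfK sa0) E mul1r.
have sE : sigma alpha = - alpha by rewrite -[alpha in RHS](divfK sa0) E mulN1r opprK.
exists true, (alpha * x); rewrite expn1; split.
- by rewrite mulf_neq0.
- by rewrite rmorphM sE sigma_x mulrNN.
- have EE : (alpha * x) ^+ 2 / (N * M)%:R = - (alpha ^+ 2 / N%:R).
    by rewrite exprMn x2 natrM; field; rewrite NK rM0.
  by split; rewrite EE ?invrN; exact: OKN.
Qed.

Lemma kernel_logn (alpha : K) N : (0 < N)%N -> alpha != 0 -> unit_int (alpha ^+ 2 / N%:R) ->
  exists e : bool,
    (forall l, prime l -> l != 2%N -> ~~ (l %| d)%N -> odd (logn l N) = e && (l %| M)%N) /\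
    ((N * M ^ e)%N = 2 -> two_norm).
Proof.
move=> N0 a0 ua; have [e [beta [b0 sb ub]]] := kernel_real N0 a0 ua.
have NM0 : (0 < N * M ^ e)%N by rewrite muln_gt0 N0 expn_gt0 M_gt0.
exists e; split=> [l pl l2 ld|N2]; last by apply: (real_unit_two b0 sb); move: ub; rewrite N2.
have := real_unit_logn NM0 b0 sb ub pl l2 ld.
rewrite lognM ?expn_gt0 ?M_gt0 // lognX oddD logn_M //.
by case: e {ub NM0}; case: (l %| M)%N; case: (odd _).
Qed.

(** * The space of relations and the rank *)

Local Notation T := (primes (2 * d * M)).
Local Notation vec := ('rV['F_2]_(size T)).

Let N0 : (0 < 2 * d * M)%N. Proof. by rewrite !muln_gt0 d_gt0 M_gt0. Qed.

Lemma mem_T l : (l \in T) = prime l && [|| l == 2, l %| d | l %| M]%N.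
Proof.
rewrite mem_primes N0 /=; case: (boolP (prime l)) => //= pl.
by rewrite !Euclid_dvdM // dvdn_prime2 // -orbA.
Qed.

Let T_prime l : l \in T -> prime l. Proof. by rewrite mem_T => /andP[]. Qed.
Let T_uniq : uniq T. Proof. exact: primes_uniq. Qed.

Lemma ramified_T l : l \in T -> sq_ideal (radI K l) l%:R.
Proof.
rewrite mem_T => /andP[pl]; have [->|l2] /= := eqVneq l 2%N; first by move=> _; exact: ramified_2.
have [lM|lM] := boolP (l %| M)%N; have [ld|ld] := boolP (l %| d)%N => // _.
- exact: ramified_xy.
- exact: ramified_x.
- exact: ramified_y.
Qed.

Lemma unramified_T l : prime l -> l \notin T -> forall z, rad l z -> OK (z / l%:R).
Proof.
move=> pl; rewrite mem_T pl /= !negb_or => /and3P[l2 ld lM] z.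
exact: unramified_odd.
Qed.

Let ram := ram_class_eq1 T_prime ramified_T.

Lemma class_dvd_vec_M : ram_class K (dvd_vec T M) = 1%g.
Proof.
apply/ram; exists x; first by rewrite -sqrf_eq0 x2 oppr_eq0.
rewrite ram_norm_dvd_vec // => [|l pl lM]; last by rewrite mem_T pl lM !orbT.
rewrite x2 mulNr divff //; split; rewrite ?invrN ?invr1; exact/OKN/OK1.
Qed.

Lemma class_dvd_vec_d : ram_class K (dvd_vec T d) = 1%g.
Proof.
apply/ram; exists y; first by rewrite -sqrf_eq0 y2.
rewrite ram_norm_dvd_vec // => [|l pl|l pl ld]; [|exact: d_sqf|by rewrite mem_T pl ld !orbT].
by rewrite y2 divff //; split; rewrite ?invr1; exact: OK1.
Qed.

Lemma ram_norm_dvd_vec_2 : ram_norm (dvd_vec T 2) = 2.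
Proof.
rewrite ram_norm_dvd_vec // => [l pl|l pl].
  by apply/negP => /dvdn_leq -/(_ isT); have := prime_gt1 pl; clear; nia.
by rewrite dvdn_prime2 // mem_T pl => ->.
Qed.

(** The witness is [X + Y * y], of norm [2 * s] with [s ^ 2 = 1]: half its square is a unit whose
    inverse is half the square of the conjugate. *)
Lemma class_dvd_vec_2 : two_norm -> ram_class K (dvd_vec T 2) = 1%g.
Proof.
move=> [X [Y XY]]; apply/ram; rewrite ram_norm_dvd_vec_2.
have n2 : (2 : K) != 0 by exact: (@natr_neq0 K 2).
have [s s2 XYs] : exists2 s : int, s ^+ 2 = 1 & X ^+ 2 - d%:Z * Y ^+ 2 = 2 * s.
  by case: XY => ->; [exists 1 | exists (- 1)].
have XK : X%:~R ^+ 2 = d%:R * Y%:~R ^+ 2 + 2 * s%:~R :> K.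
  rewrite -intr_exp -[X ^+ 2](subrK (d%:Z * Y ^+ 2)) XYs addrC intrD.
  by rewrite [(2 * s)%:~R]intrM [(d%:Z * _)%:~R]intrM intr_exp.
have sK : s%:~R ^+ 2 = 1 :> K by rewrite -intr_exp s2.
have half (y' : K) : y' ^+ 2 = d%:R -> OK y' -> OK ((X%:~R + Y%:~R * y') ^+ 2 / 2).
  move=> y'2 Oy'.
  have -> : (X%:~R + Y%:~R * y') ^+ 2 / 2 = s%:~R + d%:R * Y%:~R ^+ 2 + X%:~R * Y%:~R * y'.
    transitivity ((X%:~R ^+ 2 + 2 * X%:~R * Y%:~R * y' + Y%:~R ^+ 2 * y' ^+ 2) / 2); first by field.
    by rewrite XK y'2; field.
  have OI (n : int) : OK (n%:~R : K) by exact: OK_int.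
  apply: OKD; first apply: OKD; first exact: OI.
    by apply: OKM; [exact: OK_nat | apply: OKX; exact: OI].
  by apply: OKM => //; apply: OKM; exact: OI.
have prod4 : (X%:~R + Y%:~R * y) * (X%:~R + Y%:~R * - y) = 2 * s%:~R.
  transitivity (X%:~R ^+ 2 - d%:R * Y%:~R ^+ 2 : K); first by ring: y2.
  by rewrite XK; ring.
have s0 : s%:~R != 0 :> K by rewrite -sqrf_eq0 sK oner_eq0.
have a0 : X%:~R + Y%:~R * y != 0.
  by apply: contraTneq isT => z0; move/eqP: prod4; rewrite z0 mul0r eq_sym mulf_eq0 (negbTE n2) (negbTE s0).
exists (X%:~R + Y%:~R * y) => //; split; first by apply: half => //; exact: OKy.
have -> : ((X%:~R + Y%:~R * y) ^+ 2 / 2)^-1 = (X%:~R + Y%:~R * - y) ^+ 2 / 2.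
  apply: (mulfI (expf_neq0 2 a0)).
  transitivity (2 : K); first by field; rewrite n2 a0.
  by rewrite mulrA -exprMn prod4 exprMn sK; field.
by apply: half; [rewrite sqrrN | exact/OKN/OKy].
Qed.

(** As [l0] divides [M] but neither [2] nor [d], its valuation shows that the factor [x] does not
    occur. *)
Lemma two_norm_of_class : ram_class K (dvd_vec T 2) = 1%g -> two_norm.
Proof.
move/ram; rewrite ram_norm_dvd_vec_2 => -[a a0 /(kernel_logn (isT : 0 < 2)%N a0)[e [H two]]].
apply: two; have := H l0 l0_prime; rewrite l0_d l0_M andbT.
rewrite (_ : l0 != 2%N); last by apply: contraTneq l0_ge5 => ->.
move=> /(_ isT isT); rewrite lognE l0_prime /= dvdn_prime2 //.
by rewrite (_ : (l0 == 2) = false); [case: (e) | apply/negbTE; apply: contraTneq l0_ge5 => ->].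
Qed.

Lemma class_mul (v w : vec) : ram_class K v = 1%g -> ram_class K w = 1%g -> ram_class K (v + w) = 1%g.
Proof. by move=> kv kw; rewrite (ram_classD T_prime ramified_T) kv kw mulg1. Qed.

Lemma class_scale (c : 'F_2) (v : vec) : ram_class K v = 1%g -> ram_class K (c *: v) = 1%g.
Proof.
by case/orP: (F2_case c) => /eqP->; rewrite ?scale0r ?scale1r // => _; exact: ram_class0.
Qed.

(** Adding [e] times the vector of [M] leaves a vector supported on [2] and [d0], whose two
    coordinates give the other coefficients. *)
Lemma kernel_span (v : vec) : ram_class K v = 1%g <->
  exists a b c : 'F_2, (c != 0 -> two_norm) /\
    v = a *: dvd_vec T M + b *: dvd_vec T d + c *: dvd_vec T 2.
Proof.
split=> [kv|[a [b [c [c2 ->]]]]]; last first.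
  apply: class_mul; first by apply: class_mul; apply: class_scale;
    [exact: class_dvd_vec_M | exact: class_dvd_vec_d].
  have [->|c0] := eqVneq c 0; first by rewrite scale0r; exact: ram_class0.
  exact/class_scale/class_dvd_vec_2/c2.
have /ram[alpha a0] := kv.
move/(kernel_logn (ram_norm_gt0 T_prime v) a0) => [e [H _]].
have vT2 : (2 \in T) by rewrite mem_T.
have vTd0 : (d0 \in T).
  by rewrite mem_T d0_prime; case: dE => [->|[-> _]]; rewrite ?dvdn_mull ?dvdnn ?orbT.
have i2 : (index 2%N T < size T)%N by rewrite index_mem.
have id0 : (index d0 T < size T)%N by rewrite index_mem.
have [v' v'E] : exists v', v' = v + e%:R *: dvd_vec T M by exists (v + e%:R *: dvd_vec T M).
have [b bE] : exists b, b = v' 0 (Ordinal id0) by exists (v' 0 (Ordinal id0)).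
(* The vector of [d] is subtracted first, since an even [d] contributes at [2]. *)
have [c cE] : exists c, c = (v' + b *: dvd_vec T d) 0 (Ordinal i2).
  by exists ((v' + b *: dvd_vec T d) 0 (Ordinal i2)).
have vE : v' = b *: dvd_vec T d + c *: dvd_vec T 2.
  apply/rowP => i.
  have pi : prime (nth 0%N T i) by apply/T_prime/mem_nth.
  have [i2E|i2E] := eqVneq (nth 0%N T i) 2%N.
    have Ei : i = Ordinal i2.
      by apply: val_inj; rewrite /= -[LHS](index_uniq 0%N (ltn_ord i) T_uniq) i2E.
    have d1 : dvd_vec T 2 0 i = 1 by rewrite mxE i2E.
    rewrite mxE [(_ *: dvd_vec T 2) 0 i]mxE d1 mulr1 cE Ei [(v' + _) 0 _]mxE.
    by rewrite addrCA F2_addxx addr0.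
  have d2 : dvd_vec T 2 0 i = 0 by rewrite mxE dvdn_prime2 // (negbTE i2E).
  rewrite [RHS]mxE [(_ *: dvd_vec T 2) 0 i]mxE d2 mulr0 addr0.
  have [di|ndi] := boolP (nth 0%N T i %| d)%N.
    have d1 : dvd_vec T d 0 i = 1 by rewrite mxE di.
    rewrite mxE d1 mulr1 bE; congr (v' 0 _); apply: val_inj.
    rewrite /= -[LHS](index_uniq 0%N (ltn_ord i) T_uniq); congr (index _ _).
    apply/eqP; rewrite -dvdn_prime2 //; move: (nth 0%N T i) pi i2E di => l pl l2.
    by case: dE => [->|[-> _] //]; rewrite Euclid_dvdM // dvdn_prime2 // (negbTE l2).
  have d1 : dvd_vec T d 0 i = 0 by rewrite mxE (negbTE ndi).
  rewrite [RHS]mxE d1 mulr0 v'E !mxE.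
  have := H _ pi i2E ndi; rewrite logn_ram_norm_nth // oddb.
  case/orP: (F2_case (v 0 i)) => /eqP->; case: (e); case: (_ %| _)%N => //= _; exact/eqP.
exists e%:R, b, c; split; last first.
  rewrite -addrA -vE v'E addrCA [X in _ + X](_ : _ = 0) ?addr0 //.
  by apply/rowP => i; rewrite !mxE F2_addxx.
move=> c0; apply: two_norm_of_class.
have -> : dvd_vec T 2 = c *: dvd_vec T 2.
  by move: c0; case/orP: (F2_case c) => /eqP->; rewrite ?eqxx // scale1r.
have -> : c *: dvd_vec T 2 = v' + b *: dvd_vec T d.
  by rewrite vE addrAC [X in X + _](_ : _ = 0) ?add0r //; apply/rowP => i; rewrite !mxE F2_addxx.
apply: class_mul; last exact/class_scale/class_dvd_vec_d.
by rewrite v'E; apply: class_mul => //; exact/class_scale/class_dvd_vec_M.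
Qed.

Lemma PolyaGroup_biquadratic (two : bool) r : (two <-> two_norm) ->
  (2 + two + r = size T)%N -> subgroup_iso (PolyaGroup K) [set: 'rV['Z_2]_r].
Proof.
move=> twoP Er.
pose ws := [:: dvd_vec T M; dvd_vec T d; dvd_vec T 2].
(* With [2 + two] rows, the vector of [2] is kept exactly when it is a relation. *)
pose A : 'M['F_2]_(2 + two, size T) := \matrix_(i < 2 + two) nth 0 ws i.
have mulA (u : 'rV['F_2]_(2 + two)) : exists a b c : 'F_2,
    [/\ u *m A = a *: dvd_vec T M + b *: dvd_vec T d + c *: dvd_vec T 2,
        c != 0 -> two & a = 0 -> b = 0 -> c = 0 -> u = 0].
  rewrite mulmx_sum_row /A; case: (two) u => u.
    rewrite !big_ord_recl big_ord0 !rowK /= addr0 addrA.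
    do 3!eexists; split; first by [].
      by [].
    move=> a0 b0 c0; apply/rowP => -[[|[|[|]]] // i3]; rewrite [RHS]mxE.
    - by rewrite -[RHS]a0; congr (u 0 _); apply: val_inj.
    - by rewrite -[RHS]b0; congr (u 0 _); apply: val_inj.
    - by rewrite -[RHS]c0; congr (u 0 _); apply: val_inj.
  rewrite !big_ord_recl big_ord0 !rowK /= addr0.
  do 2!eexists; exists 0; split; first by rewrite scale0r addr0.
    by rewrite eqxx.
  move=> a0 b0 _; apply/rowP => -[[|[|]] // i3]; rewrite [RHS]mxE.
  - by rewrite -[RHS]a0; congr (u 0 _); apply: val_inj.
  - by rewrite -[RHS]b0; congr (u 0 _); apply: val_inj.
have mulA' (a b c : 'F_2) : (c != 0 -> two) -> exists u : 'rV['F_2]_(2 + two),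
    a *: dvd_vec T M + b *: dvd_vec T d + c *: dvd_vec T 2 = u *m A.
  move=> c2; exists (\row_i nth 0 [:: a; b; c] i).
  rewrite mulmx_sum_row /A; case: (two) c2 => c2.
    by rewrite !big_ord_recl big_ord0 !rowK !mxE /= addr0 addrA.
  rewrite !big_ord_recl big_ord0 !rowK !mxE /= addr0.
  by have [->|/c2] := eqVneq c 0; rewrite ?scale0r ?addr0.
apply: (PolyaGroup_iso T_prime ramified_T unramified_T
  (PolyaIdealE galK gal1 gal_norm fin_mod) (M := A)) => [|v].
- apply: etrans _ Er; congr (_ + _)%N; apply/eqP; rewrite -/(row_free A).
  apply: inj_row_free => u uA0; have [a [b [c [E _ u0]]]] := mulA u.
  (* Evaluated at [l0], [d0] and [2] in this order, the system is triangular. *)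
  have ev l : l \in T -> a * ((l %| M)%N)%:R + b * ((l %| d)%N)%:R + c * ((l %| 2)%N)%:R = 0.
    move=> lT; have il : (index l T < size T)%N by rewrite index_mem.
    have /rowP/(_ (Ordinal il)) := E; rewrite uA0 !mxE /= nth_index //.
  have l02 : (l0 %| 2)%N = false.
    by rewrite dvdn_prime2 //; apply/negbTE; apply: contraTneq l0_ge5 => ->.
  have d02 : (d0 %| 2)%N = false.
    by rewrite dvdn_prime2 //; apply/negbTE; apply: contraTneq d0_odd => ->.
  have d0d : (d0 %| d)%N by case: dE => [->|[-> _]]; rewrite ?dvdn_mull.
  have az : a = 0.
    have := ev l0; rewrite mem_T l0_prime l0_M !orbT => /(_ isT).
    by rewrite (negbTE l0_d) l02 mulr1 !mulr0 !addr0.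
  have bz : b = 0.
    have := ev d0; rewrite mem_T d0_prime d0d !orbT => /(_ isT).
    by rewrite az d02 mul0r mulr1 mulr0 add0r addr0.
  apply: u0 => //.
  have := ev 2; rewrite mem_T /= => /(_ isT).
  by rewrite az bz !mul0r !add0r mulr1.
- rewrite kernel_span; split=> [[a [b [c [c2 ->]]]]|/submxP[u ->]].
    by have [|u ->] := mulA' a b c; [move=> c0; apply/twoP/c2 | exact: submxMl].
  by have [a [b [c [-> c2 _]]]] := mulA u; exists a, b, c; split=> // c0; apply/twoP/c2.
Qed.

End Biquadratic.

(** * Choice of the radicands *)

(** Euclid's argument: [4 * B! - 1] cannot have only prime factors congruent to 1. *)
Lemma prime_mod4_3 (B : nat) : exists l, [/\ prime l, (B < l)%N & (l %% 4 = 3)%N].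
Proof.
pose n := (4 * B`! - 1)%N.
have n3 : (n %% 4 = 3)%N.
  have f0 := fact_gt0 B; have -> : n = (B`!.-1 * 4 + 3)%N by rewrite /n; lia.
  by rewrite modnMDl.
have n0 : (0 < n)%N by case: n n3.
have [l [pl ln l4]] : exists l, [/\ prime l, (l %| n)%N & (l %% 4 = 3)%N].
  apply: contrapT => no.
  have : (n %% 4 = 1)%N; last by rewrite n3.
  rewrite (prod_prime_decomp n0) big_seq; elim/big_ind: _ => //.
    by move=> a b a1 b1; rewrite -modnMm a1 b1.
  move=> [l e] /mem_prime_decomp[pl e0 len] /=.
  have ln : (l %| n)%N by apply: dvdn_trans len; rewrite dvdn_exp.
  have l1 : (l %% 4 = 1)%N.
    have lodd : odd l.
      by case: (even_prime pl) => // l2; move: n3 (ln); rewrite l2 => n3 /dvdnP[k kE]; rewrite kE in n3; lia.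
    have : (l %% 4 <> 3)%N by move=> l3; apply: no; exists l.
    by move: lodd; rewrite (divn_eq l 4); have := ltn_pmod l (isT : 0 < 4)%N; lia.
  by rewrite -modnXm l1 exp1n.
exists l; split=> //; rewrite ltnNge; apply/negP => lB.
have lf : (l %| 4 * B`!)%N by rewrite dvdn_mull // dvdn_fact // prime_gt0.
have : (l %| 1)%N.
  have f0 := fact_gt0 B.
  by have := dvdn_sub lf ln; rewrite /n subKn //; lia.
by rewrite dvdn1 => /eqP l1; rewrite l1 in pl.
Qed.

(** Modulo a prime factor [l] of [(2 * B!) ^ 2 + 1] the element [a = 2 * B!] squares to [- 1]. If
    [l = 3 (mod 4)] this gives [a ^ l = - a], against Fermat's [a ^ l = a]. *)
Lemma prime_mod4_1 (B : nat) : exists l, [/\ prime l, (B < l)%N & (l %% 4 = 1)%N].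
Proof.
pose n := ((2 * B`!) ^ 2 + 1)%N.
have f0 := fact_gt0 B.
have n1 : (1 < n)%N by rewrite /n addn1 ltnS expn_gt0 muln_gt0 f0.
pose l := pdiv n; have pl : prime l := pdiv_prime n1.
have ln : (l %| n)%N by exact: pdiv_dvd.
have nl m : (m %| 2 * B`!)%N -> (m %| n)%N -> m = 1%N.
  move=> m1 mn; apply/eqP; rewrite -dvdn1.
  have m2 : (m %| (2 * B`!) ^ 2)%N by apply: dvdn_trans m1 _; rewrite dvdn_exp.
  by rewrite -(dvdn_addr 1 m2).
exists l; split=> //.
  rewrite ltnNge; apply/negP => lB.
  have lf : (l %| B`!)%N by rewrite dvdn_fact // prime_gt0.
  by move: pl; rewrite (nl l (dvdn_mull _ lf) ln).
have lodd : odd l.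
  by case: (even_prime pl) => // l2; have := nl l; rewrite l2 dvdn_mulr // -{1}l2 => /(_ isT ln).
have [l1|l3] : (l %% 4 = 1)%N \/ (l %% 4 = 3)%N.
  by move: lodd; rewrite (divn_eq l 4); have := ltn_pmod l (isT : 0 < 4)%N; lia.
  by [].
pose a : 'F_l := (2 * B`!)%:R.
have a2 : a ^+ 2 = - 1.
  apply/eqP; rewrite -addr_eq0 /a -natrX -(natrD _ _ 1).
  by rewrite -(dvdn_pcharf (pchar_Fp pl)).
have al : a ^+ l = a by rewrite -[l in a ^+ l](card_Fp pl) expf_card.
have lE : l = (2 * (2 * (l %/ 4) + 1) + 1)%N by rewrite {1}(divn_eq l 4) l3; lia.
have aE n' k : n' = (2 * (2 * k + 1) + 1)%N -> a ^+ n' = - a.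
  by move=> ->; rewrite exprD exprM a2 expr1 addn1 exprS exprM sqrrN !expr1n mulr1 mulN1r.
have := aE _ _ lE; rewrite al => /eqP; rewrite -addr_eq0 -mulr2n -mulr_natr mulf_eq0 => /orP[/eqP a0|].
  by move/eqP: a2; rewrite a0 expr0n eq_sym oppr_eq0 oner_eq0.
rewrite -(dvdn_pcharf (pchar_Fp pl)) dvdn_prime2 // => /eqP l2.
by move: lodd; rewrite l2.
Qed.

(** All primes but the last are congruent to 1, and the last corrects the residue of [c]. Each prime
    serves as the bound for the next, which keeps them distinct. *)
Lemma exists_primes_mod4 k : forall c B, odd c -> exists s : seq nat,
  [/\ size s = k.+1, all prime s, all (fun l => B < l)%N s, uniq s &
    ((c * \prod_(l <- s) l) %% 4 = 3)%N].
Proof.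
elim: k => [|k IH] c B oc.
  have c13 : (c %% 4 = 1)%N \/ (c %% 4 = 3)%N.
    by move: oc; rewrite {1}(divn_eq c 4); have := ltn_pmod c (isT : 0 < 4)%N; lia.
  case: c13 => c4.
    have [l [pl Bl l4]] := prime_mod4_3 B.
    by exists [:: l]; rewrite /= pl Bl big_seq1 -modnMm c4 l4.
  have [l [pl Bl l4]] := prime_mod4_1 B.
  by exists [:: l]; rewrite /= pl Bl big_seq1 -modnMm c4 l4.
have [l [pl Bl l4]] := prime_mod4_1 B.
have ol : odd l by rewrite (divn_eq l 4) l4 oddD oddM andbF.
have [|s [ss ps Bs us s4]] := IH (c * l)%N l; first by rewrite oddM oc ol.
exists (l :: s); rewrite /= ss pl ps Bl us big_cons mulnA s4 ?andbT; split=> //.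
  by apply/allP => j js; exact: ltn_trans Bl (allP Bs j js).
by apply/negP => ls; have := allP Bs l ls; rewrite /= ltnn.
Qed.

Lemma dvdn_prod_primes (L : seq nat) l : all prime L -> prime l ->
  (l %| \prod_(j <- L) j)%N = (l \in L).
Proof.
move=> + pl; elim: L => [|j L IH] /=; first by rewrite big_nil dvdn1; case: l pl => [|[]].
by case/andP=> pj pL; rewrite big_cons Euclid_dvdM // IH // inE dvdn_prime2.
Qed.

Lemma squarefree_prod_primes (L : seq nat) l : all prime L -> uniq L -> prime l ->
  ~~ (l ^ 2 %| \prod_(j <- L) j)%N.
Proof.
move=> pL uL pl; apply/negP => l2.
have lL : l \in L.
  by rewrite -dvdn_prod_primes //; apply: dvdn_trans l2; rewrite dvdn_exp.
move: l2; rewrite (big_rem l) //= -mulnn dvdn_pmul2l ?prime_gt0 //.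
rewrite dvdn_prod_primes //; first by rewrite mem_rem_uniq // inE eqxx.
by apply/allP => j /mem_rem jL; exact: (allP pL j jL).
Qed.

Lemma prime_not_square (l n : nat) (r : rat) : prime l -> (l %| n)%N -> ~~ (l ^ 2 %| n)%N ->
  (0 < n)%N -> r ^+ 2 != n%:R.
Proof.
move=> pl ln l2n n0; apply/eqP => E.
have /(logn_sqr_class l (isT : 0 < 1)%N n0) : 1%:R * r ^+ 2 = n%:R by rewrite mul1r.
have : (0 < logn l n)%N by rewrite logn_gt0 mem_primes pl n0.
by move: l2n; rewrite pfactor_dvdn // -ltnNge ltnS logn1; case: (logn l n) => [|[]].
Qed.

(* [d0] is the odd prime factor of [d]; [l0] makes the square class of [M] independent of [2] and [d], and
   excludes roots of unity other than [1] and [- 1]. *)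
Record admissible (M d d0 l0 : nat) : Prop := Admissible {
  adm_d0 : prime d0;
  adm_d0_odd : odd d0;
  adm_d : d = (2 * d0)%N \/ d = d0 /\ (d %% 4 = 3)%N;
  adm_d_ge5 : (5 <= d)%N;
  adm_M_gt0 : (0 < M)%N;
  adm_M_sqf : forall l, prime l -> ~~ (l ^ 2 %| M)%N;
  adm_M_mod4 : (M %% 4 = 3)%N;
  adm_l0 : prime l0;
  adm_l0_ge5 : (5 <= l0)%N;
  adm_l0_M : (l0 %| M)%N;
  adm_l0_d : ~~ (l0 %| d)%N
}.

Lemma adm_nsq M d d0 l0 : admissible M d d0 l0 -> forall r : rat, r ^+ 2 != d%:R.
Proof.
case=> pd0 od0 dE d5 _ _ _ _ _ _ _ r.
have d0d : (d0 %| d)%N by case: dE => [->|[-> _]]; rewrite ?dvdn_mull.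
apply: (prime_not_square r pd0 d0d); last exact: leq_trans d5.
apply/negP; case: dE => [->|[-> _]].
  rewrite Gauss_dvdr; last first.
    by rewrite coprime_pexpl // prime_coprime // dvdn_prime2 //; case: eqP od0 => // ->.
  move/(dvdn_leq (prime_gt0 pd0)); rewrite leqNgt -{1}(expn1 d0) ltn_exp2l //; exact: prime_gt1.
move/(dvdn_leq (prime_gt0 pd0)); rewrite leqNgt -{1}(expn1 d0) ltn_exp2l //; exact: prime_gt1.
Qed.

Lemma Kmn_sqrt (M d : nat) : exists x y : Kmn (- M%:Z) d%:Z,
  [/\ Kmn_embed (- M%:Z) d%:Z x = sqrtC (- M%:Z)%:~R, x ^+ 2 = - M%:R, y ^+ 2 = d%:R &
    <<1 & [:: x; y]>>%VS = fullv].
Proof.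
have [x [y [Ex Ey gen]]] := Kmn_gen (- M%:Z) d%:Z; exists x, y; split=> //.
  apply: (fmorph_inj (Kmn_embed (- M%:Z) d%:Z)).
  by rewrite rmorphXn rmorphN rmorph_nat Ex sqrtCK rmorphN.
apply: (fmorph_inj (Kmn_embed (- M%:Z) d%:Z)).
by rewrite rmorphXn rmorph_nat Ey sqrtCK.
Qed.

Lemma Kmn_biquadratic M d d0 l0 : admissible M d d0 l0 -> biquadratic (- M%:Z) d%:Z.
Proof.
move=> adm; have nsq := adm_nsq adm; case: adm => pd0 od0 dE d5 M0 _ _ _ _ _ _.
have [x [y [_ x2 y2 gen]]] := Kmn_sqrt M d.
split.
- by move=> k; apply/eqP => E; have := sqr_ge0 k; rewrite -E; lia.
- move=> k; apply: contraNneq (nsq k%:~R) => E.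
  by rewrite -intr_exp -E.
- exact: (dim_biquadratic (in_alg _) x2 y2 gen M0 nsq).
Qed.

Lemma Kmn_polya M d d0 l0 (two : bool) r : admissible M d d0 l0 -> (two <-> two_norm d) ->
  (2 + two + r = size (primes (2 * d * M)))%N ->
  subgroup_iso (PolyaGroup (Kmn (- M%:Z) d%:Z)) [set: 'rV['Z_2]_r].
Proof.
move=> adm; have nsq := adm_nsq adm; case: adm => pd0 od0 dE d5 M0 Msq M4 pl0 l05 l0M l0d twoP Er.
have [x [y [_ x2 y2 gen]]] := Kmn_sqrt M d.
exact: (PolyaGroup_biquadratic (in_alg _) x2 y2 gen M0 (leq_trans (ltn0Sn 4) d5) nsq
  pd0 od0 dE Msq M4 d5 pl0 l05 l0M l0d twoP Er).
Qed.

(** Otherwise [- M'] would be a square in the first field, hence in the class of [1], [- M], [d] or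
    [- M * d]. Signs exclude two of these, and the odd valuation of [M'] at [l'] the other two. *)
Lemma subfieldC_neq M M' d d0 l0 l' : admissible M d d0 l0 -> (0 < M')%N -> prime l' ->
  (l' %| M')%N -> ~~ (l' ^ 2 %| M')%N -> ~~ (l' %| M)%N -> ~~ (l' %| d)%N ->
  subfieldC (- M%:Z) d%:Z <> subfieldC (- M'%:Z) d%:Z.
Proof.
move=> adm M'0 pl' l'M' l'2 l'M l'd E; have nsq := adm_nsq adm.
case: adm => pd0 od0 dE d5 M0 _ _ _ _ _ _.
have [x [y [_ x2 y2 gen]]] := Kmn_sqrt M d.
have [x' [_ [Ex' _ _ _]]] := Kmn_sqrt M' d.
have : subfieldC (- M'%:Z) d%:Z (sqrtC (- M'%:Z)%:~R) by exists x'.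
rewrite -E => -[z _ Ez].
have z2 : z ^+ 2 = in_alg _ (- M'%:R).
  apply: (fmorph_inj (Kmn_embed (- M%:Z) d%:Z)).
  have -> : in_alg _ (- M'%:R) = - M'%:R :> Kmn (- M%:Z) d%:Z by rewrite rmorphN rmorph_nat.
  by rewrite rmorphXn Ez sqrtCK !rmorphN rmorph_nat.
have [s Hs] := rational_sqr (emb := in_alg _) x2 y2 gen M0 nsq z2.
have par (a : nat) : (0 < a)%N -> ~~ (l' %| a)%N -> a%:R * s ^+ 2 <> M'%:R.
  move=> a0 l'a /(logn_sqr_class l' a0 M'0).
  have : (0 < logn l' M')%N by rewrite logn_gt0 mem_primes pl' M'0.
  rewrite [logn l' a]lognE (negbTE l'a) !andbF.
  by move: l'2; rewrite pfactor_dvdn // -ltnNge ltnS; case: (logn l' M') => [|[]].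
have M'q : 0 < M'%:R :> rat by rewrite ltr0n.
have s0 := sqr_ge0 s; have ds0 : 0 <= d%:R * s ^+ 2 by rewrite mulr_ge0 ?ler0n.
case: Hs => Hs.
- by move: Hs M'q s0; clear; lra.
- by apply: (par M) => //; apply: oppr_inj; rewrite Hs mulNr.
- by move: Hs M'q ds0; clear; lra.
- apply: (par (M * d)%N); first by rewrite muln_gt0 M0 (leq_trans _ d5).
    by rewrite Euclid_dvdM // negb_or l'M.
  by apply: oppr_inj; rewrite Hs natrM mulNr; congr (- _); ring.
Qed.

Lemma PolyaGroup_common (K L : fieldExtType rat) r :
  subgroup_iso (PolyaGroup K) [set: 'rV['Z_2]_r] ->
  subgroup_iso (PolyaGroup L) [set: 'rV['Z_2]_r] -> subgroup_iso (PolyaGroup K) (PolyaGroup L).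
Proof.
apply: subgroup_iso_common; last exact: PolyaGroupM; last exact: PolyaGroupM.
by exists 1%g => A [].
Qed.

Section Radicand.

Variables p q r : nat.
Hypotheses (p_prime : prime p) (q_prime : prime q) (p_odd : odd p) (q_odd : odd q).
Hypotheses (pq : p = (2 * q + 1)%N) (r_ge1 : (1 <= r)%N).

Let pq_bounds : [/\ (2 < q)%N, (q < p)%N, (5 <= 2 * q)%N, (5 <= p)%N & (p %% 4 = 3)%N].
Proof.
have q3 : (2 < q)%N by have := prime_gt1 q_prime; case: q q_odd => [|[|[|]]].
rewrite pq; split=> //; try by clear -q3; lia.
by rewrite -(odd_double_half q) q_odd -muln2; clear; lia.
Qed.

(** One [M] has to serve both fields; the size equations are the rank formula for [d = 2 * q] and
    [d = p]. The bound on [l0] later separates fields of different radicands. *)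
Definition good_radicand (B M : nat) := exists l0 : nat,
  [/\ (B < l0)%N, admissible M (2 * q) q l0, admissible M p p l0,
    (2 + `[< two_norm (2 * q) >] + r = size (primes (2 * (2 * q) * M)))%N &
    (2 + `[< two_norm p >] + r = size (primes (2 * p * M)))%N].

Lemma exists_good_radicand B : exists M, good_radicand B M.
Proof.
set t1 := `[< two_norm (2 * q) >]; set t2 := `[< two_norm p >].
(* A factor [p] of the radicand ramifies additionally in the field with [d = 2 q] only, a factor [q] in the one
   with [d = p] only; they compensate the relation given by [two_norm]. *)
pose c := nseq t2 q ++ nseq t1 p.
have oc : odd (\prod_(l <- c) l).
  rewrite /c; case: (t1); case: (t2) => /=; rewrite ?big_cons big_nil ?oddM ?p_odd ?q_odd //.
(* The lemma delivers one prime more than its argument, whence [r.-1]. Primes above [2 * p] divide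
   neither value of [d] and differ from [2], [q] and [p]. *)
have [s [ss ps Bs us s4]] := exists_primes_mod4 r.-1 (B + 2 * p) oc.
rewrite prednK // in ss.
have [q3 qltp q5 p5 p3] := pq_bounds.
have Bsl l : l \in s -> [/\ prime l, (B < l)%N & (2 * p < l)%N].
  move=> ls; have Bl : (B + 2 * p < l)%N := allP Bs l ls.
  split; first exact: (allP ps l ls).
    exact: leq_ltn_trans (leq_addr _ _) Bl.
  exact: leq_ltn_trans (leq_addl _ _) Bl.
have ns l : (l <= p)%N -> l \notin s.
  move=> lp; apply/negP => /Bsl[_ _]; rewrite ltnNge (leq_trans lp) //.
  by rewrite leq_pmull.
have qs : q \notin s by exact/ns/ltnW.
have p_s : p \notin s by exact: ns.
have s2 : 2%N \notin s by apply: ns; apply: leq_trans p5.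
have qp : q != p by rewrite neq_ltn qltp.
have q2 : (2%N == q) = false by rewrite ltn_eqF.
have p2 : (2%N == p) = false by rewrite ltn_eqF // (leq_trans _ p5).
pose L := c ++ s.
have ME : (\prod_(l <- L) l = (\prod_(l <- c) l) * \prod_(l <- s) l)%N by rewrite big_cat.
have uc : uniq c by rewrite /c; case: (t1); case: (t2); rewrite /= ?inE ?qp.
have uL : uniq L.
  rewrite cat_uniq uc us andbT; apply/hasPn => l ls /=.
  rewrite /c mem_cat !mem_nseq; apply/negP => /orP[]/andP[_ /eqP E]; move: ls.
    by rewrite E (negbTE qs).
  by rewrite E (negbTE p_s).
have pL : all prime L.
  rewrite all_cat ps andbT /c; case: (t1); case: (t2); rewrite /= ?p_prime ?q_prime //.
have M0 : (0 < \prod_(l <- L) l)%N.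
  by rewrite big_seq; apply: prodn_cond_gt0 => l lL; exact/prime_gt0/(allP pL l lL).
have Msq l : prime l -> ~~ (l ^ 2 %| \prod_(j <- L) j)%N by exact: squarefree_prod_primes.
have un (b : bool) a : a \notin s -> uniq (nseq b a ++ s) by move=> na; case: b; rewrite /= ?na.
case sE : s ss => [|l0 s'] ss; first by have := r_ge1; rewrite -ss.
have l0s : l0 \in s by rewrite sE mem_head.
have [pl0 Bl0 l0p] := Bsl _ l0s.
have M4 : ((\prod_(l <- L) l) %% 4 = 3)%N by rewrite ME.
have l0M : (l0 %| \prod_(l <- L) l)%N by rewrite dvdn_prod_primes // mem_cat l0s orbT.
have l0_5 : (5 <= l0)%N by apply: leq_trans p5 _; apply: leq_trans (ltnW l0p); rewrite leq_pmull.
have l0_ge n : (0 < n)%N -> (n <= 2 * p)%N -> ~~ (l0 %| n)%N.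
  by move=> n0 np; apply/negP => /(dvdn_leq n0); rewrite leqNgt (leq_ltn_trans np).
exists (\prod_(l <- L) l)%N, l0; split=> //.
- split=> //; first by left.
  by apply: l0_ge; [rewrite muln_gt0 (prime_gt0 q_prime) | rewrite leq_pmul2l // ltnW].
- split=> //; first by right.
  by apply: l0_ge; [exact: prime_gt0 | rewrite leq_pmull].
(* A factor [q] of the radicand already divides [d] and adds no prime here. *)
- have -> : size (primes (2 * (2 * q) * \prod_(l <- L) l)) = size (2%N :: q :: nseq t1 p ++ s).
    apply/perm_size/uniq_perm; first exact: primes_uniq.
      rewrite /= (un _ _ p_s) andbT !inE !mem_cat !mem_nseq q2 p2 (negbTE qp) !andbF.
      by rewrite (negbTE s2) (negbTE qs).
    move=> l; rewrite mem_primes !muln_gt0 M0 ?(prime_gt0 q_prime) ?(prime_gt0 p_prime) /= !inE mem_cat mem_nseq.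
    have [pl|npl] /= := boolP (prime l).
      rewrite !Euclid_dvdM // dvdn_prod_primes // !dvdn_prime2 // !mem_cat !mem_nseq.
      by case: (l == 2%N); case: (l == q); case: (l == p); case: (t1); case: (t2); case: (l \in s).
    apply/esym/negbTE; apply: contra npl => /or4P[/eqP->|/eqP->|/andP[_ /eqP->]|ls] //; exact: (allP ps l ls).
  by rewrite /= size_cat size_nseq sE ss -addnA.
- have -> : size (primes (2 * p * \prod_(l <- L) l)) = size (2%N :: p :: nseq t2 q ++ s).
    apply/perm_size/uniq_perm; first exact: primes_uniq.
      rewrite /= (un _ _ qs) andbT !inE !mem_cat !mem_nseq q2 p2 [p == q]eq_sym (negbTE qp) !andbF.
      by rewrite (negbTE s2) (negbTE p_s).
    move=> l; rewrite mem_primes !muln_gt0 M0 ?(prime_gt0 q_prime) ?(prime_gt0 p_prime) /= !inE mem_cat mem_nseq.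
    have [pl|npl] /= := boolP (prime l).
      rewrite !Euclid_dvdM // dvdn_prod_primes // !dvdn_prime2 // !mem_cat !mem_nseq.
      by case: (l == 2%N); case: (l == q); case: (l == p); case: (t1); case: (t2); case: (l \in s).
    apply/esym/negbTE; apply: contra npl => /or4P[/eqP->|/eqP->|/andP[_ /eqP->]|ls] //; exact: (allP ps l ls).
  by rewrite /= size_cat size_nseq sE ss -addnA.
Qed.

End Radicand.

Theorem theorem1p1 (p q r : nat) (p_prime : prime p) (q_prime : prime q)
    (p_odd : odd p) (q_odd : odd q) (pq : p = (2 * q + 1)%N)
    (r_ge1 : (1 <= r)%N) (r_even : ~~ odd r) :
  infinite_set
    [set F : set algC * set algC | exists m : int,
       [/\ F = (subfieldC m (p%:Z - 1), subfieldC m p%:Z),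
           biquadratic m (p%:Z - 1) /\ biquadratic m p%:Z,
           subgroup_iso (PolyaGroup (Kmn m (p%:Z - 1))) (PolyaGroup (Kmn m p%:Z))
         & subgroup_iso (PolyaGroup (Kmn m p%:Z)) [set: 'rV['Z_2]_r]]].
Proof.
have dE : p%:Z - 1 = (2 * q)%:Z by rewrite pq; lia.
have /choice[f fP] := exists_good_radicand p_prime q_prime p_odd q_odd pq r_ge1.
(* Each radicand is built with a bound beyond the preceding one, so its prime [l0] divides none of
   the earlier radicands. *)
pose b n := iter n (fun B => f (B + p)%N) 0%N.
have f_gt B : (B < f B)%N.
  have [l0 [Bl0 adm _ _ _]] := fP B; apply: leq_trans Bl0 _.
  by apply: dvdn_leq; [exact: adm_M_gt0 adm | exact: adm_l0_M adm].
have b_lt i j : (i < j)%N -> (b i.+1 <= b j)%N.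
  elim: j => // j IH; rewrite ltnS leq_eqVlt => /orP[/eqP->//|/IH bij].
  by apply: leq_trans bij _; rewrite /b /=; apply: leq_trans (leq_addr p _) (ltnW (f_gt _)).
pose F n : set algC * set algC :=
  (subfieldC (- (b n.+1)%:Z) (p%:Z - 1), subfieldC (- (b n.+1)%:Z) p%:Z).
apply: (@infinite_set_inj _ _ F) => [|n]; last first.
  have [l0 [_ adm1 adm2 E1 E2]] := fP (b n + p)%N.
  have iso1 := Kmn_polya adm1 (iff_sym (rwP (asboolP _))) E1.
  have iso2 := Kmn_polya adm2 (iff_sym (rwP (asboolP _))) E2.
  exists (- (b n.+1)%:Z); rewrite dE; split=> //.
  - by rewrite /F dE.
  - by split; [exact: Kmn_biquadratic adm1 | exact: Kmn_biquadratic adm2].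
  - exact: PolyaGroup_common iso1 iso2.
(* Already the second components, the fields with [d = p], differ. *)
have neq i j : (i < j)%N -> F i <> F j.
  move=> ij [_]; have [li [_ _ admi _ _]] := fP (b i + p)%N.
  have [lj [Blj _ admj _ _]] := fP (b j + p)%N.
  have bij := b_lt _ _ ij.
  apply: (subfieldC_neq admi (adm_M_gt0 admj) (adm_l0 admj) (adm_l0_M admj)).
  - exact/(adm_M_sqf admj)/(adm_l0 admj).
  - apply/negP => /(dvdn_leq (adm_M_gt0 admi)); apply/negP; rewrite -ltnNge.
    by apply: leq_ltn_trans Blj; apply: leq_trans bij (leq_addr _ _).
  - exact: adm_l0_d admj.
move=> i j E; case: (ltngtP i j) => // ij; first by case: (neq _ _ ij).
by case: (neq _ _ ij).
Qed.
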